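(* Let $\theta>0$ and let $(S_t)_{t\ge 0}$ be the geometric subordinator $$S_t=1-\prod_{(\tau_j,\xi_j):\,\tau_j\le t}(1-\xi_j),$$ where $\{(\tau_j,\xi_j)\}$ are the atoms of a Poisson point process in the strip $[0,\infty)\times[0,1]$ with intensity measure $\mathrm{Lebesgue}\times\omega$ and $$\mathrm{d}\omega(z)=z^{-1}(1-z)^{\theta-1}\,\mathrm{d}z .$$ Let $U_g$ be the complement in $[0,1]$ of the closure of the random set $\{S_t:t>0\}$. Then the composition structure derived from the paintbox $U_g$ is $g$; that is, for every $n\ge1$ and every composition $\lambda=(\lambda_1,\ldots,\lambda_\ell)$ of $n$, the probability that the random composition of $n$ derived from $U_g$ equals $\lambda$ is $$g(\lambda)=\frac{n!}{[\theta]_n}\prod_{j=1}^{\ell}\frac{1}{\lambda_j\,h_\theta(\Lambda_j)},$$ where $\Lambda_j=\lambda_j+\cdots+\lambda_\ell$ and $h_\theta(m)=\sum_{k=1}^{m}\frac{1}{\theta+k-1}$.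
   Context: A composition of weight $n$ and length $\ell$ is an ordered sequence $\lambda=(\lambda_1,\ldots,\lambda_\ell)$ of positive integers with $\sum_j\lambda_j=n$ (written $\lambda\vdash n$). The Pochhammer factorial is $[x]_n=x(x+1)\cdots(x+n-1)$, $[x]_0=1$. A composition structure is a nonnegative function $q$ on compositions such that for each $n$ the values $\{q(\lambda):\lambda\vdash n\}$ form a probability distribution $q_n$, and the $q_n$'s are sampling consistent: if balls are placed in an ordered series of nonempty boxes with occupancy numbers, from left to right, distributed according to $q_n$, and $k<n$ balls are removed uniformly at random, then the reduced occupancy numbers of the nonempty boxes (in the same order) have distribution $q_{n-k}$. Paintbox construction: a paintbox is a random open subset $U$ of $[0,1]$. It induces an ordered partition of $[0,1]$ whose blocks are the component intervals of $U$ and the individual points of the complement $U^c=[0,1]\setminus U$, ordered by the order on the reals. Sample $n$ independent uniform points from $[0,1]$, independently of $U$; recording the nonzero numbers of sample points in the blocks, from left to right, gives a random composition of $n$. The composition structure derived from $U$ assigns to each $\lambda\vdash n$ the probability that this random composition equals $\lambda$. The measure $\omega$ is infinite, but $\int_0^1 z\,\mathrm{d}\omega(z)<\infty$, so the Poisson process has (almost surely) countably many atoms and the (infinite) product defining $S_t$ converges for each $t$; the labeling of atoms by $j$ is arbitrary. $(S_t)$ is a pure-jump process with increasing càdlàg paths, called a geometric subordinator because for $t'>t$ the ratio $(1-S_{t'})/(1-S_t)$ is independent of the path on $[0,t]$ and has the same distribution as $1-S_{t'-t}$. *)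

(* Defs.v *)
From HB Require Import structures.
From mathcomp Require Import all_boot all_order all_algebra finmap.
From mathcomp Require Import all_classical all_reals all_analysis.
From mathcomp Require Import measurable_realfun.

Set Implicit Arguments.
Unset Strict Implicit.
Unset Printing Implicit Defensive.

Import Order.TTheory GRing.Theory Num.Theory.
Import numFieldNormedType.Exports.

Local Open Scope classical_set_scope.
Local Open Scope ring_scope.

Definition is_composition (n : nat) (lambda : seq nat) : bool :=
  all (leq 1) lambda && (sumn lambda == n).

Section composition_function.
Context {R : realType}.
Implicit Types (theta x : R) (lambda : seq nat).

Definition pochhammer x (n : nat) : R := \prod_(0 <= i < n) (x + i%:R).

Definition h theta (m : nat) : R :=
  \sum_(1 <= k < m.+1) (theta + k%:R - 1)^-1.

(* The parts are indexed from 0, so that sumn (drop j lambda) is the sum of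
   the part of index j and of all the parts to its right. *)
Definition g theta lambda : R :=
  (sumn lambda)`!%:R / pochhammer theta (sumn lambda) *
  \prod_(0 <= j < size lambda)
    ((nth 0%N lambda j)%:R * h theta (sumn (drop j lambda)))^-1.

End composition_function.

Section probability_notions.
Context {R : realType} {d : measure_display} {T : measurableType d}.
Variable P : probability T R.

Definition mutual_independence (I : choiceType) (F : I -> set (set T)) : Prop :=
  forall (J : {fset I}) (A : I -> set T), (forall i, i \in J -> F i (A i)) ->
    P (\bigcap_(i in [set` J]) A i) = (\prod_(i <- J) P (A i))%E.

(* The probability of E with respect to the completion of P: E itself need
   not be measurable, as it may behave arbitrarily on a null set. *)
Definition has_probability (E : set T) (p : \bar R) : Prop :=
  exists A : set T,
    [/\ measurable A, {ae P, forall w, A w <-> E w} & P A = p].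

Definition ae_events (G : set (set T)) : set (set T) :=
  [set D | measurable D /\ exists2 E, G E & {ae P, forall w, D w <-> E w}].

End probability_notions.

Section poisson_process.
Context {R : realType} {d d' : measure_display}.
Context {T : measurableType d} {S : measurableType d'}.
Implicit Types (P : probability T R) (x : nat -> T -> S) (A : set S).

(* Atoms are counted with multiplicity. *)
Definition atom_count x A (w : T) : \bar R := counting [set j | A (x j w)].

(* Poisson distribution with mean m, where m may be infinite; poisson_prob
   does not depend on its nat argument, here 0. *)
Definition poisson_law P (N : T -> \bar R) (m : \bar R) : Prop :=
  match m with
  | r%:E => forall k : nat,
      P [set w | N w = k%:R%:E] = poisson_prob r 0 [set k]
  | _ => P [set w | N w = +oo%E] = 1%E
  end.

(* The atoms x 0, x 1, ... of a Poisson point process with intensity mu.  Only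
   the counts of atoms in measurable sets are required to be random variables,
   so the labeling of the atoms is arbitrary; as it uses all of nat, this
   covers the processes with almost surely infinitely many atoms. *)
Record poisson_process P (mu : set S -> \bar R) x : Prop := {
  poisson_process_measurable : forall A, measurable A ->
    measurable_fun setT (atom_count x A);
  poisson_process_law : forall A, measurable A ->
    poisson_law P (atom_count x A) (mu A);
  poisson_process_independent : forall (k : nat) (A : 'I_k -> set S),
    (forall i, measurable (A i)) -> trivIset setT A ->
    mutual_independence P
      (fun i => preimage_set_system setT (atom_count x (A i)) measurable)
}.

End poisson_process.

Section paintbox.
Context {R : realType}.
Implicit Types (U : set R) (xs : seq R).

(* The block, containing x, of the ordered partition induced by U. *)
Definition paintbox_block U (x : R) : set R :=
  if x \in U then connected_component U x else [set x].

(* The blocks are intervals, so listing the blocks of the sample points in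
   increasing order of the points lists the occupied blocks from left to
   right. *)
Definition occupied_blocks U xs : seq (set R) :=
  undup [seq paintbox_block U x | x <- sort <=%R xs].

Definition paintbox_composition U xs : seq nat :=
  [seq count (fun x => x \in B) xs | B <- occupied_blocks U xs].

End paintbox.

Section sampling.
Context {R : realType} {d : measure_display} {T : measurableType d}.
Implicit Types (P : probability T R) (U : T -> set R).

(* The sigma-algebra generated by the random open subset U of [0, 1]: it is
   the one induced by the Borel sigma-algebra of the Fell (or Hausdorff)
   topology on the complements of the open subsets. *)
Definition open_set_events U : set (set T) :=
  <<s range (fun ab : R * R => [set w | `[ab.1, ab.2] `<=` U w]) >>.

(* X consists of n independent uniform points of [0, 1], independent of U;
   the index None stands for U. *)
Definition uniform_sample P U (n : nat) (X : 'I_n -> {RV P >-> R}) : Prop :=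
  (forall i (B : set R), measurable B ->
     distribution P (X i) B = uniform_prob (@ltr01 R) B) /\
  mutual_independence P (fun i : option 'I_n =>
    match i with
    | Some i => preimage_set_system setT (X i) measurable
    | None => ae_events P (open_set_events U)
    end).

End sampling.

Section geometric_subordinator.
Context {R : realType}.
Variable theta : R.

Let density (z : R) : R := z^-1 * (1 - z) `^ (theta - 1).

Definition omega (B : set R) : \bar R :=
  (\int[lebesgue_measure]_(z in B `&` `[0%R, 1%R])
     (z^-1 * (1 - z) `^ (theta - 1))%:E)%E.

Let measurable_density :
  measurable_fun (`[0, 1] : set R) (fun z => (density z)%:E).
Proof.
apply: (eq_measurable_fun
    (fun z : R => (z `^ (- 1) * (1 - z) `^ (theta - 1))%:E)).
  by move=> z /set_mem/=; rewrite in_itv/= => /andP[z0 _]; rewrite powR_inv1.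
apply: measurable_funTS; apply/measurable_EFinP; apply: measurable_funM.
  exact: measurable_powR.
apply: (measurableT_comp (measurable_powR (theta - 1))).
exact: measurable_funB.
Qed.

Let omega0 : omega set0 = 0%E.
Proof. by rewrite /omega set0I integral_set0. Qed.

Let density_ge0 B z : (B `&` `[0, 1]) z -> (0 <= (density z)%:E)%E.
Proof.
move=> [_] /=; rewrite in_itv/= => /andP[z0 _].
by rewrite lee_fin mulr_ge0 ?invr_ge0 ?powR_ge0.
Qed.

Let omega_ge0 B : (0 <= omega B)%E.
Proof. by apply: integral_ge0 => z; exact: density_ge0. Qed.

Let omega_sigma_additive : semi_sigma_additive omega.
Proof.
move=> /= F mF tF mUF; apply: cvg_toP.
  apply: ereal_nondecreasing_is_cvgn => m n mn.
  by apply: lee_sum_nneg_natr => // k _ _; exact: omega_ge0.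
rewrite /omega setI_bigcupl ge0_integral_bigcup//=.
- by move=> k; apply: (measurableI _ _ (mF k)); exact: (@measurable_itv R).
- rewrite -setI_bigcupl.
  apply: (measurable_funS (@measurable_itv R _) _ measurable_density).
  exact: subIsetr.
- by move=> z [k _]; exact: density_ge0.
- exact: trivIset_setIr.
Qed.

HB.instance Definition _ := isMeasure.Build _ _ _ omega
  omega0 omega_ge0 omega_sigma_additive.

Definition strip_intensity : set (R * R) -> \bar R :=
  (mrestr lebesgue_measure (measurable_itv `[0%R, +oo[) \x omega)%E.

(* a j is the atom (tau_j, xi_j).  Almost surely all the factors are in [0, 1],
   so that the partial products decrease to a limit that does not depend on
   the labeling. *)
Implicit Type a : nat -> R * R.

Definition geometric_subordinator a (t : R) : R :=
  1 - limn (fun n => \prod_(0 <= j < n | (a j).1 <= t) (1 - (a j).2)).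

Definition geometric_paintbox a : set R :=
  `[0, 1] `\` closure [set geometric_subordinator a t | t in [set t | 0 < t]].

End geometric_subordinator.

(* Main.v *)
(* Let L = 1 - S and delta = 2^-N.  The factors by which L is multiplied over the
   time cells (k delta, (k+1) delta] are independent copies of a variable r with
   E r^m = exp (- delta h(m)), because the integral of 1 - (1-z)^m with respect
   to omega is h(m); to see this, the sizes of the jumps are rounded down to
   finitely many values, whose numbers of occurrences are independent Poisson
   variables.  Replace the blocks of the paintbox by the cells
   [S(k delta), S((k+1) delta)).  The probability that a uniform sample,
   independent of all the atoms, occupies the cells with the counts lambda is a
   sum of products of the moments E (1-r)^a r^b; it satisfies an affine recursion
   in the number of cells, hence has a limit, which is a product over the parts
   of lambda.  As N tends to infinity, E (1-r)^a r^b is asymptotically delta times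
   a Beta integral, 1 - E r^m is asymptotically delta h(m), and the product tends
   to g(lambda).

   The cells and the blocks give the same composition for large N once the sample
   points are at a positive distance from the range of S.  This holds almost
   surely: the same moments show that, with probability arbitrarily close to 1, a
   sample point lies well inside a cell over which S has a macroscopic jump.

   The given sample is independent of U only, not of the atoms.  So the above is
   carried out for a sample adjoined to the probability space, and transferred:
   the composition is the limit of functions of the dyadic cells of the sample
   points and of finitely many events of the form [q,r] `<=` U, which have the
   same expectation for both samples. *)

Require Import Defs.
From mathcomp Require Import all_boot all_order all_algebra finmap.
From mathcomp Require Import all_classical all_reals all_analysis.
From mathcomp Require Import measurable_realfun.
From mathcomp Require Import ring lra.

Set Implicit Arguments.
Unset Strict Implicit.
Unset Printing Implicit Defensive.

Import Order.TTheory GRing.Theory Num.Theory.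
Import numFieldNormedType.Exports.

Local Open Scope classical_set_scope.
Local Open Scope ring_scope.

(** * Expectations of bounded random variables *)

(** The hypotheses give access to the atoms only through counts in measurable sets: a single atom
    need not be a random variable, and S is a limit of products over an arbitrary labeling. So a
    quantity is integrated only after it is expressed by finitely many counts. Rounding the sizes
    down can only enlarge the products, hence each factor r is the infimum of its roundings, and
    this infimum is measurable without any exceptional set.

    The form of g comes from the first cell of the grid. Either it is empty, which costs a factor r
    for each point, or it takes exactly the first part, which costs 1 - r for each of its points and
    r for each point to its right. So every part contributes a Beta integral divided by h of the
    number of points not yet placed; the Beta denominators multiply to the Pochhammer factorial and
    the values of h remain.

    The grids are dyadic so that a grid time stays one at all finer levels: once two sample points
    are separated by a grid, they are separated by all later ones. By right continuity the values of
    S at dyadic times determine U, which makes the conditions on U countable. *)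

Section bounded_expectation.
Context {R : realType} {d : measure_display} {T : measurableType d}.
Variable P : probability T R.
Implicit Types f g : T -> R.

(** Everything integrated below is bounded, so expectations can be real numbers and integrability is
    automatic. *)
Definition bounded_rv f :=
  measurable_fun setT f /\ exists C, forall w, `|f w| <= C.

Definition Ex f : R := \int[P]_w f w.

Lemma bounded_rv_integrable f : bounded_rv f -> P.-integrable setT (EFin \o f).
Proof.
move=> [mf [C fC]]; apply: measurable_bounded_integrable => //.
  by apply: (le_lt_trans (probability_le1 P measurableT)); rewrite ltry.
by exists C; split; [exact: num_real | move=> x Cx w _; exact: le_trans (fC w) (ltW Cx)].
Qed.

Lemma bounded_rv_cst c : bounded_rv (fun=> c).
Proof. by split; [exact: measurable_cst | exists `|c|]. Qed.

Lemma bounded_rvD f g : bounded_rv f -> bounded_rv g ->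
  bounded_rv (fun w => f w + g w).
Proof.
move=> [mf [C fC]] [mg [D gD]]; split; first exact: measurable_funD.
exists (C + D) => w; exact: le_trans (ler_normD _ _) (lerD (fC w) (gD w)).
Qed.

Lemma bounded_rvM f g : bounded_rv f -> bounded_rv g ->
  bounded_rv (fun w => f w * g w).
Proof.
move=> [mf [C fC]] [mg [D gD]]; split; first exact: measurable_funM.
by exists (C * D) => w; rewrite normrM ler_pM.
Qed.

Lemma bounded_rvB f g : bounded_rv f -> bounded_rv g ->
  bounded_rv (fun w => f w - g w).
Proof.
move=> [mf [C fC]] [mg [D gD]]; split; first exact: measurable_funB.
exists (C + D) => w; exact: le_trans (ler_normB _ _) (lerD (fC w) (gD w)).
Qed.

Lemma bounded_rvX f n : bounded_rv f -> bounded_rv (fun w => f w ^+ n).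
Proof.
move=> bf; elim: n => [|n IH]; first exact: bounded_rv_cst.
by under eq_fun => w do rewrite exprS; exact: bounded_rvM.
Qed.

Lemma bounded_rv_prod (I : Type) (s : seq I) (p : pred I) (F : I -> T -> R) :
  (forall i, p i -> bounded_rv (F i)) ->
  bounded_rv (fun w => \prod_(i <- s | p i) F i w).
Proof.
move=> bF; elim: s => [|i s IH].
  by under eq_fun => w do rewrite big_nil; exact: bounded_rv_cst.
case pi: (p i); under eq_fun => w do rewrite big_cons pi; last by [].
exact: bounded_rvM (bF _ pi) IH.
Qed.

Lemma bounded_rv_sum (I : Type) (s : seq I) (p : pred I) (F : I -> T -> R) :
  (forall i, p i -> bounded_rv (F i)) ->
  bounded_rv (fun w => \sum_(i <- s | p i) F i w).
Proof.
move=> bF; elim: s => [|i s IH].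
  by under eq_fun => w do rewrite big_nil; exact: bounded_rv_cst.
case pi: (p i); under eq_fun => w do rewrite big_cons pi; last by [].
exact: bounded_rvD (bF _ pi) IH.
Qed.

Lemma bounded_rv_indic (A : set T) : measurable A -> bounded_rv \1_A.
Proof.
move=> mA; split; first exact: measurable_indic.
by exists 1 => w; rewrite indicE; case: (_ \in _); rewrite ?normr1 ?normr0.
Qed.

Lemma bounded_rv01 f : measurable_fun setT f -> (forall w, 0 <= f w <= 1) ->
  bounded_rv f.
Proof.
by move=> mf f01; split => //; exists 1 => w; case/andP: (f01 w) => *; rewrite ger0_norm.
Qed.

Lemma ExD f g : bounded_rv f -> bounded_rv g ->
  Ex (fun w => f w + g w) = Ex f + Ex g.
Proof. by move=> bf bg; apply: RintegralD => //; exact: bounded_rv_integrable. Qed.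

Lemma ExB f g : bounded_rv f -> bounded_rv g ->
  Ex (fun w => f w - g w) = Ex f - Ex g.
Proof. by move=> bf bg; apply: RintegralB => //; exact: bounded_rv_integrable. Qed.

Lemma ExZl c f : bounded_rv f -> Ex (fun w => c * f w) = c * Ex f.
Proof. by move=> bf; apply: RintegralZl => //; exact: bounded_rv_integrable. Qed.

Lemma Ex_cst c : Ex (fun=> c) = c.
Proof.
transitivity (c * fine (P setT)); first exact: Rintegral_cst.
by rewrite probability_setT mulr1.
Qed.

Lemma le_Ex f g : bounded_rv f -> bounded_rv g -> (forall w, f w <= g w) ->
  Ex f <= Ex g.
Proof. by move=> bf bg fg; apply: le_Rintegral => //; exact: bounded_rv_integrable. Qed.

Lemma Ex_sum (I : Type) (s : seq I) (p : pred I) (F : I -> T -> R) :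
  (forall i, p i -> bounded_rv (F i)) ->
  Ex (fun w => \sum_(i <- s | p i) F i w) = \sum_(i <- s | p i) Ex (F i).
Proof.
move=> bF; elim: s => [|i s IH].
  by under [in LHS]eq_fun => w do rewrite big_nil; rewrite big_nil Ex_cst.
rewrite big_cons; case pi: (p i);
  under [in LHS]eq_fun => w do rewrite big_cons pi; last by [].
by rewrite ExD ?IH//; [exact: bF | exact: bounded_rv_sum].
Qed.

Lemma Ex_indic (A : set T) : measurable A -> (Ex \1_A)%:E = P A.
Proof.
move=> mA; rewrite /Ex /Rintegral integral_indic// setIT fineK//.
exact: fin_num_measure.
Qed.

Lemma EFin_Ex f : bounded_rv f -> (Ex f)%:E = (\int[P]_w (f w)%:E)%E.
Proof.
move=> bf; rewrite fineK//; apply: integrable_fin_num => //.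
exact: bounded_rv_integrable.
Qed.

Lemma Ex_cvg (f_ : nat -> T -> R) f (C : R) :
  (forall n, measurable_fun setT (f_ n)) -> (forall n w, `|f_ n w| <= C) ->
  bounded_rv f -> {ae P, forall w, f_ ^~ w @ \oo --> f w} ->
  (fun n => Ex (f_ n)) @ \oo --> Ex f.
Proof.
move=> mf_ fC bf cf.
have [//|||||_ _ c] := @dominated_convergence _ _ _ P setT measurableT
  (fun n => EFin \o f_ n) (EFin \o f) (cst C%:E).
- by move=> n; exact/measurable_EFinP.
- by apply/measurable_EFinP; case: bf.
- by apply: filterS cf => w cw _; apply: cvg_EFin => //; exact: nearW.
- exact: finite_measure_integrable_cst.
- by apply: aeW => w n _; rewrite /= lee_fin.
by apply/fine_cvg; rewrite -EFin_Ex in c.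
Qed.

End bounded_expectation.

Lemma poisson_prob1 (R : realType) (r : R) (k b : nat) : 0 <= r ->
  poisson_prob r k [set b] = (r ^+ b / b`!%:R * expR (- r))%:E.
Proof.
rewrite /poisson_prob; case: ltP => [r0 _|r0 r0'].
  by rewrite esum_set1/= ?lee_fin ?poisson_pmf_ge0// /poisson_pmf r0.
(* For r = 0 the law is the Dirac mass at 0 by default; the formula gives the same since 0 ^+ 0 =
   1. *)
have -> : r = 0 by apply/eqP; rewrite eq_le r0 r0'.
rewrite oppr0 expR0 mulr1 diracE; case: b => [|b].
  by rewrite expr0 fact0 divr1 mem_set.
by rewrite exprS !mul0r memNset.
Qed.

Lemma measurable_truncn (R : realType) : measurable_fun [set: R] (@Num.truncn R).
Proof.
move=> _ Y _; rewrite setTI.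
have -> : @Num.truncn R @^-1` Y = \bigcup_(k in Y) (@Num.truncn R @^-1` [set k]).
  by apply/seteqP; split => [x Yx | x [k Yk /= xk]]; [exists (Num.truncn x) | rewrite /= xk].
apply: bigcup_measurable => k _.
have mle m : measurable [set x : R | (Num.truncn x <= m)%N].
  rewrite (_ : [set _ | _] = `]-oo, m.+1%:R[%classic); first exact: measurable_itv.
  by apply/seteqP; split => x /=; rewrite in_itv/= truncn_le_nat.
case: k => [|k].
  rewrite (_ : _ @^-1` _ = [set x : R | (Num.truncn x <= 0)%N]); first exact: mle.
  by apply/seteqP; split => x /=; rewrite leqn0 => /eqP.
rewrite (_ : _ @^-1` _ = [set x : R | (Num.truncn x <= k.+1)%N] `\`
    [set x | (Num.truncn x <= k)%N]); first exact: measurableD.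
apply/seteqP; split => x /=; first by move=> ->; rewrite leqnn ltnn.
by move=> [le1 /negP]; rewrite -ltnNge => le2; apply/eqP; rewrite eqn_leq le1.
Qed.

(** * Independent Poisson counts *)

Section poisson_counts.
Context {R : realType} {d : measure_display} {T : measurableType d}.
Variable P : probability T R.

(** An infinite count is read as 0, because [fine] sends +oo to 0; for a finite mean this concerns
    only a null set. *)
Definition nat_count (x : \bar R) : nat := Num.truncn (fine x).

Lemma nat_countE (k : nat) : nat_count k%:R%:E = k.
Proof. by rewrite /nat_count/= Num.Theory.natrK. Qed.

Lemma measurable_count_eq (N : T -> \bar R) (k : nat) :
  measurable_fun setT N -> measurable [set w | N w = k%:R%:E].
Proof.
move=> mN; rewrite -[X in measurable X]setTI.
exact: (mN measurableT [set k%:R%:E] (emeasurable_set1 _)).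
Qed.

Lemma measurable_nat_count (N : T -> \bar R) (q : R) : measurable_fun setT N ->
  measurable_fun setT (fun w => q ^+ nat_count (N w)).
Proof.
move=> mN.
apply: (@measurableT_comp _ _ _ _ _ _ (fun x => q ^+ nat_count x) _ N) => //.
apply: (@measurableT_comp _ _ _ _ _ _ (fun n => q ^+ n) _ nat_count) => //.
apply: (@measurableT_comp _ _ _ _ _ _ (@Num.truncn R) _ fine).
exact: measurable_truncn.
exact: fine_measurable.
Qed.

(** The Poisson weights add up to 1, so the natural numbers carry the whole mass and +oo or other
    values have none. *)
Lemma poisson_law_ae (N : T -> \bar R) (r : R) : measurable_fun setT N ->
  poisson_law P N r%:E -> {ae P, forall w, exists k : nat, N w = k%:R%:E}.
Proof.
move=> mN PN; pose F k := [set w | N w = k%:R%:E].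
have mF k : measurable (F k) by exact: measurable_count_eq.
exists (~` \bigcup_k F k); split.
- by apply: measurableC; exact: bigcup_measurable.
- have -> : P (~` \bigcup_k F k) = (1 - P (\bigcup_k F k))%E.
    by apply: probability_setC; exact: bigcup_measurable.
  suff -> : P (\bigcup_k F k) = 1%E by rewrite subee.
  transitivity ((poisson_prob r 0 : {measure set _ -> \bar R}) (\bigcup_k [set k])).
    rewrite !measure_bigcup//.
    + by apply: eq_eseriesr => k _; exact: PN.
    + by move=> i j _ _ [w [-> ->]].
    + move=> i j _ _ [w [/= Ni]]; rewrite /F/= Ni => /eqP.
      by rewrite eqe eqr_nat => /eqP.
  have -> : \bigcup_k [set k] = [set: nat].
    by apply/seteqP; split=> // k _; exists k.
  exact: probability_setT.
- by move=> w /= H [k _ Nk]; apply: H; exists k.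
Qed.

Lemma poisson_generating_cvg (r q : R) : 0 <= r ->
  (fun B => \sum_(b < B) q ^+ b * (r ^+ b / b`!%:R * expR (- r)))
    @ \oo --> expR (- (r * (1 - q))).
Proof.
move=> r0.
have -> : expR (- (r * (1 - q))) = expR (q * r) * expR (- r).
  by rewrite -expRD; congr expR; ring.
rewrite (_ : (fun _ => _) = (fun B => series (exp_coeff (q * r)) B * expR (- r))).
  by apply: cvgMl; exact: is_cvg_series_exp_coeff.
apply/funext => B; rewrite /series/= big_mkord big_distrl/=.
by apply: eq_bigr => b _; rewrite /exp_coeff/= exprMn; ring.
Qed.

Section family.
Variables (I : finType) (N : I -> T -> \bar R) (r q : I -> R).
Hypothesis mN : forall i, measurable_fun setT (N i).
Hypothesis indepN :
  mutual_independence P (fun i => preimage_set_system setT (N i) measurable).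
Hypothesis r_ge0 : forall i, 0 <= r i.
Hypothesis lawN : forall i, poisson_law P (N i) (r i)%:E.
Hypothesis q01 : forall i, 0 <= q i <= 1.

Let ev i (b : nat) : set T := [set w | N i w = b%:R%:E].

Let mev i b : measurable (ev i b).
Proof. exact: measurable_count_eq. Qed.

Let prob_ev (b : I -> nat) :
  P (\bigcap_i ev i (b i)) = (\prod_i P (ev i (b i)))%E.
Proof.
have := indepN (J := [fset i in enum I]%fset) (A := fun i => ev i (b i)).
have -> : [set` [fset i in enum I]%fset] = setT :> set I.
  by apply/seteqP; split => // i _ /=; rewrite inE/= mem_enum.
move=> ->.
  have /(perm_big _) -> : perm_eq [fset i in enum I]%fset (enum I).
    apply: uniq_perm; rewrite ?fset_uniq ?enum_uniq// => i.
    by rewrite inE.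
  by rewrite big_enum.
move=> i _; exists [set (b i)%:R%:E]; first exact: emeasurable_set1.
by rewrite setTI.
Qed.

(** This is q^N cut off to 0 when N >= B: a finite combination of indicators, so that the
    independence of events is enough to compute expectations of products. *)
Let trunc B i w : R := \sum_(b < B) q i ^+ b * \1_(ev i b) w.

Let bounded_trunc B i : bounded_rv (trunc B i).
Proof.
apply: bounded_rv_sum => b _; apply: bounded_rvM; first exact: bounded_rv_cst.
exact: bounded_rv_indic.
Qed.

Let truncE B i w k : N i w = k%:R%:E ->
  trunc B i w = if (k < B)%N then q i ^+ k else 0.
Proof.
move=> Nk; case: ifPn => kB; last first.
  rewrite /trunc big1// => b _; rewrite indicE memNset ?mulr0//=.
  rewrite /ev/= Nk => /eqP; rewrite eqe eqr_nat => /eqP kb.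
  by rewrite kb ltn_ord in kB.
rewrite /trunc (bigD1 (Ordinal kB))//= indicE mem_set// mulr1 big1 ?addr0// => b.
move=> bk; rewrite indicE memNset ?mulr0//.
rewrite /ev/= Nk => /eqP; rewrite eqe eqr_nat => /eqP kb.
by move: bk; rewrite -val_eqE/= kb eqxx.
Qed.

Let Ex_trunc B : Ex P (fun w => \prod_i trunc B i w) =
  \prod_i \sum_(b < B) q i ^+ b * (r i ^+ b / b`!%:R * expR (- r i)).
Proof.
rewrite bigA_distr_bigA/=.
under [in LHS]eq_fun => w do rewrite /trunc bigA_distr_bigA/=.
rewrite Ex_sum; last first.
  move=> f _; apply: bounded_rv_prod => i _.
  by apply: bounded_rvM; [exact: bounded_rv_cst | exact: bounded_rv_indic].
apply: eq_bigr => f _.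
under [in LHS]eq_fun => w do rewrite big_split/=.
have e : (fun w => \prod_i \1_(ev i (f i)) w) = \1_(\bigcap_i ev i (f i)) :> (T -> R).
  apply/funext => w; rewrite indicE; case: (boolP (_ \in _)) => [/set_mem H|].
    by rewrite big1// => i _; rewrite indicE mem_set//; exact: H.
  move=> /negP H; apply/eqP; rewrite prodf_seq_eq0.
  apply/negPn/negP => /hasPn H2; apply: H; apply/mem_set => i _.
  by have := H2 i (mem_index_enum i); rewrite indicE; case: (boolP (w \in _)) => [/set_mem|]//=; rewrite eqxx.
rewrite ExZl; last by rewrite e; apply: bounded_rv_indic; exact: fin_bigcap_measurable.
rewrite e big_split/=; congr (_ * _).
apply: EFin_inj; rewrite Ex_indic; last exact: fin_bigcap_measurable.
rewrite prob_ev -prodEFin; apply: eq_bigr => i _.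
by rewrite lawN poisson_prob1.
Qed.

(** Product of the generating functions exp(- r (1 - q)): the truncated products are computed
    exactly, and B tends to infinity by dominated convergence on one side and by the exponential
    series on the other. *)
Lemma Ex_prod_poisson : Ex P (fun w => \prod_i q i ^+ nat_count (N i w)) =
  \prod_i expR (- (r i * (1 - q i))).
Proof.
have c1 : (fun B => Ex P (fun w => \prod_i trunc B i w)) @ \oo -->
    \prod_i expR (- (r i * (1 - q i))).
  under eq_fun => B do rewrite Ex_trunc.
  apply: cvg_big => [|i _]; first exact: mul_continuous.
  exact: poisson_generating_cvg.
have trunc01 B i w : 0 <= trunc B i w <= 1.
  have [[k Nk]|Nk] := pselect (exists k : nat, N i w = k%:R%:E).
    rewrite (truncE _ Nk); case/andP: (q01 i) => q0 q1; case: ifP => _.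
      by rewrite exprn_ge0// exprn_ile1.
    by rewrite lexx ler01.
  rewrite /trunc big1 ?lexx ?ler01// => b _; rewrite indicE memNset ?mulr0//.
  by move=> Nb; apply: Nk; exists b.
have bp : bounded_rv (fun w => \prod_i q i ^+ nat_count (N i w)).
  apply: bounded_rv_prod => i _; apply: bounded_rv01.
    exact: measurable_nat_count.
  by move=> w; case/andP: (q01 i) => q0 q1; rewrite exprn_ge0// exprn_ile1.
have c2 : (fun B => Ex P (fun w => \prod_i trunc B i w)) @ \oo -->
    Ex P (fun w => \prod_i q i ^+ nat_count (N i w)).
  apply: (@Ex_cvg _ _ _ _ _ _ 1) => //.
  - by move=> B; case: (@bounded_rv_prod _ _ _ _ (index_enum I) xpredT (trunc B)).
  - move=> B w; rewrite ger0_norm ?prodr_ge0//.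
      by apply: prodr_ile1 => i _; exact: trunc01.
    by move=> i _; case/andP: (trunc01 B i w).
  - have : {ae P, forall w, forall i, exists k : nat, N i w = k%:R%:E}.
      apply: filter_forall => i; exact: poisson_law_ae (lawN i).
    apply: filterS => w Nw; apply: cvg_big => [|i _]; first exact: mul_continuous.
    have [k Nk] := Nw i; apply: cvg_near_cst; near=> B.
    rewrite (truncE _ Nk) Nk nat_countE ifT//.
    by near: B; exact: nbhs_infty_gt.
exact: (cvg_unique _ c2 c1).
Unshelve. all: by end_near. Qed.

End family.
End poisson_counts.

(** * The Laplace exponent *)

Section omega_integrals.
Context {R : realType}.
Implicit Types (a theta : R).
Local Notation mu := (@lebesgue_measure R).

Lemma is_derive_onem_powR a (x : R) : x < 1 ->
  is_derive x 1 (fun z : R => (1 - z) `^ a) (- (a * (1 - x) `^ (a - 1))).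
Proof.
move=> x1.
have d1 : is_derive x 1 (fun z : R => 1 - z) (-1).
  have := is_deriveB (is_derive_cst (1 : R) x 1) (is_derive_id x (1 : R)).
  by rewrite sub0r.
have d2 : is_derive (1 - x) 1 (@powR R ^~ a) (a * (1 - x) `^ (a - 1)).
  by apply: is_derive1_powR; rewrite subr_gt0.
have := @is_derive1_comp _ (@powR R ^~ a) (fun z : R => 1 - z) x _ _ d2 d1.
by rewrite mulrN1.
Qed.

Lemma is_derive_onem_powR_primitive a (x : R) : x < 1 -> a != 0 ->
  is_derive x 1 (fun z : R => - a^-1 * (1 - z) `^ a) ((1 - x) `^ (a - 1)).
Proof.
move=> x1 a0.
have := @is_deriveZ _ _ _ _ (- a^-1) _ _ _ (is_derive_onem_powR a x1).
by rewrite /GRing.scale/= mulrNN mulrA mulVf ?mul1r.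
Qed.

Lemma measurable_onem_powR a : measurable_fun setT (fun z : R => (1 - z) `^ a).
Proof.
apply: (measurableT_comp (measurable_powR a)).
exact: measurable_funB.
Qed.

(** For a < 1 the integrand is unbounded near 1, so the fundamental theorem of calculus is applied
    on [0, 1 - e n] and followed by monotone convergence. *)
Lemma integral_onem_powR a : 0 < a ->
  (\int[mu]_(z in `[0%R, 1%R]) ((1 - z) `^ (a - 1))%:E = (a^-1)%:E)%E.
Proof.
move=> a0.
have mf D : measurable_fun D (fun z : R => ((1 - z) `^ (a - 1))%:E).
  by apply/measurable_EFinP/measurable_funTS; exact: measurable_onem_powR.
rewrite -integral_itv_bndo_bndc; last exact: mf.
pose e n : R := n.+2%:R^-1.
have e0 n : 0 < e n by rewrite invr_gt0.
have e1 n : e n < 1 by rewrite invf_lt1// ltr1n.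
pose F n := `[0%R, 1 - e n]%classic.
have UF : \bigcup_n F n = `[0%R, 1%R[%classic.
  apply/seteqP; split => x.
    move=> [n _]; rewrite /F/= !in_itv/= => /andP[-> xe].
    by apply: le_lt_trans xe _; rewrite ltrBlDr ltrDl.
  rewrite /= in_itv/= => /andP[x0 x1].
  have [k xk] := ltr_add_invr x1; exists k => //.
  rewrite /F/= in_itv/= x0/= lerBrDr (le_trans _ (ltW xk))// lerD2l.
  by rewrite lef_pV2 ?posrE// ler_nat.
have IF n : (\int[mu]_(z in F n) ((1 - z) `^ (a - 1))%:E =
    (a^-1 - a^-1 * e n `^ a)%:E)%E.
  rewrite (@continuous_FTC2 _ _ (fun z : R => - a^-1 * (1 - z) `^ a)).
  - rewrite -EFinB subr0 powR1 mulr1 opprK subKr mulNr addrC//.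
  - by rewrite subr_gt0.
  - apply: derivable_within_continuous => x; rewrite in_itv/= => /andP[_ xe].
    have x1 : x < 1 by apply: le_lt_trans xe _; rewrite ltrBlDr ltrDl.
    by case: (is_derive_onem_powR (a - 1) x1).
  - have d x : x < 1 -> derivable (fun z : R => - a^-1 * (1 - z) `^ a) x 1.
      by move=> x1; case: (is_derive_onem_powR_primitive x1 (lt0r_neq0 a0)).
    have c x : x < 1 -> {for x, continuous (fun z : R => - a^-1 * (1 - z) `^ a)}.
      by move=> x1; apply: differentiable_continuous; apply/derivable1_diffP; exact: d.
    split.
    + move=> x; rewrite in_itv/= => /andP[_ xe]; apply: d.
      by apply: lt_trans xe _; rewrite ltrBlDr ltrDl.
    + by apply: cvg_at_right_filter; exact: c.
    + by apply: cvg_at_left_filter; apply: c; rewrite ltrBlDr ltrDl.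
  - move=> x; rewrite in_itv/= => /andP[_ xe].
    have x1 : x < 1 by apply: lt_trans xe _; rewrite ltrBlDr ltrDl.
    by rewrite derive1E; have [_ ->] := is_derive_onem_powR_primitive x1 (lt0r_neq0 a0).
have c1 : (fun n => \int[mu]_(z in F n) ((1 - z) `^ (a - 1))%:E)%E @ \oo -->
    (\int[mu]_(z in `[0%R, 1%R[) ((1 - z) `^ (a - 1))%:E)%E.
  rewrite -UF; apply: (@ge0_nondecreasing_set_cvg_integral _ (measurableTypeR R)).
  - move=> m n mn; apply/subsetPset => x; rewrite /F/= !in_itv/= => /andP[-> xe].
    by rewrite (le_trans xe)// lerB// lef_pV2 ?posrE// ler_nat.
  - by move=> n; exact: measurable_itv.
  - by move=> n; exact: mf.
  - by move=> i x _; rewrite lee_fin powR_ge0.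
have c2 : (fun n => \int[mu]_(z in F n) ((1 - z) `^ (a - 1))%:E)%E @ \oo -->
    (a^-1)%:E.
  rewrite (_ : (fun _ => _) = EFin \o (fun n => a^-1 - a^-1 * e n `^ a)); last first.
    by apply/funext => n; exact: IF.
  apply: cvg_EFin; first exact: nearW.
  rewrite -[X in _ --> X]subr0; apply: cvgB; first exact: cvg_cst.
  rewrite -[X in _ --> X](mulr0 a^-1); apply: cvgMr.
  apply: ((cvg_at_rightP (@powR R ^~ a) 0 0).1 (powR_cvg0 a0)); split=> //.
  by have := @cvg_harmonic R; rewrite -cvg_shiftS.
exact: cvg_unique c1 c2.
Qed.

Variable theta : R.
Hypothesis theta_gt0 : 0 < theta.

Definition omega_density (z : R) : R := z^-1 * (1 - z) `^ (theta - 1).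

Lemma measurable_omega_density (D : set R) : D `<=` `[0, 1]%classic ->
  measurable D -> measurable_fun D omega_density.
Proof.
move=> D01 mD.
apply: (eq_measurable_fun (fun z : R => z `^ (- 1) * (1 - z) `^ (theta - 1))).
  by move=> z /set_mem/D01/=; rewrite in_itv/= => /andP[z0 _]; rewrite powR_inv1.
apply: measurable_funTS; apply: measurable_funM.
  exact: measurable_powR.
exact: measurable_onem_powR.
Qed.

Lemma omega_density_ge0 z : 0 <= z -> 0 <= omega_density z.
Proof. by move=> z0; rewrite mulr_ge0 ?invr_ge0// powR_ge0. Qed.

(** A jump z multiplies (1 - S)^m by (1 - z)^m; the factor 1 - (1 - z)^m is of first order at 0 and
    makes the density of omega integrable there. *)
Definition thinned_density (m : nat) (z : R) : R :=
  (1 - (1 - z) ^+ m) * omega_density z.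

Lemma thinned_density_ge0 m z : 0 <= z <= 1 -> 0 <= thinned_density m z.
Proof.
move=> /andP[z0 z1]; rewrite mulr_ge0 ?omega_density_ge0// subr_ge0 exprn_ile1//.
  by rewrite subr_ge0.
by rewrite lerBlDr lerDl.
Qed.

(** Geometric sum: (1 - (1 - z)^m) / z is the sum of the (1 - z)^k for k < m. Integrated term by
    term it yields the reciprocals in h. *)
Lemma thinned_densityE m z : 0 < z <= 1 ->
  thinned_density m z = \sum_(k < m) (1 - z) `^ (theta + k%:R - 1).
Proof.
move=> /andP[z0 z1]; elim: m => [|m IH].
  by rewrite big_ord0 /thinned_density expr0 subrr mul0r.
rewrite big_ord_recr/= -IH /thinned_density /omega_density.
have -> : (1 - z) `^ (theta + m%:R - 1) = (1 - z) ^+ m * (1 - z) `^ (theta - 1).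
  (* At z = 1 the base is 0, whose powers multiply only if the exponents do not sum to 0. For m = 0
     the sum theta - 1 may vanish, hence the separate case; for larger m it cannot, as theta > 0. *)
  case: m {IH} => [|m]; first by rewrite expr0 mul1r addr0.
  rewrite -powR_mulrn ?subr_ge0// -powRD; first by congr powR; ring.
  apply/implyP => /eqP e; exfalso.
  have : 0 <= m%:R :> R by [].
  by move: e theta_gt0; rewrite -natr1; lra.
by rewrite exprS; field; rewrite gt_eqF.
Qed.

Lemma measurable_thinned_density (D : set R) m : D `<=` `[0, 1]%classic ->
  measurable D -> measurable_fun D (thinned_density m).
Proof.
move=> D01 mD; apply: measurable_funM; last exact: measurable_omega_density.
apply: measurable_funB => //; apply: measurable_funX.
exact: measurable_funB.
Qed.

Lemma integral_thinned_density m :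
  (\int[mu]_(z in `[0%R, 1%R]) (thinned_density m z)%:E = (h theta m)%:E)%E.
Proof.
rewrite -integral_itv_obnd_cbnd; last first.
  apply/measurable_EFinP; apply: measurable_thinned_density => //.
  by apply: subset_itvr; rewrite bnd_simp.
under eq_integral => z.
  rewrite inE/= in_itv/= => z01; rewrite thinned_densityE// -sumEFin; over.
have mf (k : nat) D : measurable_fun D (fun z : R => ((1 - z) `^ (theta + k%:R - 1))%:E).
  by apply/measurable_EFinP/measurable_funTS; exact: measurable_onem_powR.
rewrite /= ge0_integral_sum//; last 2 first.
- by move=> k; exact: mf.
- by move=> k z _; rewrite lee_fin powR_ge0.
rewrite /h big_add1/= big_mkord -sumEFin; apply: eq_bigr => k _.
rewrite (integral_itv_obnd_cbnd (mf k _)).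
rewrite integral_onem_powR; last by rewrite ltr_wpDr.
by congr (_^-1)%:E; rewrite -natr1; ring.
Qed.

(** The restriction to sizes in C lets one computation serve for all the jumps (C = setT) and for
    the small jumps alone, which are needed for right continuity. *)
Definition laplace_exponent (C : set R) (m : nat) : R :=
  fine (\int[mu]_(z in `[0%R, 1%R] `&` C) (thinned_density m z)%:E)%E.

Lemma laplace_exponentT m : laplace_exponent setT m = h theta m.
Proof. by rewrite /laplace_exponent setIT integral_thinned_density. Qed.

Lemma thinned_density_integrable m :
  mu.-integrable `[0, 1] (EFin \o thinned_density m).
Proof.
apply/integrableP; split.
  by apply/measurable_EFinP; exact: measurable_thinned_density.
under eq_integral => z.
  rewrite inE/= in_itv/= => z01; rewrite /= ger0_norm ?thinned_density_ge0//; over.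
by rewrite integral_thinned_density ltry.
Qed.

Lemma thinned_density1_le2 (z : R) : 0 <= z <= 2^-1 -> thinned_density 1 z <= 2.
Proof.
move=> /andP[z0 z2].
have [->|zn0] := eqVneq z 0; first by rewrite /thinned_density subr0 expr1n subrr mul0r.
rewrite thinned_densityE; last by rewrite lt_neqAle eq_sym zn0 z0/=; lra.
rewrite big_ord_recl big_ord0 addr0/= addr0.
have zz : 0 < 1 - z <= 1 by lra.
have /andP[zz0 zz1] := zz.
apply: (@le_trans _ _ ((1 - z) `^ (-1))).
  by apply: (ger_powR zz); rewrite lerBrDl subrr ltW.
rewrite powR_inv1; last exact: ltW.
by rewrite invf_ple ?posrE//; lra.
Qed.

(** For m = 1 the integrand is (1 - z)^(theta - 1), at most 1 / (1 - z) as theta > 0, hence at most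
    2 up to 1/2. *)
Lemma laplace_exponent_small (c : R) : 0 <= c <= 2^-1 ->
  0 <= laplace_exponent `]-oo, c] 1 <= 2 * c.
Proof.
move=> /andP[c0 c2]; rewrite /laplace_exponent.
have -> : `[0%R, 1%R] `&` `]-oo, c] = `[0%R, c]%classic :> set R.
  apply/seteqP; split => z /=; rewrite !in_itv/=.
    by move=> [/andP[-> _] ->].
  by move=> /andP[-> zc]; rewrite zc (le_trans zc)// (le_trans c2)// invf_le1// ler1n.
have ge0 : (0%E <= \int[mu]_(z in `[0%R, c]) (thinned_density 1 z)%:E)%E.
  apply: integral_ge0 => z /=; rewrite in_itv/= => /andP[z0 zc].
  rewrite lee_fin thinned_density_ge0// z0/= (le_trans zc)// (le_trans c2)//.
  by rewrite invf_le1// ler1n.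
have le2c : (\int[mu]_(z in `[0%R, c]) (thinned_density 1 z)%:E <= (2 * c)%:E)%E.
  have -> : (2 * c)%:E = (\int[mu]_(z in `[0%R, c]) 2%:E)%E :> \bar R.
    rewrite integral_cst//= lebesgue_measure_itv/= lte_fin.
    have [->|cn0] := eqVneq c 0; first by rewrite ltxx mule0 mulr0.
    by rewrite lt_neqAle eq_sym cn0 c0/= oppr0 adde0 EFinM.
  apply: ge0_le_integral => //.
  - move=> z /=; rewrite in_itv/= => /andP[z0 zc].
    rewrite lee_fin thinned_density_ge0// z0/= (le_trans zc)// (le_trans c2)//.
    by rewrite invf_le1// ler1n.
  - apply/measurable_EFinP; apply: measurable_thinned_density => //.
    apply: subset_itvl; rewrite bnd_simp (le_trans c2)//.
    by rewrite invf_le1 ?ler1n.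
  - move=> z /=; rewrite in_itv/= => /andP[z0 zc]; rewrite lee_fin.
    by apply: thinned_density1_le2; rewrite z0 (le_trans zc).
apply/andP; split; first exact: fine_ge0.
by rewrite -lee_fin fineK// ge0_fin_numE// (le_lt_trans le2c)// ltry.
Qed.

Lemma omega_fin (B : set R) (e : R) : measurable B -> 0 < e ->
  B `<=` `]e, +oo[%classic -> (omega theta B < +oo)%E.
Proof.
move=> mB e0 Be; rewrite /omega.
have mBI : measurable (B `&` `[0, 1]) by exact: measurableI.
have mf D : measurable_fun D (fun z : R => ((1 - z) `^ (theta - 1))%:E).
  by apply/measurable_EFinP/measurable_funTS; exact: measurable_onem_powR.
apply: (@le_lt_trans _ _
    (e^-1%:E * \int[mu]_(z in `[0%R, 1%R]) ((1 - z) `^ (theta - 1))%:E)%E); last first.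
  by rewrite integral_onem_powR// -EFinM ltry.
rewrite -ge0_integralZl//; last by rewrite lee_fin invr_ge0 ltW.
  apply: (@le_trans _ _
    (\int[mu]_(z in B `&` `[0%R, 1%R]) (e^-1%:E * ((1 - z) `^ (theta - 1))%:E))%E).
    apply: ge0_le_integral => //.
    - move=> z [/Be]/=; rewrite !in_itv/= => _ /andP[z0 _].
      by rewrite lee_fin; exact: omega_density_ge0.
    - apply/measurable_EFinP; apply: measurable_omega_density => //.
    - by apply: emeasurable_funM => //; exact: mf.
    - move=> z [/Be]/=; rewrite !in_itv/= andbT => ez _.
      by rewrite -EFinM lee_fin ler_wpM2r ?powR_ge0// lef_pV2 ?posrE ?(ltW ez)// (lt_trans e0).
  apply: ge0_subset_integral => //.
  - by apply: emeasurable_funM => //; exact: mf.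
  - by move=> z _; rewrite -EFinM lee_fin mulr_ge0 ?powR_ge0// invr_ge0 ltW.
- exact: mf.
- by move=> z _; rewrite lee_fin powR_ge0.
Qed.

(** Sizes in this cell are rounded down to i / M. The cells are open on the left, so they cover ]0,
    1], and those with i > 0 stay away from 0 and have finite omega-measure. *)
Definition z_cell (M i : nat) : set R := `]i%:R / M%:R, i.+1%:R / M%:R]%classic.

Lemma measurable_z_cell M i : measurable (z_cell M i).
Proof. exact: measurable_itv. Qed.

Lemma z_cell_uniq M i j z : z_cell M i z -> z_cell M j z -> i = j.
Proof.
wlog ij : i j / (i < j)%N.
  by move=> H zi zj; case: (ltngtP i j) => // ?; [exact: H | exact/esym/H].
rewrite /z_cell/= !in_itv/= => /andP[_ zi] /andP[jz _].
have := lt_le_trans jz zi; rewrite ltNge => /negP[].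
by rewrite ler_wpM2r ?invr_ge0// ler_nat.
Qed.

Lemma z_cell_exists M z : (0 < M)%N -> 0 < z <= 1 ->
  exists2 i, (i < M)%N & z_cell M i z.
Proof.
move=> M0 /andP[z0 z1].
have M0' : 0 < M%:R :> R by rewrite ltr0n.
have ex : exists j, z <= j%:R / M%:R by exists M; rewrite divff ?gt_eqF.
case: (ex_minnP ex) => -[|i]; first by rewrite mul0r leNgt z0.
move=> zi mini; exists i.
  by apply: mini; rewrite divff ?gt_eqF.
rewrite /z_cell/= in_itv/= zi andbT ltNge; apply/negP => /mini.
by rewrite ltnn.
Qed.

(** The value of 1 - (1 - z)^m at the rounded z; for m = 1 it is the rounded size itself, and it is
    0 outside ]0, 1]. *)
Definition floor_thinned (m M : nat) (z : R) : R :=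
  \sum_(i < M) (1 - (1 - i%:R / M%:R) ^+ m) * \1_(z_cell M i) z.

Lemma floor_thinnedE m M i z : (i < M)%N -> z_cell M i z ->
  floor_thinned m M z = 1 - (1 - i%:R / M%:R) ^+ m.
Proof.
move=> iM zi; rewrite /floor_thinned (bigD1 (Ordinal iM))//=.
rewrite indicE mem_set// mulr1 big1 ?addr0// => j ji.
rewrite indicE memNset ?mulr0// => zj; move: ji.
by rewrite -val_eqE/= (z_cell_uniq zi zj) eqxx.
Qed.

Lemma ler_exprB (x y : R) m : 0 <= y -> y <= x -> x <= 1 ->
  x ^+ m - y ^+ m <= m%:R * (x - y).
Proof.
move=> y0 yx x1; elim: m => [|m IH]; first by rewrite !expr0 subrr mul0r.
have -> : x ^+ m.+1 - y ^+ m.+1 = x ^+ m * (x - y) + (x ^+ m - y ^+ m) * y.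
  by rewrite !exprS; ring.
rewrite -natr1 [leRHS]mulrDl mul1r addrC lerD//.
  apply: le_trans IH; rewrite ler_piMr//; last exact: le_trans x1.
  by rewrite subr_ge0 lerXn2r ?nnegrE// (le_trans y0).
by rewrite ler_piMl ?subr_ge0// exprn_ile1// (le_trans y0).
Qed.

Lemma floor_thinned_bounds m M z : (0 < M)%N -> 0 < z <= 1 ->
  0 <= floor_thinned m M z <= 1 - (1 - z) ^+ m /\
  1 - (1 - z) ^+ m - floor_thinned m M z <= m%:R / M%:R.
Proof.
move=> M0 z01; have [i iM zi] := z_cell_exists M0 z01.
rewrite (floor_thinnedE m iM zi); move: zi; rewrite /z_cell/= in_itv/= => /andP[iz zi].
have M0' : 0 < M%:R :> R by rewrite ltr0n.
have i0 : 0 <= i%:R / M%:R :> R by rewrite divr_ge0.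
case/andP: z01 => z0 z1.
have zz : 0 <= 1 - z by rewrite subr_ge0.
have zi' : 1 - z <= (1 : R) - i%:R / M%:R by rewrite lerB// ltW.
have ii : 1 - i%:R / M%:R <= (1 : R) by rewrite lerBlDr lerDl.
split.
  rewrite subr_ge0 exprn_ile1 ?(le_trans zz)//= lerB// lerXn2r// nnegrE//.
  exact: le_trans zi'.
have := ler_exprB m zz zi' ii.
have : m%:R * ((1 - i%:R / M%:R) - (1 - z)) <= m%:R / M%:R.
  apply: ler_wpM2l => //; move: zi; rewrite -natr1 mulrDl mul1r; lra.
lra.
Qed.

Lemma floor_thinned_cvg m z : 0 < z <= 1 ->
  (fun M => floor_thinned m M.+1 z) @ \oo --> 1 - (1 - z) ^+ m.
Proof.
move=> z01; apply: (@squeeze_cvgr _ _ _ _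
    (fun M => 1 - (1 - z) ^+ m - m%:R * harmonic M) (fun=> 1 - (1 - z) ^+ m)).
- apply: nearW => M; have [/andP[_ b] c] := floor_thinned_bounds m (ltn0Sn M) z01.
  by rewrite b andbT lerBlDr -lerBlDl.
- rewrite -[X in _ --> X]subr0; apply: cvgB; first exact: cvg_cst.
  by rewrite -[X in _ --> X](mulr0 m%:R); apply: cvgMr; exact: cvg_harmonic.
- exact: cvg_cst.
Qed.

(** The sum is the integral over C of [floor_thinned] against omega, which is dominated by the
    integrable [thinned_density]. *)
Lemma laplace_exponent_cvg (C : set R) m : measurable C ->
  (fun M => \sum_(i < M.+1)
     fine (omega theta (z_cell M.+1 i `&` C)) * (1 - (1 - i%:R / M.+1%:R) ^+ m))
    @ \oo --> laplace_exponent C m.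
Proof.
move=> mC; pose D := `[0%R, 1%R]%classic `&` C.
have mD : measurable D by exact: measurableI.
have D01 : D `<=` `[0, 1] by exact: subIsetl.
have md A : measurable A -> A `<=` D -> measurable_fun A (fun z => (omega_density z)%:E).
  move=> mA AD; apply/measurable_EFinP; apply: measurable_omega_density => //.
  exact: subset_trans AD D01.
pose f M z := floor_thinned m M.+1 z * omega_density z.
have sumE M : (\int[mu]_(z in D) (f M z)%:E = (\sum_(i < M.+1)
     fine (omega theta (z_cell M.+1 i `&` C)) * (1 - (1 - i%:R / M.+1%:R) ^+ m))%:E)%E.
  pose c i := 1 - (1 - i%:R / M.+1%:R) ^+ m : R.
  have c0 (i : 'I_M.+1) : 0 <= c i.
    have iM : i%:R / M.+1%:R <= (1 : R).
      by rewrite ler_pdivrMr// mul1r ler_nat ltnW.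
    have i0 : 0 <= i%:R / M.+1%:R :> R by rewrite divr_ge0.
    by rewrite subr_ge0 exprn_ile1 ?subr_ge0// lerBlDr lerDl.
  pose u i z := (\1_(z_cell M.+1 i) z * omega_density z)%:E.
  have u0 i z : D z -> (0 <= u i z)%E.
    move=> [+ _] => /=; rewrite in_itv/= => /andP[z0 _].
    by rewrite lee_fin mulr_ge0 ?omega_density_ge0.
  have mu_ i : measurable_fun D (u i).
    apply/measurable_EFinP; apply: measurable_funM.
      apply: measurable_indic; exact: measurable_z_cell.
    exact: measurable_omega_density.
  transitivity (\int[mu]_(z in D) (\sum_(i < M.+1) (c i)%:E * u i z))%E.
    apply: eq_integral => z _; rewrite /f /floor_thinned mulr_suml -sumEFin.
    by apply: eq_bigr => i _; rewrite -mulrA EFinM.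
  rewrite ge0_integral_sum//; last 2 first.
  - by move=> i; apply: measurable_funeM; exact: mu_.
  - by move=> i z Dz; apply: mule_ge0; [rewrite lee_fin; exact: c0 | exact: u0].
  rewrite -sumEFin; apply: eq_bigr => i _.
  rewrite ge0_integralZl//; [|exact: mu_|exact: u0|by rewrite lee_fin].
  have -> : (\int[mu]_(z in D) u i z = omega theta (z_cell M.+1 i `&` C))%E.
    rewrite /omega (_ : _ `&` _ = D `&` z_cell M.+1 i); last first.
      by rewrite /D setIC setIA setIAC.
    rewrite [RHS]integral_mkcondr; apply: eq_integral => z _.
    rewrite patchE /u indicE; case: (z \in _); first by rewrite mul1r.
    by rewrite mul0r.
  (* The cell 0 may have infinite measure, but its coefficient is 0 on both sides. *)
  have [i0|i0] := posnP i.
    by rewrite i0 /c mul0r subr0 expr1n subrr mul0e mulr0.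
  rewrite EFinM fineK 1?muleC// ge0_fin_numE//.
  apply: (@omega_fin _ (i%:R / M.+1%:R)).
  - by apply: measurableI => //; exact: measurable_z_cell.
  - by rewrite divr_gt0// ltr0n.
  - by move=> z [+ _]; rewrite /z_cell/= !in_itv/= andbT => /andP[].
have fcvg z : D z -> (fun M => f M z) @ \oo --> thinned_density m z.
  move=> [+ _] => /=; rewrite in_itv/= => /andP[z0 z1].
  have [->|zn0] := eqVneq z 0.
    rewrite /f /thinned_density /omega_density invr0 mul0r mulr0.
    by under eq_fun do rewrite mulr0; exact: cvg_cst.
  apply: cvgMl; apply: floor_thinned_cvg.
  by rewrite lt_neqAle eq_sym zn0 z0.
have fb M z : D z -> `|f M z| <= thinned_density m z.
  move=> [+ _] => /=; rewrite in_itv/= => /andP[z0 z1].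
  have [->|zn0] := eqVneq z 0.
    by rewrite /f /thinned_density /omega_density invr0 !mul0r !mulr0 normr0.
  have z01 : 0 < z <= 1 by rewrite lt_neqAle eq_sym zn0 z0.
  have [/andP[a b] _] := floor_thinned_bounds m (ltn0Sn M) z01.
  rewrite ger0_norm; last by apply: mulr_ge0 => //; exact: omega_density_ge0.
  by apply: ler_wpM2r => //; exact: omega_density_ge0.
have [|||||_ _ c] := @dominated_convergence _ _ _ mu D mD
  (fun M z => (f M z)%:E) (fun z => (thinned_density m z)%:E)
  (fun z => (thinned_density m z)%:E).
- move=> M; apply/measurable_EFinP; apply: measurable_funM.
    apply: measurable_sum => i; apply: measurable_funM => //.
    by apply: measurable_indic; exact: measurable_z_cell.
  exact: measurable_omega_density.
- by apply/measurable_EFinP; exact: measurable_thinned_density.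
- by apply: aeW => z Dz; apply: cvg_EFin; [exact: nearW | exact: fcvg].
- apply: (@integrableS _ _ _ mu `[0%R, 1%R]) => //.
  exact: thinned_density_integrable.
- by apply: aeW => z M Dz; rewrite lee_fin fb.
rewrite /laplace_exponent.
have {}c : (fun M => \int[mu]_(z in D) (f M z)%:E)%E @ \oo -->
    (laplace_exponent C m)%:E.
  rewrite /laplace_exponent fineK//; apply: integrable_fin_num => //.
  apply: (@integrableS _ _ _ mu `[0%R, 1%R]) => //.
  exact: thinned_density_integrable.
move: c; under eq_fun do rewrite sumE.
by move=> /fine_cvg.
Qed.

End omega_integrals.

Section strip.
Local Open Scope ereal_scope.

(* [product_measure1E] without the sigma-finiteness of the second measure. *)
Lemma product_measure1_rect d1 d2 (T1 : measurableType d1)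
    (T2 : measurableType d2) (R : realType) (m1 : {measure set T1 -> \bar R})
    (m2 : {measure set T2 -> \bar R}) (A : set T1) (B : set T2) :
  measurable A -> measurable B -> (m1 \x m2) (A `*` B) = m1 A * m2 B.
Proof.
move=> mA mB /=; rewrite /product_measure1 /=.
rewrite (eq_integral (fun x => (\1_A x)%:E * m2 B)); last first.
  by move=> x _; rewrite indicE; have [xA1|xA1] /= := boolP (x \in A);
    [rewrite in_xsectionX// mul1e|rewrite mul0e notin_xsectionX].
by rewrite ge0_integralZr ?integral_indic ?setIT//; exact: measurableT_comp.
Qed.

Lemma strip_intensity_rect (R : realType) (theta : R) (A B : set R) :
  measurable A -> measurable B ->
  strip_intensity theta (A `*` B) =
  lebesgue_measure (A `&` `[0%R, +oo[) * omega theta B.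
Proof. by move=> mA mB; rewrite /strip_intensity product_measure1_rect. Qed.

End strip.

(** * Products over the jumps *)

Section jump_products.
Context {R : realType}.
Implicit Types (xi : nat -> R) (p : pred nat).

Definition jump_prod xi p (n : nat) : R := \prod_(0 <= j < n | p j) (1 - xi j).

Definition jump_lim xi p : R := limn (jump_prod xi p).

Lemma jump_prod01 xi p n : (forall j, 0 <= xi j <= 1) -> 0 <= jump_prod xi p n <= 1.
Proof.
move=> xi01; apply/andP; split.
  by apply: prodr_ge0 => j _; case/andP: (xi01 j) => _; rewrite subr_ge0.
apply: prodr_ile1 => j _; case/andP: (xi01 j) => x0 x1.
by rewrite subr_ge0 x1 lerBlDr lerDl.
Qed.

Lemma nonincreasing_jump_prod xi p : (forall j, 0 <= xi j <= 1) ->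
  nonincreasing_seq (jump_prod xi p).
Proof.
move=> xi01; apply/nonincreasing_seqP => n.
rewrite {1}/jump_prod big_mkcond/= big_nat_recr//= -big_mkcond/= -/(jump_prod xi p n).
have /andP[j0 j1] := jump_prod01 p n xi01; case/andP: (xi01 n) => x0 x1.
by case: ifP => _; rewrite ?mulr1// ler_piMr// lerBlDr lerDl.
Qed.

Lemma jump_prod_cvg xi p : (forall j, 0 <= xi j <= 1) ->
  jump_prod xi p @ \oo --> jump_lim xi p.
Proof.
move=> xi01; apply: nonincreasing_is_cvgn; first exact: nonincreasing_jump_prod.
by exists 0 => _ [n _ <-]; case/andP: (jump_prod01 p n xi01).
Qed.

Lemma jump_lim_le xi p n : (forall j, 0 <= xi j <= 1) ->
  jump_lim xi p <= jump_prod xi p n.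
Proof.
move=> xi01; apply: nonincreasing_cvgn_ge; first exact: nonincreasing_jump_prod.
exact: jump_prod_cvg.
Qed.

Lemma jump_lim01 xi p : (forall j, 0 <= xi j <= 1) -> 0 <= jump_lim xi p <= 1.
Proof.
move=> xi01; apply/andP; split.
  apply: limr_ge; first exact: jump_prod_cvg.
  by apply: nearW => n; case/andP: (jump_prod01 p n xi01).
apply: le_trans (jump_lim_le p 0 xi01) _.
by rewrite /jump_prod big_nil.
Qed.

Lemma jump_lim0 xi p : (forall j, ~~ p j) -> jump_lim xi p = 1.
Proof.
move=> np; rewrite /jump_lim (_ : jump_prod xi p = fun=> 1) ?lim_cst//.
by apply/funext => n; rewrite /jump_prod big1// => j; rewrite (negbTE (np j)).
Qed.

Lemma jump_lim_split xi p p1 p2 : (forall j, 0 <= xi j <= 1) ->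
  (forall j, p j = p1 j || p2 j) -> (forall j, ~~ (p1 j && p2 j)) ->
  jump_lim xi p = jump_lim xi p1 * jump_lim xi p2.
Proof.
move=> xi01 pE p12; apply/cvg_lim => //.
rewrite (_ : jump_prod xi p = fun n => jump_prod xi p1 n * jump_prod xi p2 n).
  by apply: cvgM; exact: jump_prod_cvg.
apply/funext => n; rewrite /jump_prod big_mkcond/= [X in X * _]big_mkcond/=.
rewrite [X in _ * X]big_mkcond/= -big_split/=; apply: eq_bigr => j _.
by rewrite pE; case: (p1 j) (p2 j) (p12 j) => -[]//= _; rewrite ?mulr1 ?mul1r.
Qed.

Lemma le_jump_lim xi p1 p2 : (forall j, 0 <= xi j <= 1) ->
  (forall j, p1 j -> p2 j) -> jump_lim xi p2 <= jump_lim xi p1.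
Proof.
move=> xi01 p12; rewrite (@jump_lim_split xi p2 p1 (fun j => p2 j && ~~ p1 j))//.
- case/andP: (jump_lim01 p1 xi01) => ? ?.
  by case/andP: (jump_lim01 (fun j => p2 j && ~~ p1 j) xi01) => ? ?; rewrite ler_piMr.
- by move=> j; case: (p1 j) (p12 j) => [->|]//=; rewrite andbT.
- by move=> j; rewrite andbCA andbN andbF.
Qed.

Lemma counting_nat_count (S : set nat) : finite_set S ->
  \forall n \near \oo,
    (\sum_(0 <= j < n) (j \in S : nat))%N = nat_count (counting S : \bar R).
Proof.
move=> fS; rewrite /counting; case: asboolP => // _; rewrite nat_countE.
have [m Sm] : exists m, S `<=` `I_m.
  exists (\max_(j <- fset_set S) j).+1 => j Sj /=; rewrite ltnS.
  by rewrite (@leq_bigmax_seq _ _ xpredT id)// in_fset_set// inE.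
near=> n.
have nm : (m <= n)%N by near: n; exact: nbhs_infty_ge.
transitivity (\sum_(0 <= j < n | j \in S) 1)%N.
  by rewrite [RHS]big_mkcond/=; apply: eq_bigr => j _; case: (j \in S).
rewrite sum1_count -size_filter; apply: perm_size; apply: uniq_perm.
- by rewrite filter_uniq// iota_uniq.
- exact: fset_uniq.
- move=> j; rewrite mem_filter in_fset_set// mem_index_iota/=.
  case: (boolP (j \in S)) => //= /set_mem /Sm/= jm.
  exact: leq_trans nm.
Unshelve. all: by end_near. Qed.

(* The cell 0 is left out: its intensity is infinite and its factor would be 1. *)
Definition strip_cell (M : nat) (I C : set R) (i : nat) : set (R * R) :=
  if i == 0 then set0 else I `*` (z_cell M.+1 i `&` C).

(** The rounded factors, grouped by size: in this form the product depends on the atoms only through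
    counts, which are random variables. *)
Definition floor_prod (a : nat -> R * R) (I C : set R) (M : nat) : R :=
  \prod_(i < M.+1) (1 - i%:R / M.+1%:R) ^+
     nat_count (counting [set j | strip_cell M I C i (a j)] : \bar R).

Definition window_pred (a : nat -> R * R) (I C : set R) : pred nat :=
  fun j => ((a j).1 \in I) && ((a j).2 \in C).

Lemma floor_thinned_prod M (z : R) : 1 - floor_thinned 1 M.+1 z =
  \prod_(i < M.+1) (1 - i%:R / M.+1%:R) ^+ (z \in z_cell M.+1 i).
Proof.
have [[i zi]|nz] := pselect (exists i : 'I_M.+1, z_cell M.+1 i z).
  rewrite (floor_thinnedE 1 (ltn_ord i) zi) expr1 (bigD1 i)//= mem_set//.
  rewrite big1 ?mulr1 ?expr1; first by rewrite subKr.
  move=> k ki; rewrite memNset ?expr0// => zk; move: ki.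
  by rewrite -val_eqE/= (z_cell_uniq zk zi) eqxx.
rewrite /floor_thinned !big1 ?subr0// => i _.
  by rewrite memNset ?expr0// => zi; apply: nz; exists i.
by rewrite indicE memNset ?mulr0// => zi; apply: nz; exists i.
Qed.

(** The same factors are multiplied atom by atom and cell by cell. The cells i > 0 contain finitely
    many atoms, all of label below n for large n, and the cell 0 contributes factors 1. *)
Lemma floor_prodE a I C M : (forall i, (0 < i <= M)%N ->
    finite_set [set j | strip_cell M I C i (a j)]) ->
  \forall n \near \oo,
    jump_prod (fun j => floor_thinned 1 M.+1 (a j).2) (window_pred a I C) n
    = floor_prod a I C M.
Proof.
move=> fin.
have : \forall n \near \oo, forall i : 'I_M.+1, (0 < i)%N ->
    (\sum_(0 <= j < n) (j \in [set j | strip_cell M I C i (a j)] : nat))%N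
    = nat_count (counting [set j | strip_cell M I C i (a j)] : \bar R).
  apply: filter_forall => i; have [->|i0] := posnP i.
    by apply: nearW => n.
  have /counting_nat_count : finite_set [set j | strip_cell M I C i (a j)].
    by apply: fin; rewrite i0 -ltnS ltn_ord.
  by apply: filterS.
apply: filterS => n cnt; rewrite /jump_prod /floor_prod.
under eq_bigr => j _ do rewrite floor_thinned_prod.
rewrite exchange_big/=; apply: eq_bigr => i _.
have [->|i0] := posnP i.
  by rewrite mul0r subr0 expr1n big1// => j _; rewrite expr1n.
rewrite -cnt// -prodrXr big_mkcond/=; apply: eq_bigr => j _.
have -> : (j \in [set j | strip_cell M I C i (a j)]) =
    window_pred a I C j && ((a j).2 \in z_cell M.+1 i).
  rewrite /strip_cell eqn0Ngt i0/=.
  apply/idP/idP => [/set_mem/= [aI [aZ aC]]|].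
    by rewrite /window_pred !mem_set.
  by move=> /andP[/andP[/set_mem aI /set_mem aC] /set_mem aZ]; apply/mem_set.
by case: (window_pred a I C j); rewrite ?expr0.
Qed.

Lemma floor_prod01 a I C M : 0 <= floor_prod a I C M <= 1.
Proof.
have b01 (i : 'I_M.+1) : 0 <= (1 : R) - i%:R / M.+1%:R <= 1.
  have iM : i%:R / M.+1%:R <= (1 : R).
    by rewrite ler_pdivrMr// mul1r ler_nat ltnW.
  have i0 : 0 <= i%:R / M.+1%:R :> R by rewrite divr_ge0.
  by rewrite subr_ge0 iM lerBlDr lerDl.
apply/andP; split.
  by apply: prodr_ge0 => i _; case/andP: (b01 i) => b0 _; exact: exprn_ge0.
apply: prodr_ile1 => i _; case/andP: (b01 i) => b0 b1.
by rewrite exprn_ge0// exprn_ile1.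
Qed.

Lemma strip_cell_subset M (I C : set R) i (z : R * R) : (0 < i)%N ->
  strip_cell M I C i z -> I z.1 /\ M.+1%:R^-1 < z.2.
Proof.
move=> i0; rewrite /strip_cell eqn0Ngt i0/= => -[Iz [zc _]]; split => //; move: zc.
rewrite /z_cell/= in_itv/= => /andP[+ _]; apply: le_lt_trans.
by rewrite -[leLHS]mul1r ler_wpM2r// ler1n.
Qed.

Section floor_approximation.
Variables (a : nat -> R * R) (I C : set R).
Hypothesis a01 : forall j, 0 <= (a j).2 <= 1.
Hypothesis fin : forall M : nat,
  finite_set [set j | I (a j).1 /\ M.+1%:R^-1 < (a j).2].

Let xi j := (a j).2.
Let fl M j := floor_thinned 1 M.+1 (a j).2.

Let fl_bounds M j : 0 <= fl M j <= xi j /\ xi j - fl M j <= M.+1%:R^-1.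
Proof.
rewrite /fl /xi; have [->|z0] := eqVneq (a j).2 0.
  rewrite /floor_thinned big1 ?subrr ?lexx ?invr_ge0// => i _.
  rewrite indicE memNset ?mulr0// /z_cell/= in_itv/= => /andP[].
  by rewrite ltNge divr_ge0.
have /andP[z0' z1] := a01 j.
have [] := @floor_thinned_bounds _ 1 M.+1 (a j).2 (ltn0Sn _).
  by rewrite lt_neqAle eq_sym z0 z0'.
by rewrite expr1 subKr div1r.
Qed.

Let fl01 M j : 0 <= fl M j <= 1.
Proof.
have [/andP[-> le1] _] := fl_bounds M j; rewrite (le_trans le1)//.
by case/andP: (a01 j).
Qed.

Let cell_fin M i : (0 < i <= M)%N ->
  finite_set [set j | strip_cell M I C i (a j)].
Proof.
move=> /andP[i0 _]; apply: sub_finite_set (fin M) => j /=.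
exact: strip_cell_subset.
Qed.

Lemma jump_lim_le_floor_prod M :
  jump_lim xi (window_pred a I C) <= floor_prod a I C M.
Proof.
have [n _ /(_ n (leqnn n))/= <-] := floor_prodE (@cell_fin M).
apply: le_trans (jump_lim_le _ n a01) _.
apply: ler_prod => j _; case/andP: (a01 j) => x0 x1; rewrite subr_ge0 x1/=.
by apply: lerB => //; case: (fl_bounds M j) => /andP[].
Qed.

Lemma floor_prod_le_jump_prod M n :
  floor_prod a I C M <= jump_prod (fl M) (window_pred a I C) n.
Proof.
have [m _ H] := floor_prodE (@cell_fin M).
have /= <- := H (maxn m n) (leq_maxl m n).
by apply: nonincreasing_jump_prod; [exact: fl01 | exact: leq_maxr].
Qed.

(** [floor_prod] lies between its limit and the product of the first n rounded factors. The number n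
    is chosen first, then M, since for fixed n only finitely many factors have to converge. *)
Lemma floor_prod_cvg :
  floor_prod a I C @ \oo --> jump_lim xi (window_pred a I C).
Proof.
have cfl n : (fun M => jump_prod (fl M) (window_pred a I C) n) @ \oo -->
    jump_prod xi (window_pred a I C) n.
  apply: cvg_big => [|j _]; first exact: mul_continuous.
  apply: cvgB; first exact: cvg_cst.
  apply: (@squeeze_cvgr _ _ _ _ (fun M => xi j - harmonic M) (fun=> xi j)).
  - apply: nearW => M; have [/andP[_ ->] b] := fl_bounds M j.
    by rewrite andbT lerBlDr -lerBlDl.
  - rewrite -[X in _ --> X]subr0; apply: cvgB; first exact: cvg_cst.
    exact: cvg_harmonic.
  - exact: cvg_cst.
apply/cvgrPdist_le => e e0.
have e2 : 0 < e / 2 by rewrite divr_gt0.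
have /cvgrPdist_le/(_ _ e2)[n _ /(_ n (leqnn n))/= Hn] :=
  @jump_prod_cvg xi (window_pred a I C) a01.
have /cvgrPdist_le/(_ _ e2) := cfl n.
apply: filterS => M HM.
rewrite distrC ger0_norm ?subr_ge0 ?jump_lim_le_floor_prod//.
have := floor_prod_le_jump_prod M n; move: Hn HM; rewrite !ler_norml.
by move=> /andP[? ?] /andP[? ?] ?; lra.
Qed.

(** The roundings for successive M are not nested, so the sequence need not be monotone; but its
    limit is also a lower bound, hence the infimum. *)
Lemma inf_floor_prod :
  infs (floor_prod a I C) 0 = jump_lim xi (window_pred a I C).
Proof.
rewrite /infs/=.
have sE : sdrop (floor_prod a I C) 0 = range (floor_prod a I C).
  by apply/seteqP; split => x [M _ <-]; exists M.
rewrite sE; apply/eqP; rewrite eq_le; apply/andP; split.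
  apply: (cvgr_to_ge floor_prod_cvg); apply: nearW => M.
  apply: ge_inf; last by exists M.
  by exists 0 => _ [k _ <-]; case/andP: (floor_prod01 a I C k).
apply: lb_le_inf; first by exists (floor_prod a I C 0); exists 0%N.
by move=> _ [M _ <-]; exact: jump_lim_le_floor_prod.
Qed.

End floor_approximation.

End jump_products.

(** * Poisson atoms and the moments of the factors of the time cells *)

Definition regular_atoms (R : realType) (a : nat -> R * R) : Prop :=
  (forall j, 0 < (a j).1 /\ 0 <= (a j).2 <= 1) /\
  (forall T m : nat,
     finite_set [set j | (a j).1 <= T%:R /\ m.+1%:R^-1 < (a j).2]).

(** Open on the left and closed on the right: these are the atoms that S counts at the end of the
    cell and not yet at its beginning. *)
Definition time_cell (R : realType) (delta : R) (k : nat) : set R :=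
  `]k%:R * delta, k.+1%:R * delta]%classic.

Lemma time_cell_disjoint (R : realType) (delta : R) k l t : 0 < delta ->
  time_cell delta k t -> time_cell delta l t -> k = l.
Proof.
move=> d0; wlog kl : k l / (k < l)%N.
  by move=> H tk tl; case: (ltngtP k l) => // ?; [exact: H | exact/esym/H].
rewrite /time_cell/= !in_itv/= => /andP[_ tk] /andP[lt _].
have := lt_le_trans lt tk; rewrite ltNge => /negP[].
by apply: ler_wpM2r; [exact: ltW | rewrite ler_nat].
Qed.

Section poisson_atoms.
Context {R : realType} {d : measure_display} {T : measurableType d}.
Variables (theta : R) (theta_gt0 : 0 < theta) (P : probability T R).
Variable atom : nat -> T -> R * R.
Hypothesis atomP : poisson_process P (strip_intensity theta) atom.

Lemma ae_of_prob1 (A : set T) : measurable A -> P A = 1%E -> {ae P, forall w, A w}.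
Proof.
move=> mA PA; exists (~` A); split => //; first exact: measurableC.
by rewrite [LHS]probability_setC// PA subee.
Qed.

Lemma no_atom_ae (A : set (R * R)) : measurable A ->
  strip_intensity theta A = 0%E -> {ae P, forall w, forall j, ~ A (atom j w)}.
Proof.
move=> mA A0; have := poisson_process_law atomP mA; rewrite A0 => law.
have mN := poisson_process_measurable atomP mA.
have : {ae P, forall w, (atom_count atom A w : \bar R) = 0%:R%:E}.
  apply: (@ae_of_prob1 [set w | (atom_count atom A w : \bar R) = 0%:R%:E]).
    exact: (measurable_count_eq 0 mN).
  by rewrite (law 0%N) poisson_prob1// oppr0 expR0 mulr1 expr0 fact0 divr1.
apply: filterS => w; rewrite /atom_count /counting; case: asboolP => // fS.
move=> /eqP; rewrite eqe eqr_nat cardfs_eq0 => /eqP S0 j Aj.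
have : j \in fset_set [set j | A (atom j w)] by rewrite in_fset_set// mem_set.
by rewrite S0 inE.
Qed.

Lemma finite_atoms_ae (A : set (R * R)) : measurable A ->
  (strip_intensity theta A < +oo)%E ->
  {ae P, forall w, finite_set [set j | A (atom j w)]}.
Proof.
move=> mA Afin; have := poisson_process_law atomP mA.
have mN := poisson_process_measurable atomP mA.
have -> : strip_intensity theta A = (fine (strip_intensity theta A))%:E.
  rewrite fineK// ge0_fin_numE//.
  apply: integral_ge0 => x _; exact: (measure_ge0 (omega theta)).
move=> /(poisson_law_ae mN); apply: filterS => w [k].
by rewrite /atom_count /counting; case: asboolP.
Qed.

Lemma omega0 (B : set R) : measurable B -> B `&` `[0, 1] `<=` [set 0] ->
  omega theta B = 0%E.
Proof. by move=> mB B0; rewrite /omega (@integral_Sset1 _ _ _ 0). Qed.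

Lemma regular_atoms_ae : {ae P, forall w, regular_atoms (fun j => atom j w)}.
Proof.
have ae1 : {ae P, forall w, forall j, ~ (`]-oo, 0] `*` setT : set (R * R)) (atom j w)}.
  apply: no_atom_ae; first exact: measurableX.
  rewrite strip_intensity_rect// (_ : _ `&` _ = [set 0]) ?lebesgue_measure_set1 ?mul0e//.
  apply/seteqP; split => t /=; rewrite !in_itv/= ?andbT.
    by move=> [? ?]; apply/eqP; rewrite eq_le; apply/andP.
  by move=> ->; rewrite lexx.
have ae2 : {ae P, forall w, forall j, ~ (setT `*` `]-oo, 0[ : set (R * R)) (atom j w)}.
  apply: no_atom_ae; first exact: measurableX.
  rewrite strip_intensity_rect// omega0 ?mule0// => z [] /=; rewrite !in_itv/=.
  by move=> z0 /andP[]; rewrite leNgt z0.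
have ae3 : {ae P, forall w, forall j, ~ (setT `*` `]1, +oo[ : set (R * R)) (atom j w)}.
  apply: no_atom_ae; first exact: measurableX.
  rewrite strip_intensity_rect// omega0 ?mule0// => z [] /=; rewrite !in_itv/= andbT.
  by move=> z1 /andP[_]; rewrite leNgt z1.
have ae4 : {ae P, forall w, forall t m : nat, finite_set [set j |
    (`]-oo, t%:R] `*` `]m.+1%:R^-1, +oo[ : set (R * R)) (atom j w)]}.
  apply: ae_foralln => t; apply: ae_foralln => m; apply: finite_atoms_ae.
    exact: measurableX.
  rewrite strip_intensity_rect// lte_mul_pinfty//.
  - rewrite (_ : _ `&` _ = `[0, t%:R]%classic); last first.
      apply/seteqP; split => x /=; rewrite !in_itv/= ?andbT; first by move=> [-> ->].
      by move=> /andP[-> ->].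
    rewrite lebesgue_measure_itv/= lte_fin; case: ifP => _ //.
  - exact: (@omega_fin _ _ theta_gt0 _ m.+1%:R^-1).
apply: filterS2 (filterI ae1 ae2) (filterI ae3 ae4) => w [H1 H2] [H3 H4]; split.
  move=> j; split; first by rewrite ltNge; apply/negP => j0; apply: (H1 j); rewrite /= in_itv.
  rewrite !leNgt; apply/andP; split; apply/negP => j0.
    by apply: (H2 j); rewrite /= in_itv.
  by apply: (H3 j); rewrite /= in_itv/= andbT.
move=> t m; apply: sub_finite_set (H4 t m) => j /=.
by rewrite !in_itv/= andbT.
Qed.

Variable delta : R.
Hypothesis delta_gt0 : 0 < delta.

Lemma strip_intensity_cell M (C : set R) k i : measurable C -> (0 < i)%N ->
  strip_intensity theta (strip_cell M (time_cell delta k) C i) =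
  (delta * fine (omega theta (z_cell M.+1 i `&` C)))%:E.
Proof.
move=> mC i0; rewrite /strip_cell eqn0Ngt i0/=.
have mz : measurable (z_cell M.+1 i `&` C : set R).
  by apply: measurableI => //; exact: measurable_z_cell.
rewrite strip_intensity_rect//; last exact: measurable_itv.
have -> : time_cell delta k `&` `[0%R, +oo[ = time_cell delta k.
  apply/setIidl => t; rewrite /time_cell/= !in_itv/= andbT => /andP[+ _].
  by move/ltW; apply: le_trans; rewrite mulr_ge0// ltW.
rewrite /time_cell lebesgue_measure_itv/= lte_fin ltr_pM2r// ltr_nat ltnSn.
rewrite -EFinD -natr1 mulrDl mul1r addrAC subrr add0r EFinM fineK//.
rewrite ge0_fin_numE//; apply: (@omega_fin _ _ theta_gt0 _ (i%:R / M.+1%:R)) => //.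
  by rewrite divr_gt0// ltr0n.
by move=> z [+ _]; rewrite /z_cell/= !in_itv/= andbT => /andP[].
Qed.

Lemma measurable_strip_cell M (C : set R) k i : measurable C ->
  measurable (strip_cell M (time_cell delta k) C i).
Proof.
move=> mC; rewrite /strip_cell; case: ifP => // _; apply: measurableX.
  exact: measurable_itv.
by apply: measurableI => //; exact: measurable_z_cell.
Qed.

Let fp (C : set R) k M w :=
  floor_prod (fun j => atom j w) (time_cell delta k) C M.

Lemma measurable_floor_prod (C : set R) k M : measurable C ->
  measurable_fun setT (fp C k M).
Proof.
move=> mC; apply: measurable_prod => i _.
apply: (@measurable_nat_count _ _ _
  (atom_count atom (strip_cell M (time_cell delta k) C i))).
by apply: (poisson_process_measurable atomP); exact: measurable_strip_cell.
Qed.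

(** The rectangles formed by a time cell and a size cell are disjoint, so their counts are
    independent Poisson variables and the left side is a product of generating functions at the
    points [q]. *)
Lemma Ex_floor_prod (C : set R) K M (c : nat -> nat) : measurable C ->
  Ex P (fun w => \prod_(k < K) fp C k M w ^+ c k) =
  \prod_(k < K) expR (- (delta * \sum_(i < M.+1)
     fine (omega theta (z_cell M.+1 i `&` C)) *
     (1 - (1 - i%:R / M.+1%:R) ^+ c k))).
Proof.
move=> mC; pose I := ('I_K * 'I_M.+1)%type.
pose A (x : I) := strip_cell M (time_cell delta x.1) C x.2.
pose q (x : I) : R := (1 - x.2%:R / M.+1%:R) ^+ c x.1.
(* For the size cell 0 the set [strip_cell] is empty, hence the mean 0. *)
pose r (x : I) : R := if x.2 == 0 :> nat then 0
  else delta * fine (omega theta (z_cell M.+1 x.2 `&` C)).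
(* Independence of the counts is given for families indexed by ordinals, so the pairs are
   enumerated. *)
pose e (i : 'I_#|predT : pred I|) : I := enum_val i.
have mA x : measurable (A x) by exact: measurable_strip_cell.
have tA : trivIset setT (A \o e).
  move=> i j _ _ [[t z] []]; rewrite /A /= /strip_cell.
  case: ifP => // _ [/= ti [zi _]]; case: ifP => // _ [/= tj [zj _]].
  apply: enum_val_inj; rewrite -/(e i) -/(e j).
  case: (e i) (e j) ti zi tj zj => [k1 i1] [k2 i2]/= ti zi tj zj.
  by congr pair; apply: val_inj => /=;
    [exact: time_cell_disjoint ti tj | exact: z_cell_uniq zi zj].
have H := @Ex_prod_poisson _ _ _ P _ (fun i => atom_count atom (A (e i)))
  (r \o e) (q \o e).
transitivity (Ex P (fun w => \prod_i
   (q \o e) i ^+ nat_count (atom_count atom (A (e i)) w : \bar R))).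
  congr Ex; apply/funext => w.
  rewrite -(big_enum_val (A := predT) (fun x =>
    q x ^+ nat_count (atom_count atom (A x) w : \bar R))).
  rewrite -(pair_big predT predT (fun k i =>
     q (k, i) ^+ nat_count (atom_count atom (A (k, i)) w : \bar R)))/=.
  apply: eq_bigr => k _; rewrite /fp /floor_prod -prodrXl; apply: eq_bigr => i _.
  by rewrite /q/= exprAC.
rewrite {}H.
- rewrite -(big_enum_val (A := predT) (fun x => expR (- (r x * (1 - q x))))).
  rewrite -(pair_big predT predT (fun k i => expR (- (r (k, i) * (1 - q (k, i))))))/=.
  apply: eq_bigr => k _; rewrite -expR_sum; congr expR.
  rewrite mulr_sumr -sumrN; apply: eq_bigr => i _; rewrite /r /q/=.
  have [->|i0] := eqVneq (i : nat) 0%N.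
    by rewrite mul0r mul0r subr0 expr1n subrr !mulr0.
  by rewrite mulrA.
- by move=> i; apply: (poisson_process_measurable atomP).
- exact: (poisson_process_independent atomP (fun i => mA (e i)) tA).
- move=> i; rewrite /= /r; case: ifP => // _; apply: mulr_ge0; first exact: ltW.
  by apply: fine_ge0; exact: (measure_ge0 (omega theta)).
- move=> i; have := poisson_process_law atomP (mA (e i)).
  rewrite /A /= /r; case: ifP => i0.
    have -> : strip_cell M (time_cell delta (e i).1) C (e i).2 = setT `*` set0.
      by rewrite /strip_cell i0 setX0.
    by rewrite strip_intensity_rect// omega0 ?mule0// set0I.
  by rewrite strip_intensity_cell// lt0n i0.
- move=> i; rewrite /= /q.
  have iM : (e i).2%:R / M.+1%:R <= (1 : R).
    by rewrite ler_pdivrMr// mul1r ler_nat ltnW.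
  have i0 : 0 <= (e i).2%:R / M.+1%:R :> R by rewrite divr_ge0.
  rewrite exprn_ge0 ?subr_ge0//= exprn_ile1 ?subr_ge0// lerBlDr lerDl.
Qed.

(* The product of 1 - xi over the atoms in the k-th time cell with xi in C, written
   as the infimum of its roundings so that it is measurable (see ratioE). *)
Definition ratio (C : set R) (k : nat) (w : T) : R := infs (fp C k ^~ w) 0.

Lemma ratio01 C k w : 0 <= ratio C k w <= 1.
Proof.
have sE : sdrop (fp C k ^~ w) 0 = range (fp C k ^~ w).
  by apply/seteqP; split => x [M _ <-]; exists M.
rewrite /ratio /infs/= sE; apply/andP; split.
  apply: lb_le_inf; first by exists (fp C k 0 w); exists 0%N.
  by move=> _ [M _ <-]; case/andP: (floor_prod01 (fun j => atom j w) (time_cell delta k) C M).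
apply: (@le_trans _ _ (fp C k 0 w)); last by case/andP: (floor_prod01 (fun j => atom j w) (time_cell delta k) C 0).
apply: ge_inf; last by exists 0%N.
by exists 0 => _ [M _ <-]; case/andP: (floor_prod01 (fun j => atom j w) (time_cell delta k) C M).
Qed.

Lemma measurable_ratio (C : set R) k : measurable C ->
  measurable_fun setT (ratio C k).
Proof.
move=> mC; apply: (@measurable_fun_infs _ _ _ _ (fp C k) 0).
  move=> w _; exists 0 => _ [M _ <-].
  by case/andP: (floor_prod01 (fun j => atom j w) (time_cell delta k) C M).
by move=> M; exact: measurable_floor_prod.
Qed.

Lemma bounded_ratio (C : set R) k : measurable C -> bounded_rv (ratio C k).
Proof.
by move=> mC; apply: bounded_rv01; [exact: measurable_ratio | exact: ratio01].
Qed.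

Lemma regular_window a k : regular_atoms a -> forall M : nat,
  finite_set [set j | time_cell delta k (a j).1 /\ M.+1%:R^-1 < (a j).2].
Proof.
move=> [_ fin] M; apply: sub_finite_set (fin (Num.truncn (k.+1%:R * delta)).+1 M).
move=> j /=; rewrite /time_cell/= in_itv/= => -[/andP[_ le1] ->]; split => //.
by apply: le_trans le1 _; apply/ltW; exact: truncnS_gt.
Qed.

Lemma ratioE (C : set R) k w : regular_atoms (fun j => atom j w) ->
  ratio C k w = jump_lim (fun j => (atom j w).2)
    (window_pred (fun j => atom j w) (time_cell delta k) C).
Proof.
move=> rw; apply: inf_floor_prod; first by move=> j; case: (rw.1 j).
exact: regular_window.
Qed.

(** Exponents that vary with the cell express at once the moments of the factors and their
    independence. The roundings converge almost surely and lie in [0, 1]. *)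
Lemma Ex_ratio (C : set R) K (c : nat -> nat) : measurable C ->
  Ex P (fun w => \prod_(k < K) ratio C k w ^+ c k) =
  \prod_(k < K) expR (- (delta * laplace_exponent theta C (c k))).
Proof.
move=> mC.
have c1 : (fun M => Ex P (fun w => \prod_(k < K) fp C k M w ^+ c k)) @ \oo -->
    \prod_(k < K) expR (- (delta * laplace_exponent theta C (c k))).
  under eq_fun => M do rewrite Ex_floor_prod//.
  apply: cvg_big => [|k _]; first exact: mul_continuous.
  apply: continuous_cvg; first exact: continuous_expR.
  by apply: cvgN; apply: cvgMr; exact: laplace_exponent_cvg.
have fp01 k M w : 0 <= fp C k M w <= 1 by exact: floor_prod01.
have bfp k M : bounded_rv (fp C k M).
  by apply: bounded_rv01; [exact: measurable_floor_prod | exact: fp01].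
have c2 : (fun M => Ex P (fun w => \prod_(k < K) fp C k M w ^+ c k)) @ \oo -->
    Ex P (fun w => \prod_(k < K) ratio C k w ^+ c k).
  apply: (@Ex_cvg _ _ _ _ _ _ 1).
  - move=> M; apply: measurable_prod => k _; apply: measurable_funX.
    exact: measurable_floor_prod.
  - move=> M w; rewrite ger0_norm.
      apply: prodr_ile1 => k _; case/andP: (fp01 k M w) => f0 f1.
      by rewrite exprn_ge0// exprn_ile1.
    by apply: prodr_ge0 => k _; case/andP: (fp01 k M w) => f0 f1; exact: exprn_ge0.
  - apply: bounded_rv_prod => k _; apply: bounded_rvX; exact: bounded_ratio.
  - apply: filterS regular_atoms_ae => w rw.
    apply: cvg_big => [|k _]; first exact: mul_continuous.
    rewrite ratioE//; have := @exprn_continuous R (c k)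
      (jump_lim (fun j => (atom j w).2)
        (window_pred (fun j => atom j w) (time_cell delta k) C)).
    apply: cvg_comp; apply: floor_prod_cvg; first by move=> j; case: (rw.1 j).
    exact: regular_window.
exact: cvg_unique c2 c1.
Qed.

End poisson_atoms.

(** * Moments on a grid of times *)

Section moments.
Context {R : realType}.
Variables (theta : R) (theta_gt0 : 0 < theta).

(* E ((1 - r)^a r^b), where r is the factor by which 1 - S is multiplied over a
   time cell of length delta, so that E (r^b) = exp (- delta h(b)). *)
Fixpoint mixed_moment (delta : R) (a b : nat) : R :=
  if a is a'.+1 then mixed_moment delta a' b - mixed_moment delta a' b.+1
  else expR (- (delta * h theta b)).

Lemma hS (m : nat) : h theta m.+1 = h theta m + (theta + m%:R)^-1.
Proof.
by rewrite /h big_nat_recr//=; congr (_ + _^-1); rewrite -natr1; ring.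
Qed.

Lemma h0 : h theta 0 = 0.
Proof. by rewrite /h big_geq. Qed.

Lemma h_gt0 m : (0 < m)%N -> 0 < h theta m.
Proof.
case: m => // m _; elim: m => [|m IH].
  by rewrite hS h0 add0r addr0 invr_gt0.
by rewrite hS addr_gt0// invr_gt0 ltr_wpDr.
Qed.

Lemma mixed_moment0_lt1 delta b : 0 < delta -> (0 < b)%N ->
  mixed_moment delta 0 b < 1.
Proof.
by move=> d0 b0; rewrite /= expR_lt1 oppr_lt0 mulr_gt0// h_gt0.
Qed.

(* The limit of mixed_moment delta a b / delta as delta tends to 0, that is, the
   integral of z^a (1 - z)^b with respect to omega. *)
Definition beta_limit (a b : nat) : R :=
  a.-1`!%:R / \prod_(k < a) (theta + b%:R + k%:R).

(** Integrated form of z^(a+1) (1 - z)^b = z^a (1 - z)^b - z^a (1 - z)^(b+1), the recursion that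
    also defines [mixed_moment]. *)
Lemma beta_limitS a b : (0 < a)%N ->
  beta_limit a.+1 b = beta_limit a b - beta_limit a b.+1.
Proof.
case: a => // a _; rewrite /beta_limit/=.
rewrite big_ord_recr/= [X in _ = _ / X - _]big_ord_recl/=.
rewrite [X in _ = _ - _ / X]big_ord_recr/= addr0.
rewrite [X in _ / (X * _)]big_ord_recl/= addr0.
have pE : \prod_(i < a) (theta + b%:R + (lift ord0 i)%:R) =
          \prod_(i < a) (theta + b.+1%:R + i%:R) :> R.
  by apply: eq_bigr => i _; rewrite /= /bump/= natrD -natr1; ring.
rewrite pE; set p := \prod_(i < a) _.
have p0 : p != 0.
  by rewrite gt_eqF// prodr_gt0// => i _; rewrite ltr_wpDr// ltr_wpDr.
have t1 : theta + b%:R != 0 by rewrite gt_eqF// ltr_wpDr.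
have t2 : theta + b%:R + a.+1%:R != 0 by rewrite gt_eqF// ltr_wpDr// ltr_wpDr.
have e : theta + b.+1%:R + a%:R = theta + b%:R + a.+1%:R by rewrite -!natr1; ring.
rewrite e factS natrM.
have aE : a.+1%:R = (theta + b%:R + a.+1%:R) - (theta + b%:R) by ring.
rewrite [X in X * _ / _]aE; move: (theta + b%:R) (a.+1%:R) t1 t2 => x y t1 t2.
by field; rewrite p0 t1 t2.
Qed.

Definition mesh (N : nat) : R := (2 ^ N)%:R^-1.

Lemma mesh_gt0 N : 0 < mesh N.
Proof. by rewrite invr_gt0 ltr0n expn_gt0. Qed.

Lemma pow2_mesh N : (2 ^ N)%:R * mesh N = 1.
Proof. by rewrite divff// pnatr_eq0 -lt0n expn_gt0. Qed.

Lemma mesh_cvg : mesh @ \oo --> 0.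
Proof.
rewrite (_ : mesh = fun N => (2^-1 : R) ^+ N); last first.
  by apply/funext => N; rewrite /mesh natrX exprVn.
by apply: cvg_expr; rewrite ger0_norm// invf_lt1// ltr1n.
Qed.

(** With y = mesh N * x, the inequality 1 + t <= exp t at t = y and t = - y gives y / (1 + y) <= 1 -
    exp(- y) <= y. *)
Lemma onem_expR_cvg (x : R) : 0 <= x ->
  (fun N => (1 - expR (- (mesh N * x))) / mesh N) @ \oo --> x.
Proof.
move=> x0; apply: (@squeeze_cvgr _ _ _ _ (fun N => x / (1 + mesh N * x)) (fun=> x)).
- apply: nearW => N; have d0 := mesh_gt0 N.
  have y0 : 0 <= mesh N * x by rewrite mulr_ge0// ltW.
  apply/andP; split.
    rewrite ler_pdivlMr// mulrAC ler_pdivrMr ?ltr_wpDr//.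
    have : expR (- (mesh N * x)) * (1 + mesh N * x) <= 1.
      rewrite expRN mulrC ler_pdivrMr ?expR_gt0// mul1r; exact: expR_ge1Dx.
    by lra.
  rewrite ler_pdivrMr//; have := expR_ge1Dx (- (mesh N * x)); lra.
- have c1 : (fun N => 1 + mesh N * x) @ \oo --> (1 : R).
    have : (fun N => 1 + mesh N * x) @ \oo --> 1 + 0 * x.
      by apply: cvgD; [exact: cvg_cst | apply: cvgMl; exact: mesh_cvg].
    by rewrite mul0r addr0.
  have : (fun N => x / (1 + mesh N * x)) @ \oo --> x * 1^-1.
    by apply: cvgM; [exact: cvg_cst | apply: cvgV => //; exact: oner_neq0].
  by rewrite invr1 mulr1.
- exact: cvg_cst.
Qed.

Lemma h_ge0 m : 0 <= h theta m.
Proof. by case: m => [|m]; [rewrite h0 | exact/ltW/h_gt0]. Qed.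

Lemma mixed_moment0_cvg b :
  (fun N => (1 - mixed_moment (mesh N) 0 b) / mesh N) @ \oo --> h theta b.
Proof. exact: onem_expR_cvg (h_ge0 b). Qed.

(** The induction starts at a = 1, since E r^b tends to 1 and not to 0; there the limit is h(b + 1)
    - h(b) = 1 / (theta + b). *)
Lemma mixed_moment_cvg a b : (0 < a)%N ->
  (fun N => mixed_moment (mesh N) a b / mesh N) @ \oo --> beta_limit a b.
Proof.
case: a => // a _; elim: a b => [|a IH] b.
  have -> : beta_limit 1 b = h theta b.+1 - h theta b.
    by rewrite hS addrAC subrr add0r /beta_limit big_ord1 addr0 div1r.
  rewrite (_ : (fun _ => _) = (fun N => (1 - mixed_moment (mesh N) 0 b.+1) / mesh N -
     (1 - mixed_moment (mesh N) 0 b) / mesh N)).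
    by apply: cvgB; exact: mixed_moment0_cvg.
  by apply/funext => N; rewrite -mulrBl; congr (_ / _); rewrite /=; ring.
rewrite beta_limitS//.
rewrite (_ : (fun _ => _) = (fun N => mixed_moment (mesh N) a.+1 b / mesh N -
   mixed_moment (mesh N) a.+1 b.+1 / mesh N)).
  by apply: cvgB; exact: IH.
by apply/funext => N; rewrite -mulrBl.
Qed.

(* The probability, without the multinomial coefficient, that the sample lies in
   the first K cells of the grid and has composition lam. *)
Fixpoint grid_sum delta (K : nat) (lam : seq nat) : R :=
  if K is K'.+1 then
    mixed_moment delta 0 (sumn lam) * grid_sum delta K' lam +
    (if lam is l :: lam' then
       mixed_moment delta l (sumn lam') * grid_sum delta K' lam' else 0)
  else (lam == [::])%:R.

(** The fixed points of the recursion of [grid_sum]: u = q u + v has the solution v / (1 - q), where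
    q is the probability that a cell receives none of the points and v the term in which it receives
    the first part. *)
Fixpoint grid_limit delta (lam : seq nat) : R :=
  if lam is l :: lam' then
    mixed_moment delta l (sumn lam') / (1 - mixed_moment delta 0 (sumn lam)) *
    grid_limit delta lam'
  else 1.

(** An increasing sequence bounded by the fixed point l / (1 - q) converges, and its limit solves
    the equation. Monotonicity belongs to the conclusion because u, up to a factor, becomes the
    input b for the next longer composition. *)
Lemma affine_recursion_cvg (q l : R) (u b : nat -> R) : 0 <= q < 1 ->
  b @ \oo --> l -> nondecreasing_seq b -> 0 <= b 0%N -> u 0%N = 0 ->
  (forall n, u n.+1 = q * u n + b n) ->
  nondecreasing_seq u /\ u @ \oo --> l / (1 - q).
Proof.
move=> /andP[q0 q1] bl ndb b0 u0 uS.
have q1' : 0 < 1 - q by rewrite subr_gt0.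
have ndu : nondecreasing_seq u.
  apply/nondecreasing_seqP; elim=> [|n IH]; first by rewrite uS u0 mulr0 add0r.
  by rewrite !uS lerD ?ndb// ler_wpM2l// -uS.
split => //.
have bn n : b n <= l.
  rewrite -(cvg_lim (@Rhausdorff R) bl).
  by apply: nondecreasing_cvgn_le => //; apply/cvg_ex; exists l.
have cu : cvgn u.
  apply: nondecreasing_is_cvgn => //; exists (l / (1 - q)) => _ [n _ <-].
  elim: n => [|n IH].
    rewrite u0; apply: divr_ge0; [exact: le_trans b0 (bn 0%N) | exact: ltW].
  rewrite uS; have -> : l / (1 - q) = q * (l / (1 - q)) + l.
    by field; rewrite subr_eq0 eq_sym lt_eqF.
  by rewrite lerD ?bn// ler_wpM2l.
suff -> : l / (1 - q) = limn u by [].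
have : limn u = q * limn u + l.
  have c1 : (fun n => u n.+1) @ \oo --> limn u by rewrite (cvg_shiftS u).
  have c2 : (fun n => u n.+1) @ \oo --> q * limn u + l.
    under eq_fun do rewrite uS.
    by apply: cvgD => //; exact: cvgMr.
  exact: cvg_unique c1 c2.
move=> e.
apply: (mulIf (lt0r_neq0 q1')); rewrite divfK ?gt_eqF//.
have -> : l = limn u - q * limn u by rewrite {1}e addrAC subrr add0r.
ring.
Qed.

Lemma grid_limit_cvg lam : all (leq 1) lam ->
  (fun N => grid_limit (mesh N) lam) @ \oo -->
  (\prod_(0 <= j < size lam)
     (beta_limit (nth 0%N lam j) (sumn (drop j.+1 lam)) /
      h theta (sumn (drop j lam)))).
Proof.
elim: lam => [_|l lam IH /= /andP[l0 lpos]]; first by rewrite big_geq//; exact: cvg_cst.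
rewrite big_nat_recl//= drop0; apply: cvgM; last exact: IH.
rewrite (_ : (fun _ => _) = (fun N => (mixed_moment (mesh N) l (sumn lam) / mesh N) /
   ((1 - mixed_moment (mesh N) 0 (l + sumn lam)) / mesh N))).
  apply: cvgM; first exact: mixed_moment_cvg.
  apply: cvgV; last exact: mixed_moment0_cvg.
  by rewrite gt_eqF// h_gt0// addn_gt0 l0.
apply/funext => N; have d0 := mesh_gt0 N; rewrite invf_div mulrA divfK ?gt_eqF//.
Qed.

(** The denominators of the Beta integrals are consecutive blocks of the Pochhammer factorial, from
    the last part to the first, and (l - 1)! / l! leaves 1 / l. *)
Lemma multinomial_beta_limit lam : all (leq 1) lam ->
  (sumn lam)`!%:R / (\prod_(l <- lam) l`!)%:R *
  \prod_(0 <= j < size lam)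
     (beta_limit (nth 0%N lam j) (sumn (drop j.+1 lam)) /
      h theta (sumn (drop j lam))) = g theta lam.
Proof.
rewrite /g -!mulrA => lpos; congr (_ * _).
have sN (l m : nat) : pochhammer theta (l + m) =
    pochhammer theta m * \prod_(k < l) (theta + m%:R + k%:R) :> R.
  rewrite /pochhammer addnC !big_mkord big_split_ord/=; congr (_ * _).
  by apply: eq_bigr => k _; rewrite natrD addrA.
elim: lam lpos => [_|l lam IH /= /andP[l0 lpos]].
  by rewrite /pochhammer big_nil !big_geq.
rewrite !big_nat_recl//= big_cons drop0 sN natrM !invfM.
have {}IH := IH lpos.
set A := (\prod_(l <- lam) _)%:R^-1 in IH *.
set B := \prod_(0 <= j < size lam) _ in IH *.
set C := (pochhammer theta (sumn lam))^-1 in IH *.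
set D := \prod_(0 <= j < size lam) _ in IH *.
have lf : l`!%:R = l%:R * (l.-1)`!%:R :> R.
  by case: l l0 => // l _; rewrite factS natrM.
have l1 : l.-1`!%:R != 0 :> R by rewrite pnatr_eq0 -lt0n fact_gt0.
rewrite /beta_limit lf invfM.
transitivity (l%:R^-1 / h theta (l + sumn lam) /
  \prod_(k < l) (theta + (sumn lam)%:R + k%:R) * (A * B)).
  move: (\prod_(k < l) _)^-1 (h _ _)^-1 (l%:R^-1) => x y z.
  by field.
by rewrite IH; ring.
Qed.

Lemma grid_sum_cvg delta lam : 0 < delta ->
  (forall a b, 0 <= mixed_moment delta a b) -> all (leq 1) lam ->
  (grid_sum delta)^~ lam @ \oo --> grid_limit delta lam.
Proof.
move=> d0 m0; suff H : all (leq 1) lam -> nondecreasing_seq ((grid_sum delta)^~ lam) /\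
    (grid_sum delta)^~ lam @ \oo --> grid_limit delta lam by move=> /H[].
elim: lam => [_|l lam IH /= /andP[l0 lpos]].
  have -> : (grid_sum delta)^~ [::] = fun=> 1.
    apply/funext; elim => //= K ->.
    by rewrite addr0 h0 mulr0 oppr0 expR0 mulr1.
  by split; [by [] | exact: cvg_cst].
have [nd cv] := IH lpos.
have gs0 K lam' : 0 <= grid_sum delta K lam'.
  elim: K lam' => [|K IHK] lam'; first by rewrite /=; case: eqP.
  rewrite /= addr_ge0// ?mulr_ge0// ?expR_ge0//.
  by case: lam' => // *; rewrite mulr_ge0.
have -> : mixed_moment delta l (sumn lam) /
    (1 - expR (- (delta * h theta (l + sumn lam)))) * grid_limit delta lam =
   (mixed_moment delta l (sumn lam) * grid_limit delta lam) /
    (1 - mixed_moment delta 0 (l + sumn lam)) by rewrite /= mulrAC.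
apply: (@affine_recursion_cvg _ _ _
  (fun K => mixed_moment delta l (sumn lam) * grid_sum delta K lam)) => //.
- rewrite m0/=; apply: mixed_moment0_lt1 => //; by rewrite addn_gt0 l0.
- exact: cvgMr.
- by move=> m n mn; rewrite ler_wpM2l// nd.
- by rewrite mulr_ge0.
Qed.

End moments.

Section grid_moments.
Context {R : realType} {d : measure_display} {T : measurableType d}.
Variables (theta : R) (theta_gt0 : 0 < theta) (P : probability T R).
Variable atom : nat -> T -> R * R.
Hypothesis atomP : poisson_process P (strip_intensity theta) atom.
Variable delta : R.
Hypothesis delta_gt0 : 0 < delta.

Local Notation r := (ratio atom delta setT).

Lemma bounded_ratio_mixed a b k : bounded_rv (fun w => (1 - r k w) ^+ a * r k w ^+ b).
Proof.
have br : bounded_rv (r k) by exact: (bounded_ratio atomP).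
apply: bounded_rvM; apply: bounded_rvX => //.
by apply: bounded_rvB => //; exact: bounded_rv_cst.
Qed.

(** Induction on the sum of the a k: one exponent is lowered by (1 - r)^(a+1) r^b = (1 - r)^a r^b -
    (1 - r)^a r^(b+1), until only powers of r are left. *)
Lemma Ex_mixed K (a b : nat -> nat) :
  Ex P (fun w => \prod_(k < K) ((1 - r k w) ^+ a k * r k w ^+ b k)) =
  \prod_(k < K) mixed_moment theta delta (a k) (b k).
Proof.
have [n] := ubnP (\sum_(k < K) a k); elim: n a b => // n IH a b.
rewrite ltnS => an.
have [/forallP a0|/forallPn[k ak]] := boolP [forall k : 'I_K, a k == 0%N].
  transitivity (Ex P (fun w => \prod_(k < K) r k w ^+ b k)).
    congr Ex; apply/funext => w; apply: eq_bigr => k _.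
    by rewrite (eqP (a0 k)) expr0 mul1r.
  rewrite (Ex_ratio theta_gt0 atomP)//; apply: eq_bigr => k _.
  by rewrite (eqP (a0 k)) /= laplace_exponentT.
pose a' (j : nat) := if j == k then (a k).-1 else a j.
pose b' (j : nat) := if j == k then (b k).+1 else b j.
have a'n : (\sum_(j < K) a' j < n)%N.
  apply: leq_trans an; rewrite (bigD1 k)//= [leqRHS](bigD1 k)//= /a' eqxx.
  rewrite -addSn prednK ?lt0n// leq_add2l leq_sum// => j jk.
  by rewrite ifN// val_eqE.
have ak1 : a k = (a k).-1.+1 by rewrite prednK// lt0n.
have E : (fun w => \prod_(j < K) ((1 - r j w) ^+ a j * r j w ^+ b j)) =
   (fun w => \prod_(j < K) ((1 - r j w) ^+ a' j * r j w ^+ b j) -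
             \prod_(j < K) ((1 - r j w) ^+ a' j * r j w ^+ b' j)).
  apply/funext => w; rewrite (bigD1 k)//= [X in _ = X - _](bigD1 k)//=.
  rewrite [X in _ = _ - X](bigD1 k)//= /a' /b' !eqxx.
  set p := \prod_(j < K | j != k) _.
  have pE (c : nat -> nat) : (c = b \/ c = b') ->
     \prod_(j < K | j != k) ((1 - r j w) ^+ a' j * r j w ^+ c j) = p.
    move=> cE; apply: eq_bigr => j jk; rewrite /a' ifN ?val_eqE//.
    by case: cE => ->; rewrite // /b' ifN ?val_eqE.
  rewrite (pE b (or_introl erefl)) (pE b' (or_intror erefl)).
  by rewrite {1}ak1 !exprS; ring.
rewrite E ExB; [|by apply: bounded_rv_prod => j _; exact: bounded_ratio_mixed..].
rewrite !IH// (bigD1 k)//= [X in _ - X](bigD1 k)//= [RHS](bigD1 k)//=.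
rewrite {1 3}/a' {1}/b' !eqxx [in RHS]ak1/= mulrBl; congr (_ * _ - _ * _).
- by apply: eq_bigr => j jk; rewrite /a' ifN ?val_eqE.
- by apply: eq_bigr => j jk; rewrite /a' /b' !ifN ?val_eqE.
Qed.

(** As an alternating sum of exponentials this has no visible sign; it is nonnegative as the moment
    of a variable with values in [0, 1]. *)
Lemma mixed_moment_ge0 a b : 0 <= mixed_moment theta delta a b.
Proof.
have := @Ex_mixed 1 (fun=> a) (fun=> b); rewrite big_ord1 => <-.
apply: Rintegral_ge0 => w _; apply: prodr_ge0 => k _.
have /andP[r0 r1] := ratio01 atom delta setT k w.
by rewrite mulr_ge0// exprn_ge0// subr_ge0.
Qed.

End grid_moments.

(** * Compositions of labelled samples *)

Section counting_labels.

(** The multinomial coefficient, by induction on the first letter: if it is a, then b a drops by one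
    and (b a)! loses the factor b a; these factors add up to the length. *)
Lemma card_tuple_counts (A : finType) n (b : A -> nat) : (\sum_a b a = n)%N ->
  (#|[pred t : n.-tuple A | [forall a, count_mem a t == b a]]| * \prod_a (b a)`!
   = n`!)%N.
Proof.
elim: n b => [|n IH] b bn.
  have b0 a : b a = 0%N.
    by apply/eqP; move/eqP: bn; rewrite sum_nat_eq0 => /forallP/(_ a).
  rewrite big1; last by move=> a _; rewrite b0.
  rewrite muln1 (@eq_card _ _ predT) ?card_tuple//.
  by move=> t; rewrite !inE; apply/forallP => a; rewrite tuple0 b0.
have cardE : #|[pred t : n.+1.-tuple A | [forall a, count_mem a t == b a]]| =
    (\sum_a \sum_(t : n.-tuple A) [forall c, (a == c) + count_mem c t == b c])%N.
  rewrite -sum1_card big_mkcond/= pair_bigA/=.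
  rewrite (reindex (fun p : A * n.-tuple A => [tuple of p.1 :: p.2]))/=; last first.
    exists (fun t : n.+1.-tuple A => (thead t, [tuple of behead t])) => [[a t] _|t _].
      by rewrite theadE; congr pair; apply: val_inj.
    by rewrite [RHS]tuple_eta.
  by apply: eq_bigr => -[a t] _ /=; rewrite inE/=; case: [forall _, _].
rewrite cardE big_distrl/= factS -bn big_distrl/=; apply: eq_bigr => a _.
have [ba|ba] := posnP (b a).
  rewrite ba mul0n big1 ?mul0n// => t _; apply/eqP; rewrite eqb0.
  by apply/forallPn; exists a; rewrite eqxx ba.
pose b' c := if c == a then (b a).-1 else b c.
have b'n : (\sum_c b' c = n)%N.
  apply: succn_inj; rewrite -bn (bigD1 a)//= [in RHS](bigD1 a)//= /b' eqxx.
  rewrite -addSn prednK//; congr (_ + _)%N; apply: eq_bigr => c ca.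
  by rewrite ifN.
rewrite -(IH b' b'n) [in LHS](bigD1 a)//= [in RHS](bigD1 a)//= {2}/b' eqxx.
have -> : (\prod_(c | c != a) (b' c)`! = \prod_(c | c != a) (b c)`!)%N.
  by apply: eq_bigr => c ca; rewrite /b' ifN.
have -> : ((b a)`! = b a * (b a).-1`!)%N by case: (b a) ba => // k _; rewrite factS.
rewrite !mulnA; congr (_ * _ * _)%N; rewrite mulnC; congr (_ * _)%N.
rewrite -sum1_card [RHS]big_mkcond/=; apply: eq_bigr => t _.
have -> : [forall c, (a == c) + count_mem c t == b c]%N = [forall c, count_mem c t == b' c].
  apply: eq_forallb => c; rewrite /b' [a == c]eq_sym; case: (eqVneq c a) => [->|_] //.
  by rewrite add1n -[in LHS](prednK ba) eqSS.
by rewrite inE; case: [forall _, _].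
Qed.

Definition label_counts n (K : nat) (kappa : 'I_n -> nat) : seq nat :=
  [seq #|[pred i | kappa i == k]| | k <- iota 0 K].

Definition label_composition n (K : nat) (kappa : 'I_n -> nat) : seq nat :=
  [seq c <- label_counts K kappa | c != 0%N].

(* The sequences of K counts whose nonzero terms are lam. *)
Fixpoint padded (K : nat) (lam : seq nat) : seq (seq nat) :=
  if K is K'.+1 then
    [seq 0%N :: b | b <- padded K' lam] ++
    (if lam is l :: lam' then [seq l :: b | b <- padded K' lam'] else [::])
  else if lam is [::] then [:: [::]] else [::].

Lemma mem_padded K lam b : all (leq 1) lam ->
  (b \in padded K lam) = (size b == K) && ([seq c <- b | c != 0%N] == lam).
Proof.
elim: K lam b => [|K IH] lam b lpos.
  by case: lam lpos => [|l lam] /=; case: b => [|c b]; rewrite ?inE//= ?andbF.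
rewrite /= mem_cat; case: b => [|c b].
  have nin (x : nat) s : ([::] \in [seq x :: b0 | b0 <- s]) = false.
    by apply/negP => /mapP[].
  by rewrite nin; case: lam lpos => [|l lam] _; rewrite ?nin.
have map_cons (x : nat) s : (c :: b \in [seq x :: b0 | b0 <- s]) = (c == x) && (b \in s).
  apply/mapP/andP => [[b0 b0s [-> ->]]|[/eqP -> bs]]; first by rewrite eqxx.
  by exists b.
rewrite map_cons /= eqSS.
case: lam lpos => [|l lam] /= lpos.
  by rewrite in_nil orbF IH//; case: {map_cons} c => [|c]//=; rewrite andbF.
case/andP: lpos => l0 lpos.
rewrite map_cons !IH//=; last by rewrite l0.
case: {map_cons} c => [|c]/=.
  by rewrite (_ : 0%N == l = false) ?orbF//; case: (l) l0.
by rewrite eqseq_cons andbCA.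
Qed.

Lemma padded_uniq K lam : all (leq 1) lam -> uniq (padded K lam).
Proof.
elim: K lam => [|K IH] lam lpos; first by case: lam lpos.
have inj x : injective (cons x : seq nat -> seq nat) by move=> s t [].
rewrite /= cat_uniq map_inj_uniq// IH//=.
case: lam lpos => [//|l lam] /= /andP[l0 lpos].
rewrite map_inj_uniq// IH// andbT.
apply/hasPn => b /mapP[b' _ ->]; apply/negP => /mapP[b'' _ [l0' _]].
by rewrite l0' in l0.
Qed.

Lemma sumn_filter_neq0 (b : seq nat) : sumn [seq c <- b | c != 0%N] = sumn b.
Proof. by elim: b => // -[|c] b /= ->. Qed.

Lemma prod_fact_filter_neq0 (b : seq nat) :
  (\prod_(c <- [seq c <- b | c != 0%N]) c`! = \prod_(c <- b) c`!)%N.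
Proof.
elim: b => // c b IH; rewrite big_cons -IH/=; case: eqP => [->|_] /=.
  by rewrite mul1n.
by rewrite big_cons.
Qed.

End counting_labels.

Section grid_sums.
Context {R : realType}.
Variables (theta delta : R).

(** Each point to the right of cell k contributes a factor r k to its probability, hence the second
    exponent. *)
Definition counts_moment (b : seq nat) : R :=
  \prod_(k < size b) mixed_moment theta delta (nth 0%N b k) (sumn (drop k.+1 b)).

Lemma counts_moment_cons c b :
  counts_moment (c :: b) = mixed_moment theta delta c (sumn b) * counts_moment b.
Proof. by rewrite /counts_moment big_ord_recl/= drop0. Qed.

Lemma grid_sumE K lam : all (leq 1) lam ->
  grid_sum theta delta K lam = \sum_(b <- padded K lam) counts_moment b.
Proof.
elim: K lam => [|K IH] lam lpos.
  case: lam lpos => [|l lam] lpos /=; last by rewrite big_nil.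
  by rewrite big_seq1 /counts_moment big_ord0.
have sumn_padded l b : all (leq 1) l -> b \in padded K l -> sumn b = sumn l.
  by move=> lp; rewrite mem_padded// => /andP[_ /eqP <-]; rewrite sumn_filter_neq0.
rewrite /= big_cat big_map/=; congr (_ + _).
  rewrite IH// big_distrr/= big_seq [RHS]big_seq; apply: eq_bigr => b bl.
  by rewrite counts_moment_cons (sumn_padded lam).
case: lam lpos => [|l lam] /= lpos; first by rewrite big_nil.
case/andP: lpos => l0 lpos.
rewrite big_map IH// big_distrr/= big_seq [RHS]big_seq; apply: eq_bigr => b bl.
by rewrite counts_moment_cons (sumn_padded lam).
Qed.

(** A sequence of counts comes from a multinomial number of labelings. Zero counts do not change the
    product of the factorials, so this number depends on lam alone. *)
Lemma sum_label_composition n K lam : all (leq 1) lam -> sumn lam = n ->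
  \sum_(t : n.-tuple 'I_K | label_composition K (tnth t) == lam)
     counts_moment (label_counts K (tnth t)) =
  n`!%:R / (\prod_(l <- lam) l`!)%:R * grid_sum theta delta K lam.
Proof.
move=> lpos ln.
rewrite grid_sumE// big_distrr/=.
transitivity (\sum_(t : n.-tuple 'I_K) \sum_(b <- padded K lam)
   (if label_counts K (tnth t) == b then counts_moment b else 0)).
  rewrite big_mkcond/=; apply: eq_bigr => t _.
  have <- : (label_counts K (tnth t) \in padded K lam) =
     (label_composition K (tnth t) == lam).
    by rewrite mem_padded// size_map size_iota eqxx.
  case: ifPn => [tin|tn].
    rewrite (bigD1_seq _ tin (padded_uniq _ lpos))/= eqxx//= big1 ?addr0//.
    by move=> b; rewrite eq_sym => /negbTE ->.
  rewrite big_seq big1// => b bl; case: eqP => // tb.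
  by rewrite tb bl in tn.
rewrite exchange_big/= big_seq [RHS]big_seq; apply: eq_bigr => b bl.
have := bl; rewrite mem_padded// => /andP[/eqP bK /eqP blam].
rewrite -big_mkcond/= sumr_const -[LHS]mulr_natl; congr (_ * _).
have -> : #|[pred t : n.-tuple 'I_K | label_counts K (tnth t) == b]| =
  #|[pred t : n.-tuple 'I_K | [forall a : 'I_K, count_mem a t == nth 0%N b a]]|.
  apply: eq_card => t; rewrite !inE.
  have cE (a : 'I_K) : #|[pred i | tnth t i == a :> nat]| = count_mem a t.
    by rewrite -sum1_count big_tuple sum1_card.
  apply/eqP/forallP => [tb a|tb].
    rewrite -tb (nth_map 0%N) ?size_iota// nth_iota// add0n; apply/eqP.
    by rewrite -cE; apply: eq_card.
  apply: (@eq_from_nth _ 0%N); rewrite size_map size_iota ?bK// => k kK.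
  rewrite (nth_map 0%N) ?size_iota// nth_iota// add0n.
  by rewrite -(eqP (tb (Ordinal kK))) -cE; apply: eq_card.
have sb : (\sum_(a : 'I_K) nth 0%N b a = n)%N.
  by rewrite -ln -blam sumn_filter_neq0 sumnE (big_nth 0%N) bK big_mkord.
have := card_tuple_counts sb.
have -> : (\prod_(a < K) (nth 0%N b a)`! = \prod_(l <- lam) l`!)%N.
  by rewrite -blam prod_fact_filter_neq0 (big_nth 0%N) bK big_mkord.
move=> <-; rewrite natrM mulfK// pnatr_eq0 -lt0n prodn_gt0// => l.
exact: fact_gt0.
Qed.

(** Cell k has length 1 - r k times the product of the earlier r j, so r k is collected once for
    every point in a later cell. *)
Lemma prod_cells (r : nat -> R) n K (t : n.-tuple 'I_K) :
  \prod_(i < n) ((\prod_(j < tnth t i) r j) * (1 - r (tnth t i))) =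
  \prod_(k < K) ((1 - r k) ^+ nth 0%N (label_counts K (tnth t)) k *
     r k ^+ sumn (drop k.+1 (label_counts K (tnth t)))).
Proof.
set b := label_counts K (tnth t).
have bE (k : 'I_K) : nth 0%N b k = #|[pred i | tnth t i == k]|.
  by rewrite /b (nth_map 0%N) ?size_iota// nth_iota//; apply: eq_card => i.
have -> : \prod_(i < n) ((\prod_(j < tnth t i) r j) * (1 - r (tnth t i))) =
   \prod_(k < K) ((\prod_(j < k) r j) * (1 - r k)) ^+ nth 0%N b k.
  rewrite (partition_big (tnth t) predT)//=; apply: eq_bigr => k _.
  rewrite bE -prodr_const; apply: eq_big => [i|i /eqP ->//].
  by rewrite inE.
under eq_bigr => k _ do rewrite exprMn.
rewrite big_split/= mulrC [RHS]big_split/=; congr (_ * _).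
transitivity (\prod_(k < K) \prod_(j < K | (j < k)%N) r j ^+ nth 0%N b k).
  apply: eq_bigr => k _; rewrite -prodrXl.
  rewrite (big_ord_widen K (fun j => r j ^+ nth 0%N b k))//.
  exact: ltnW.
rewrite (exchange_big_dep predT)//=; apply: eq_bigr => j _.
rewrite prodrXr; congr (_ ^+ _).
rewrite sumnE (big_nth 0%N) size_drop size_map size_iota.
under [RHS]eq_bigr => k _ do rewrite nth_drop addnC.
by rewrite -(big_addn 0%N K j.+1 xpredT (nth 0%N b)) add0n big_geq_mkord.
Qed.

End grid_sums.

(** * Adjoining a uniform sample *)

Section extension.
Context {R : realType}.

Lemma uniform_prob_itv (a b : R) : 0 <= a -> a <= b -> b <= 1 ->
  uniform_prob (@ltr01 R) `[a, b[ = (b - a)%:E.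
Proof.
move=> a0 ab b1; rewrite /uniform_prob.
rewrite (eq_integral (fun=> 1%E)).
  rewrite integral_cst//= mul1e lebesgue_measure_itv/= lte_fin.
  by move: ab; rewrite le_eqVlt => /predU1P[->|->]; rewrite ?ltxx ?subrr// EFinB.
move=> x; rewrite inE/= in_itv/= => /andP[ax xb]; rewrite /uniform_pdf.
by rewrite (le_trans a0 ax) (le_trans (ltW xb) b1)/= subr0 invr1.
Qed.

Definition in_cell (a b x : R) : R := (a <= x < b)%R%:R.

Lemma measurable_in_cell d (T : measurableType d) (a b X : T -> R) :
  measurable_fun setT a -> measurable_fun setT b -> measurable_fun setT X ->
  measurable_fun setT (fun w => in_cell (a w) (b w) (X w)).
Proof.
move=> ma mb mX.
rewrite (_ : (fun _ => _) = \1_([set w | a w <= X w] `&` [set w | X w < b w])).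
  apply: measurable_indic; apply: measurableI.
    rewrite -[X in measurable X]setTI.
    by have /(_ measurableT [set true]) := measurable_fun_ler ma mX; exact.
  rewrite -[X in measurable X]setTI.
  by have /(_ measurableT [set true]) := measurable_fun_ltr mX mb; exact.
apply/funext => w; rewrite /in_cell indicE; congr ((nat_of_bool _)%:R).
by apply/idP/idP => [/andP[aX Xb]|/set_mem[/= -> ->]//]; rewrite mem_set.
Qed.

Lemma in_cell01 (a b x : R) : 0 <= in_cell a b x <= 1.
Proof. by rewrite /in_cell; case: (_ <= _ < _); rewrite !lexx ler01. Qed.

(* X 0, ..., X (n-1) are independent uniform points of [0, 1], independent of
   everything that is defined on the base space T of the projection pi; only
   what is needed below is required, namely the conditional probabilities,
   given pi, of boxes whose sides depend on pi. *)
Definition uniform_extension d d' (T : measurableType d) (T' : measurableType d')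
    (P : probability T R) (P' : probability T' R) (pi : T' -> T) (n : nat)
    (X : nat -> T' -> R) : Prop :=
  forall (h : T -> R) (a b : nat -> T -> R),
    bounded_rv h -> (forall w, 0 <= h w) ->
    (forall i, measurable_fun setT (a i)) ->
    (forall i, measurable_fun setT (b i)) ->
    (forall i w, [/\ 0 <= a i w, a i w <= b i w & b i w <= 1]) ->
    Ex P' (fun w => h (pi w) * \prod_(i < n) in_cell (a i (pi w)) (b i (pi w)) (X i w))
    = Ex P (fun w => h w * \prod_(i < n) (b i w - a i w)).

(** One point is adjoined at a time. Integrating the newest coordinate first turns its indicator
    into b n - a n, a function on the base space that is absorbed into the weight h; this is why
    [uniform_extension] has a weight and boxes depending on the base. *)
Lemma sample_extension d (T : measurableType d) (P : probability T R) (n : nat) :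
  exists d' (T' : measurableType d') (P' : probability T' R) (pi : T' -> T)
    (X : nat -> T' -> R),
  [/\ measurable_fun setT pi, forall i, measurable_fun setT (X i) &
      uniform_extension P P' pi n X].
Proof.
elim: n => [|n [d' [T' [P' [pi [X [mpi mX H]]]]]]].
  exists d, T, P, id, (fun=> cst 0); split => //.
  move=> h a b _ _ _ _ _; congr Ex; apply/funext => w; by rewrite !big_ord0.
pose U : probability (measurableTypeR R) R := uniform_prob (@ltr01 R).
exists _, (T' * measurableTypeR R)%type, (P' \x U)%E, (pi \o fst),
  (fun i w => if (i < n)%N then X i w.1 else w.2); split.
- exact: measurableT_comp.
- move=> i; case: (i < n)%N; last exact: measurable_snd.
  by apply: measurableT_comp => //; exact: measurable_fst.
move=> h a b bh h0 ma mb ab.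
pose G w := h (pi w) * \prod_(i < n) in_cell (a i (pi w)) (b i (pi w)) (X i w).
have bpi (f : T -> R) : bounded_rv f -> bounded_rv (f \o pi).
  by move=> [mf [C fC]]; split; [exact: measurableT_comp | exists C => w; exact: fC].
have bcell i : bounded_rv (fun w => in_cell (a i (pi w)) (b i (pi w)) (X i w)).
  apply: bounded_rv01; last by move=> w; exact: in_cell01.
  apply: measurable_in_cell => //; exact: measurableT_comp.
have bG : bounded_rv G.
  by apply: bounded_rvM; [exact: bpi | apply: bounded_rv_prod => i _; exact: bcell].
have G0 w : 0 <= G w.
  apply: mulr_ge0 => //; apply: prodr_ge0 => i _.
  by case/andP: (in_cell01 (a i (pi w)) (b i (pi w)) (X i w)).
pose F (z : T' * measurableTypeR R) := G z.1 * in_cell (a n (pi z.1)) (b n (pi z.1)) z.2.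
have mF : measurable_fun setT F.
  apply: measurable_funM.
    by apply: measurableT_comp; [case: bG | exact: measurable_fst].
  apply: measurable_in_cell; last exact: measurable_snd.
    by do 2 apply: measurableT_comp => //; exact: measurable_fst.
  by do 2 apply: measurableT_comp => //; exact: measurable_fst.
have bF : bounded_rv F.
  have [_ [C GC]] := bG.
  split => //; exists C => z; rewrite normrM.
  have /andP[c0 c1] := in_cell01 (a n (pi z.1)) (b n (pi z.1)) z.2.
  by rewrite -[C]mulr1 ler_pM// ger0_norm.
transitivity (Ex (P' \x U)%E F).
  congr Ex; apply/funext => z; rewrite /F /G big_ord_recr/= ltnn mulrA.
  by congr (_ * _ * _); apply: eq_bigr => i _; rewrite ltn_ord.
have bl : bounded_rv (fun w => b n w - a n w).
  apply: bounded_rv01; first exact: measurable_funB.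
  by move=> w; have [a0 ab' b1] := ab n w; apply/andP; split; lra.
have step : Ex (P' \x U)%E F = Ex P' (fun w => G w * (b n (pi w) - a n (pi w))).
  have bGl : bounded_rv (fun w => G w * (b n (pi w) - a n (pi w))).
    exact: (bounded_rvM bG (bpi _ bl)).
  apply: EFin_inj; rewrite (EFin_Ex _ bF) (EFin_Ex _ bGl).
  rewrite fubini_tonelli1//; last 2 first.
  - exact/measurable_EFinP.
  - move=> z; rewrite lee_fin; exact: mulr_ge0.
  apply: eq_integral => w _; rewrite /fubini_F /F/=.
  have [a0 ab' b1] := ab n (pi w).
  transitivity ((G w)%:E * \int[U]_x (\1_(`[a n (pi w), b n (pi w)[) x)%:E)%E.
    rewrite -ge0_integralZl//; last 2 first.
    - by apply/measurable_EFinP; exact: measurable_indic.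
    - by rewrite lee_fin.
    apply: eq_integral => x _; rewrite EFinM; congr (_ * _%:E)%E.
    rewrite /in_cell indicE; congr ((nat_of_bool _)%:R).
    by apply/idP/idP => [ax|/set_mem]; [rewrite mem_set//= in_itv | rewrite /= in_itv].
  by rewrite integral_indic// setIT [X in (_ * X)%E]uniform_prob_itv.
rewrite step.
have := H (fun w => h w * (b n w - a n w)) a b.
have -> : (fun w => h (pi w) * (b n (pi w) - a n (pi w)) *
   \prod_(i < n) in_cell (a i (pi w)) (b i (pi w)) (X i w)) =
  (fun w => G w * (b n (pi w) - a n (pi w))).
  by apply/funext => w; rewrite /G; ring.
move=> ->//.
- by congr Ex; apply/funext => w; rewrite big_ord_recr/=; ring.
- exact: bounded_rvM.
- by move=> w; apply: mulr_ge0 => //; have [_ ab' _] := ab n w; rewrite subr_ge0.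
Qed.

End extension.

(** * Blocks of a paintbox *)

Lemma undup_map_in (T1 T2 : eqType) (f : T1 -> T2) (s : seq T1) :
  {in s &, injective f} -> undup (map f s) = map f (undup s).
Proof.
elim: s => //= x s IH inj.
have {}IH : undup (map f s) = map f (undup s).
  by apply: IH => y z ys zs; apply: inj; rewrite inE (ys, zs) orbT.
have -> : (f x \in map f s) = (x \in s).
  apply/mapP/idP => [[y ys fxy]|xs]; last by exists x.
  by rewrite (inj x y) ?inE ?eqxx ?ys ?orbT.
by case: ifP => _ //=; rewrite IH.
Qed.

Section blocks.
Context {R : realType}.
Implicit Types (U : set R) (x y : R).

Lemma paintbox_block_refl U x : paintbox_block U x x.
Proof.
rewrite /paintbox_block; case: ifPn => // /set_mem Ux.
exact: connected_component_refl.
Qed.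

Lemma paintbox_block_eq U x y : paintbox_block U y x ->
  paintbox_block U x = paintbox_block U y.
Proof.
rewrite {1}/paintbox_block; case: ifPn => [yU|_ ->//].
move=> xy; have Ux : U x by exact: connected_component_sub xy.
rewrite /paintbox_block mem_set// yU.
exact/esym/same_connected_component.
Qed.

Lemma paintbox_blockP U x y : U x -> U y ->
  paintbox_block U y x <-> `[Num.min x y, Num.max x y] `<=` U.
Proof.
move=> Ux Uy; rewrite /paintbox_block mem_set//; split=> [cxy z zxy|sub].
  apply: (@connected_component_sub _ _ y).
  have /connected_intervalP itv := @component_connected _ U y.
  have cy : connected_component U y y by exact: connected_component_refl.
  move: zxy => /=; rewrite in_itv/=; case: (leP x y) => xy zxy.
    exact: (itv x y).
  exact: (itv y x).
apply: (@connected_component_max _ _ `[Num.min x y, Num.max x y]) => //=.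
- by rewrite in_itv/= ge_min le_max !lexx !orbT.
- exact: segment_connected.
- by rewrite in_itv/= ge_min le_max !lexx.
Qed.

(** Labels that increase with the points and separate exactly the blocks determine the composition:
    the used labels in increasing order list the occupied blocks from left to right. *)
Lemma paintbox_composition_labels U n (x : 'I_n -> R) K (kappa : 'I_n -> nat) :
  (forall i, (kappa i < K)%N) ->
  (forall i j, (kappa i < kappa j)%N -> x i < x j) ->
  (forall i j, paintbox_block U (x j) (x i) <-> kappa i = kappa j) ->
  paintbox_composition U [seq x i | i <- enum 'I_n] = label_composition K kappa.
Proof.
move=> kK kx bk.
pose F k := if [pick i | kappa i == k] is Some i then paintbox_block U (x i) else set0.
have FE i : F (kappa i) = paintbox_block U (x i).
  rewrite /F; case: pickP => [j /eqP ji|/(_ i)]; last by rewrite eqxx.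
  by apply: paintbox_block_eq; apply/bk.
have memF i j : (x i \in F (kappa j)) = (kappa i == kappa j).
  by rewrite FE; apply/idP/eqP => [/set_mem/bk//|/bk]; exact: mem_set.
pose s := sort (relpre x <=%R) (enum 'I_n).
have ms i : i \in s by rewrite mem_sort mem_enum.
pose l := map kappa s.
rewrite /paintbox_composition /occupied_blocks sort_map -/s.
have -> : [seq paintbox_block U y | y <- map x s] = map F l.
  by rewrite /l -!map_comp; apply: eq_map => i /=; rewrite FE.
rewrite undup_map_in; last first.
  move=> _ _ /mapP[i _ ->] /mapP[j _ ->] Fij; apply/bk.
  by rewrite -FE -Fij FE; exact: paintbox_block_refl.
(* Both lists are strictly increasing and have the same elements. *)
have -> : undup l = [seq k <- iota 0 K | k \in l].
  apply: (@irr_sorted_eq _ ltn); [exact: ltn_trans | exact: ltnn | | |].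
  - rewrite ltn_sorted_uniq_leq undup_uniq/=; apply: undup_sorted; first exact: leq_trans.
    rewrite /l sorted_map; apply: (@sub_sorted _ (relpre x <=%R)).
      move=> i j /= xij; rewrite leqNgt; apply/negP => /kx.
      by rewrite ltNge xij.
    by apply: sort_sorted => i j /=; exact: le_total.
  - by apply: sorted_filter; [exact: ltn_trans | exact: iota_ltn_sorted].
  - move=> k; rewrite mem_undup mem_filter mem_iota add0n/=.
    by case: (boolP (k \in l)) => // /mapP[i _ ->]; rewrite kK.
rewrite /label_composition /label_counts filter_map.
have cE k : k \in l -> count (fun y => y \in F k) [seq x i | i <- enum 'I_n] =
    #|[pred i | kappa i == k]|.
  move=> /mapP[j _ ->]; rewrite count_map -sum1_count big_enum_cond/= sum1_card.
  by apply: eq_card => i; rewrite !inE /= -memF; apply/idP/idP.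
have fE : [seq k <- iota 0 K | k \in l] =
   [seq k <- iota 0 K | preim (fun k => #|[pred i | kappa i == k]|) (fun c => c != 0%N) k].
  apply: eq_filter => k /=; rewrite -lt0n; apply/mapP/card_gt0P => [[i _ ->]|[i]].
    by exists i; rewrite inE.
  by rewrite inE => /eqP <-; exists i.
rewrite -[LHS]map_comp fE; apply/eq_in_map => k; rewrite -fE mem_filter => /andP[kl _] /=.
exact: cE.
Qed.

End blocks.

(** * Paths of the subordinator *)

(* The second condition is the right continuity of the path, uniformly on bounded
   time intervals: the jumps of small size contribute a factor close to 1. *)
Definition tame_atoms (R : realType) (a : nat -> R * R) : Prop :=
  [/\ regular_atoms a,
    forall (t : nat) (e : R), 0 < e -> exists m : nat,
      1 - e < jump_lim (fun j => (a j).2)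
        (fun j => ((a j).1 <= t%:R) && ((a j).2 <= m.+1%:R^-1)) &
    forall e : R, 0 < e ->
      exists t : nat, 1 - e < geometric_subordinator a t%:R].

Section tame_paths.
Context {R : realType}.
Variable a : nat -> R * R.
Hypothesis tame : tame_atoms a.
Local Notation S := (geometric_subordinator a).
Local Notation xi := (fun j => (a j).2).
Local Notation U := (geometric_paintbox a).

Let xi01 j : 0 <= xi j <= 1.
Proof. by case: tame => -[H _] _ _; case: (H j). Qed.

Lemma subordinatorE t : S t = 1 - jump_lim xi (fun j => (a j).1 <= t).
Proof. by []. Qed.

Lemma subordinator0 : S 0 = 0.
Proof.
have [[H _] _ _] := tame; rewrite subordinatorE jump_lim0 ?subrr// => j.
by rewrite -ltNge; case: (H j).
Qed.

Lemma le_subordinator s t : s <= t -> S s <= S t.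
Proof.
move=> st; rewrite !subordinatorE lerB// le_jump_lim// => j /le_trans; exact.
Qed.

Lemma subordinator_grid N k :
  1 - S (k.+1%:R * mesh N) = (1 - S (k%:R * mesh N)) *
  jump_lim xi (window_pred a (time_cell (mesh N) k) setT).
Proof.
rewrite !subordinatorE !subKr; apply: jump_lim_split => // j.
  rewrite /window_pred in_setT andbT /time_cell mem_setE in_itv/=.
  case: (leP (a j).1 (k%:R * mesh N)) => //= h.
  by rewrite (le_trans h)// ler_wpM2r ?ler_nat// ltW// mesh_gt0.
rewrite /window_pred in_setT andbT /time_cell mem_setE in_itv/=.
by case: (leP (a j).1 (k%:R * mesh N)) => //= h.
Qed.

Lemma subordinator_right_continuous t (e : R) : 0 < e ->
  exists2 t', t < t' & S t' < S t + e.
Proof.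
move=> e0; have [[_ fin] small _] := tame.
pose n := (Num.truncn (t + 1)).+1.
have tn : t + 1 < n%:R by exact: truncnS_gt.
have [m Hm] := small n _ e0.
pose F := [set j | (a j).1 <= n%:R /\ m.+1%:R^-1 < (a j).2].
have fF : finite_set F by exact: fin.
(* The time t' precedes all the finitely many later atoms of F, so the atoms in ]t, t'] have size at
   most 1 / (m + 1). *)
pose t' := \big[Num.min/(t + 1)]_(j <- fset_set F | t < (a j).1) ((t + (a j).1) / 2).
have tt' : t < t'.
  rewrite /t'; elim/big_ind: _ => [|x y tx ty|j tj]; first by lra.
    by rewrite lt_min tx ty.
  lra.
have t'1 : t' <= t + 1 by exact: bigmin_le_id.
have t'F j : F j -> t < (a j).1 -> t' < (a j).1.
  move=> Fj tj; apply: (@le_lt_trans _ _ ((t + (a j).1) / 2)); last by lra.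
  by apply: ge_bigmin_seq => //; rewrite in_fset_set// mem_set.
exists t' => //.
rewrite !subordinatorE (@jump_lim_split _ xi _ (fun j => (a j).1 <= t)
    (fun j => t < (a j).1 <= t'))//; last 2 first.
- move=> j; case: (leP (a j).1 t) => //= tj.
  by rewrite (le_trans tj)// ltW.
- by move=> j; case: (leP (a j).1 t) => //= tj.
set L := jump_lim xi _; set J := jump_lim xi (fun j => t < (a j).1 <= t').
have /andP[L0 L1] : 0 <= L <= 1 by exact: jump_lim01.
have /andP[J0 J1] : 0 <= J <= 1 by exact: jump_lim01.
have Je : 1 - e < J.
  apply: (lt_le_trans Hm); apply: le_jump_lim => // j /andP[tj jt'].
  have jn : (a j).1 <= n%:R by rewrite (le_trans jt')// (le_trans t'1)// ltW.
  rewrite jn/= leNgt; apply/negP => mj.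
  by have := t'F j (conj jn mj) tj; rewrite ltNge jt'.
(* The increment of S is L * (1 - J), which this bounds by 1 - J < e. *)
have : 0 <= (1 - L) * (1 - J) by rewrite mulr_ge0// subr_ge0.
lra.
Qed.

Lemma mesh_lt (e : R) : 0 < e -> exists N, mesh N < e.
Proof.
move=> e0; have /cvgrPdist_lt/(_ _ e0)[N _ /(_ N (leqnn N))] := @mesh_cvg R.
rewrite /= sub0r normrN ger0_norm; first by exists N.
by rewrite ltW// mesh_gt0.
Qed.

(** If S t lies in the open interval, then by right continuity so does the value of S at a dyadic
    time slightly after t. Hence countably many times suffice. *)
Lemma subordinator_no_value (alpha beta : R) :
  (forall N k, ~ (alpha < S (k.+1%:R * mesh N) < beta)) ->
  forall t, 0 < t -> ~ (alpha < S t < beta).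
Proof.
move=> noval t t0 /andP[aS Sb].
have e0 : 0 < beta - S t by rewrite subr_gt0.
have [t' tt' St'] := subordinator_right_continuous t e0.
have [N Nt] : exists N, mesh N < t' - t by apply: mesh_lt; rewrite subr_gt0.
have d0 : 0 < mesh N :> R by exact: mesh_gt0.
(* The next grid time, of index k + 1, lies in [t, t']. *)
pose k := Num.truncn (t / mesh N).
have tk0 : 0 <= t / mesh N by apply: divr_ge0; exact: ltW.
have /andP[k1 k2] := truncn_itv tk0; rewrite -/k in k1 k2.
have tk : t <= k.+1%:R * mesh N by rewrite -ler_pdivrMr// ltW.
have kt' : k.+1%:R * mesh N <= t'.
  rewrite -natr1 mulrDl mul1r.
  have : k%:R * mesh N <= t by rewrite -ler_pdivlMr.
  lra.
apply: (noval N k); rewrite (lt_le_trans aS) ?le_subordinator//=.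
by apply: (le_lt_trans (le_subordinator kt')); lra.
Qed.

Lemma grid_refine (N N' k : nat) : (N <= N')%N ->
  k%:R * mesh N = (k * 2 ^ (N' - N))%N%:R * mesh N' :> R.
Proof.
move=> NN'; rewrite natrM -mulrA; congr (_ * _).
have e : (2 ^ N' = 2 ^ (N' - N) * 2 ^ N)%N by rewrite -expnD subnK.
rewrite /mesh [in (2 ^ N')%N]e natrM invfM mulrA divff ?mul1r//.
Qed.

Lemma segment_subset_paintbox (q r e : R) : 0 <= q -> r <= 1 -> 0 < e ->
  (forall N k, ~ (q - e < S (k.+1%:R * mesh N) < r + e)) ->
  `[q, r]%classic `<=` U.
Proof.
move=> q0 r1 e0 noval z /=; rewrite in_itv/= => /andP[qz zr]; split.
  by rewrite /= in_itv/= (le_trans q0)//= (le_trans zr).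
move=> /(_ `]q - e, r + e[%classic).
case.
  by apply: near_in_itvoo; rewrite in_itv/=; apply/andP; split; lra.
move=> _ [[t t0 <-] /=]; rewrite in_itv/=.
exact: (subordinator_no_value noval).
Qed.

Lemma paintbox_nearP (q : R) : U q ->
  exists2 e : R, 0 < e & forall t, 0 < t -> ~ (q - e < S t < q + e).
Proof.
move=> [_ /existsNP[B /not_implyP[/nbhs_ballP[e /= e0 qB] nB]]].
exists e => // t t0 St; apply: nB; exists (S t); split; first by exists t.
by apply: qB; rewrite /ball/= ltr_distlC; move/andP: St => [? ?]; apply/andP.
Qed.

(** This countable description in terms of dyadic values makes the event measurable up to a null
    set. The margin 1 / (m + 1) accounts for the closure; it comes from the two end points, since
    the values in between are excluded by the inclusion itself. *)
Lemma paintbox_segmentP (q r : R) : 0 <= q -> q <= r -> r <= 1 ->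
  `[q, r]%classic `<=` U <->
  exists m : nat, forall N k,
    ~ (q - m.+1%:R^-1 < S (k.+1%:R * mesh N) < r + m.+1%:R^-1).
Proof.
move=> q0 qr r1; split=> [sub|[m noval]]; last first.
  exact: (segment_subset_paintbox q0 r1 _ noval).
have [|e1 e10 H1] := @paintbox_nearP q.
  by apply: sub; rewrite /= in_itv/= lexx.
have [|e2 e20 H2] := @paintbox_nearP r.
  by apply: sub; rewrite /= in_itv/= lexx andbT.
have e0 : 0 < Num.min e1 e2 by rewrite lt_min e10.
have [m _ /(_ m (leqnn m))/=] := near_infty_natSinv_lt (PosNum e0).
rewrite lt_min => /andP[m1 m2]; exists m => N k /andP[].
move: (m.+1%:R^-1 : R) m1 m2 => v m1 m2 S1 S2.
have t0 : 0 < k.+1%:R * mesh N :> R by rewrite mulr_gt0// mesh_gt0.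
have [Sq|Sq] := ltP (S (k.+1%:R * mesh N)) q.
  by apply: (H1 _ t0); apply/andP; split; lra.
have [Sr|Sr] := ltP r (S (k.+1%:R * mesh N)).
  by apply: (H2 _ t0); apply/andP; split; lra.
have [|_] := sub (S (k.+1%:R * mesh N)); first by rewrite /= in_itv/= Sq.
by apply; apply: subset_closure; exists (k.+1%:R * mesh N).
Qed.

Definition good_point (x : R) : Prop := 0 < x < 1 /\
  exists2 e : R, 0 < e & forall N k, ~ (x - e < S (k.+1%:R * mesh N) < x + e).

Lemma good_point_paintbox x : good_point x -> U x.
Proof.
move=> [/andP[x0 x1] [e e0 noval]].
apply: (segment_subset_paintbox (ltW x0) (ltW x1) e0 noval).
by rewrite /= in_itv/= lexx.
Qed.

Lemma good_segmentP x y : good_point x -> good_point y -> x <= y ->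
  `[x, y]%classic `<=` U <-> forall N k, ~ (x < S (k.+1%:R * mesh N) <= y).
Proof.
move=> [/andP[x0 x1] [e1 e10 H1]] [/andP[y0 y1] [e2 e20 H2]] xy.
split=> [sub N k /andP[Sx Sy]|noval].
  have t0 : 0 < k.+1%:R * mesh N :> R by rewrite mulr_gt0// mesh_gt0.
  have [|_] := sub (S (k.+1%:R * mesh N)); first by rewrite /= in_itv/= ltW.
  by apply; apply: subset_closure; exists (k.+1%:R * mesh N).
have e0 : 0 < Num.min e1 e2 by rewrite lt_min e10.
apply: (segment_subset_paintbox (ltW x0) (ltW y1) e0) => N k /andP[Sx Sy].
have mn1 : Num.min e1 e2 <= e1 by rewrite ge_min lexx.
have mn2 : Num.min e1 e2 <= e2 by rewrite ge_min lexx orbT.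
have [Sx'|Sx'] := leP (S (k.+1%:R * mesh N)) x.
  by apply: (H1 N k); apply/andP; split; lra.
have [Sy'|Sy'] := leP (S (k.+1%:R * mesh N)) y.
  by apply: (noval N k); rewrite Sx' Sy'.
by apply: (H2 N k); apply/andP; split; lra.
Qed.

(** Two points are in different blocks if and only if some dyadic value of S separates them. For
    each of the finitely many pairs, a value found at one level is also a value at all finer
    levels. *)
Lemma composition_eventually n (x : 'I_n -> R) : (forall i, good_point (x i)) ->
  \forall N \near \oo, forall K (kappa : 'I_n -> nat),
    (forall i, (kappa i < K)%N) ->
    (forall i, S ((kappa i)%:R * mesh N) <= x i < S ((kappa i).+1%:R * mesh N)) ->
    paintbox_composition U [seq x i | i <- enum 'I_n] = label_composition K kappa.
Proof.
move=> good.
have : \forall N \near \oo, forall i j : 'I_n,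
    (exists N', exists k, x i < S (k.+1%:R * mesh N') <= x j) ->
    exists k, x i < S (k.+1%:R * mesh N) <= x j.
  apply: filter_forall => i; apply: filter_forall => j.
  have [[N' [k Sk]]|none] :=
    pselect (exists N', exists k, x i < S (k.+1%:R * mesh N') <= x j); last first.
    by apply: nearW.
  exists N' => // N /= NN' _; exists (k.+1 * 2 ^ (N - N')).-1.
  by rewrite prednK ?muln_gt0 ?expn_gt0// -grid_refine.
apply: filterS => N HN K kappa kK kx.
have mono (k l : nat) : (k <= l)%N -> S (k%:R * mesh N) <= S (l%:R * mesh N).
  by move=> kl; apply: le_subordinator; rewrite ler_wpM2r ?ler_nat// ltW// mesh_gt0.
have kx_lt i j : (kappa i < kappa j)%N -> x i < S ((kappa i).+1%:R * mesh N) <= x j.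
  move=> ij; case/andP: (kx i) => _ -> /=; case/andP: (kx j) => + _.
  by apply: le_trans; exact: mono.
have same i j : x i <= x j ->
    (forall N k, ~ (x i < S (k.+1%:R * mesh N) <= x j)) <-> kappa i = kappa j.
  move=> xij; split=> [noval|kij N' k val].
    case: (ltngtP (kappa i) (kappa j)) => // ij.
      by case: (noval N (kappa i)); exact: kx_lt.
    by have /andP[ji ij'] := kx_lt _ _ ij; have := lt_le_trans ji ij'; rewrite ltNge xij.
  have [l /andP[il lj]] := HN i j (ex_intro _ N' (ex_intro _ k val)).
  case/andP: (kx i) => ki _; case/andP: (kx j) => _; rewrite -kij => kj.
  have := le_lt_trans ki il; have := le_lt_trans lj kj.
  have [lk|kl] := leqP l.+1 (kappa i).
    by move=> _; rewrite ltNge mono.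
  by rewrite ltNge mono.
apply: paintbox_composition_labels => //.
  by move=> i j /kx_lt/andP[]; exact: lt_le_trans.
move=> i j; rewrite paintbox_blockP; [|exact: good_point_paintbox..].
case: (leP (x i) (x j)) => xij.
  by rewrite good_segmentP// same.
rewrite good_segmentP ?(ltW xij)// same ?(ltW xij)//; split; exact: esym.
Qed.

End tame_paths.

Lemma cell_exists (R : realType) (s : nat -> R) x : s 0%N <= x ->
  (exists k, x < s k) -> exists k, s k <= x < s k.+1.
Proof.
move=> s0 ex; case: (ex_minnP ex) => -[|k] xk mink.
  by rewrite ltNge s0 in xk.
exists k; rewrite xk andbT leNgt; apply/negP => /mink; by rewrite ltnn.
Qed.

(** * Measurable grid points and almost sure tameness *)

Section small_expectations.
Context {R : realType} {d : measure_display} {T : measurableType d}.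
Variable P : probability T R.

(** Markov's inequality for the event that X n >= e for all n. A single small value per point is all
    that the applications need, so no almost surely convergent subsequence is extracted. *)
Lemma small_expectation_ae (X : nat -> T -> R) (e : R) :
  (forall n, bounded_rv (X n)) -> (forall n w, 0 <= X n w) ->
  (fun n => Ex P (X n)) @ \oo --> 0 -> 0 < e ->
  {ae P, forall w, exists n, X n w < e}.
Proof.
move=> bX X0 cX e0; pose A := \bigcap_n [set w | e <= X n w].
have mA : measurable A.
  apply: bigcapT_measurable => n; rewrite -[X in measurable X]setTI.
  have [mX _] := bX n.
  by have /(_ measurableT [set true]) := measurable_fun_ler (measurable_cst e) mX; exact.
exists A; split => //; last first.
  by move=> w /= nex n _ /=; rewrite leNgt; apply/negP => Xn; apply: nex; exists n.
rewrite -Ex_indic//; apply: congr1; apply/eqP; rewrite eq_le; apply/andP; split; last first.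
  by apply: Rintegral_ge0 => w _; rewrite indicE.
have le1 n : e * Ex P \1_A <= Ex P (X n).
  rewrite -ExZl; last exact: bounded_rv_indic.
  apply: le_Ex => //.
    by apply: bounded_rvM; [exact: bounded_rv_cst | exact: bounded_rv_indic].
  move=> w; rewrite indicE; case: (boolP (w \in A)) => [/set_mem Aw|_].
    by rewrite mulr1; exact: Aw.
  by rewrite mulr0.
have : e * Ex P \1_A <= 0.
  by apply: (cvgr_to_ge cX); apply: nearW.
by rewrite pmulr_rle0.
Qed.

End small_expectations.

Section grid.
Context {R : realType} {d : measure_display} {T : measurableType d}.
Variables (theta : R) (theta_gt0 : 0 < theta) (P : probability T R).
Variable atom : nat -> T -> R * R.
Hypothesis atomP : poisson_process P (strip_intensity theta) atom.

Definition grid_ratio N k w := ratio atom (mesh N) setT k w.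

(** An everywhere measurable substitute for S at the time k * mesh N, equal to it for tame atoms. *)
Definition grid_point (N k : nat) (w : T) : R :=
  1 - \prod_(j < k) grid_ratio N j w.

Lemma grid_ratio01 N k w : 0 <= grid_ratio N k w <= 1.
Proof. exact: ratio01. Qed.

Lemma bounded_grid_ratio N k : bounded_rv (grid_ratio N k).
Proof. exact: (bounded_ratio atomP). Qed.

Lemma grid_point01 N k w : 0 <= grid_point N k w <= 1.
Proof.
have p0 : 0 <= \prod_(j < k) grid_ratio N j w.
  by apply: prodr_ge0 => j _; case/andP: (grid_ratio01 N j w).
have p1 : \prod_(j < k) grid_ratio N j w <= 1.
  by apply: prodr_ile1 => j _; exact: grid_ratio01.
by rewrite /grid_point; apply/andP; split; lra.
Qed.

Lemma measurable_grid_point N k : measurable_fun setT (grid_point N k).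
Proof.
apply: measurable_funB => //; apply: measurable_prod => j _.
by case: (bounded_grid_ratio N j).
Qed.

Lemma grid_point0 N w : grid_point N 0 w = 0.
Proof. by rewrite /grid_point big_ord0 subrr. Qed.

Lemma grid_cell N k w : grid_point N k.+1 w - grid_point N k w =
  (\prod_(j < k) grid_ratio N j w) * (1 - grid_ratio N k w).
Proof. by rewrite /grid_point big_ord_recr/=; ring. Qed.

Lemma grid_pointS N k w : grid_point N k w <= grid_point N k.+1 w.
Proof.
rewrite -subr_ge0 grid_cell; case/andP: (grid_ratio01 N k w) => _ r1.
rewrite mulr_ge0 ?subr_ge0//.
by apply: prodr_ge0 => j _; case/andP: (grid_ratio01 N j w).
Qed.

Lemma le_grid_point N k l w : (k <= l)%N -> grid_point N k w <= grid_point N l w.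
Proof.
move=> /subnK <-; elim: (l - k)%N => [|m IH]; first by rewrite add0n.
by rewrite addSn; apply: le_trans IH _; exact: grid_pointS.
Qed.

Lemma grid_pointE N k w : tame_atoms (fun j => atom j w) ->
  grid_point N k w = geometric_subordinator (fun j => atom j w) (k%:R * mesh N).
Proof.
move=> tame; have [reg _ _] := tame.
elim: k => [|k IH]; first by rewrite grid_point0 mul0r subordinator0.
have := subordinator_grid tame N k; rewrite -IH => e.
apply: (@subrI _ 1); rewrite [RHS]e /grid_point big_ord_recr/= !subKr.
by rewrite /grid_ratio ratioE.
Qed.

(** First moments suffice: the product over the jumps of size at most 1 / (m + 1) has mean tending
    to 1, and 1 - S at the integer time k has mean exp(- k h(1)), which tends to 0. *)
Lemma tame_atoms_ae : {ae P, forall w, tame_atoms (fun j => atom j w)}.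
Proof.
(* A single time cell of length t + 1 covers the times up to t and has positive length also for t =
   0. *)
have small : {ae P, forall w, forall t r : nat, exists m : nat,
    1 - ratio atom t.+1%:R `]-oo, m.+1%:R^-1] 0 w < r.+1%:R^-1}.
  apply: ae_foralln => t; apply: ae_foralln => r.
  have b m : bounded_rv (ratio atom t.+1%:R `]-oo, (m.+1%:R^-1 : R)] 0).
    by apply: (bounded_ratio atomP); exact: measurable_itv.
  apply: small_expectation_ae.
  - by move=> m; apply: bounded_rvB => //; exact: bounded_rv_cst.
  - by move=> m w; rewrite subr_ge0; case/andP: (ratio01 atom t.+1%:R `]-oo, m.+1%:R^-1] 0 w).
  - have E m : Ex P (fun w => 1 - ratio atom t.+1%:R `]-oo, m.+1%:R^-1] 0 w) =
        1 - expR (- (t.+1%:R * laplace_exponent theta `]-oo, m.+1%:R^-1] 1)).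
      rewrite ExB//; last exact: bounded_rv_cst.
      rewrite Ex_cst; congr (1 - _).
      have := @Ex_ratio _ _ _ _ theta_gt0 _ _ atomP t.+1%:R _ `]-oo, m.+1%:R^-1] 1 (fun=> 1%N).
      rewrite big_ord1 => <-//; congr Ex.
      by apply/funext => w; rewrite big_ord1 expr1.
    apply: (@squeeze_cvgr _ _ _ _ (fun=> 0) (fun m => t.+1%:R * (2 * harmonic m))).
    + exists 1%N => // m /= m0; rewrite E.
      have m2 : 0 <= (m.+1%:R^-1 : R) <= 2^-1.
        by rewrite invr_ge0 ler0n lef_pV2 ?posrE// ler_nat.
      have /andP[l0 l2] := laplace_exponent_small theta_gt0 m2.
      apply/andP; split.
        by rewrite subr_ge0 expR_le1 oppr_le0 mulr_ge0.
      have := expR_ge1Dx (- (t.+1%:R * laplace_exponent theta `]-oo, m.+1%:R^-1] 1)).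
      have : t.+1%:R * laplace_exponent theta `]-oo, m.+1%:R^-1] 1 <= t.+1%:R * (2 * harmonic m).
        by rewrite ler_wpM2l.
      move: (t.+1%:R * _) (t.+1%:R * (2 * _)) => u v; lra.
    + exact: cvg_cst.
    + rewrite -[X in _ --> X](mulr0 t.+1%:R); apply: cvgMr.
      rewrite -[X in _ --> X](mulr0 2); apply: cvgMr; exact: cvg_harmonic.
  - by rewrite invr_gt0.
have full : {ae P, forall w, forall r : nat, exists k : nat,
    \prod_(j < k) grid_ratio 0 j w < r.+1%:R^-1}.
  apply: ae_foralln => r; apply: small_expectation_ae.
  - by move=> k; apply: bounded_rv_prod => j _; exact: bounded_grid_ratio.
  - by move=> k w; apply: prodr_ge0 => j _; case/andP: (grid_ratio01 0 j w).
  - have E k : Ex P (fun w => \prod_(j < k) grid_ratio 0 j w) =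
        expR (- (mesh 0 * h theta 1)) ^+ k.
      have := @Ex_ratio _ _ _ _ theta_gt0 _ _ atomP (mesh 0) (mesh_gt0 0) setT k (fun=> 1%N) measurableT.
      rewrite prodr_const card_ord laplace_exponentT// => <-.
    under eq_fun do rewrite E.
    apply: cvg_expr; rewrite ger0_norm ?expR_ge0// expR_lt1 oppr_lt0.
    by rewrite mulr_gt0 ?mesh_gt0// h_gt0.
  - by rewrite invr_gt0.
have reg := regular_atoms_ae theta_gt0 atomP.
apply: filterS3 reg small full => w reg small full.
have xi01 j : 0 <= (atom j w).2 <= 1 by case: reg => /(_ j)[].
split => // [t e e0|e e0].
  have [r _ /(_ r (leqnn r))/= re] := near_infty_natSinv_lt (PosNum e0).
  have [m Hm] := small t r; exists m.
  rewrite ratioE// in Hm.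
  have : jump_lim (fun j => (atom j w).2) (window_pred (fun j => atom j w)
       (time_cell t.+1%:R 0) `]-oo, m.+1%:R^-1]) <=
     jump_lim (fun j => (atom j w).2)
       (fun j => ((atom j w).1 <= t%:R) && ((atom j w).2 <= m.+1%:R^-1)).
    apply: le_jump_lim => // j /andP[tj xj]; rewrite /window_pred !mem_setE.
    rewrite /time_cell !in_itv/= mul0r mul1r xj andbT.
    case: reg => /(_ j)[-> _] _ /=; rewrite (le_trans tj)// ler_nat//.
  by move: Hm re; move: (m.+1%:R^-1) (r.+1%:R^-1) => u v; lra.
have [r _ /(_ r (leqnn r))/= re] := near_infty_natSinv_lt (PosNum e0).
have [k Hk] := full r; exists k.
have -> : geometric_subordinator (fun j => atom j w) k%:R =
    1 - \prod_(j < k) grid_ratio 0 j w.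
  have mesh0 : mesh 0 = 1 :> R by rewrite /mesh expn0 invr1.
  rewrite subordinatorE; congr (1 - _).
  elim: (k) => [|l IH]; first by rewrite big_ord0 jump_lim0// => j;
    case: reg => /(_ j)[t0 _] _; rewrite -ltNge.
  rewrite big_ord_recr/= -IH /grid_ratio ratioE//; apply: jump_lim_split => // j.
    rewrite /window_pred in_setT andbT /time_cell mem_setE in_itv/= mesh0 !mulr1.
    case: (leP (atom j w).1 l%:R) => //= tl.
    by rewrite (le_trans tl)// ler_nat.
  rewrite /window_pred in_setT andbT /time_cell mem_setE in_itv/= mesh0 !mulr1.
  by case: (leP (atom j w).1 l%:R).
by move: Hk re; move: (r.+1%:R^-1) => u; lra.
Qed.

End grid.

(** * Sample points off the closed range *)

Lemma sum_in_cell (R : realType) (s : nat -> R) (K : nat) (x : R) :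
  {homo s : k l / (k <= l)%N >-> k <= l} ->
  \sum_(k < K) in_cell (s k) (s k.+1) x = in_cell (s 0%N) (s K) x.
Proof.
move=> ms; elim: K => [|K IH].
  by rewrite big_ord0 /in_cell; case: (leP (s 0%N) x) => //= h; rewrite ltNge h.
rewrite big_ord_recr/= IH /in_cell.
have s0K := ms 0%N K isT; have sKS := ms K K.+1 (leqnSn _).
have [xK|Kx] := ltP x (s K).
  by rewrite (lt_le_trans xK sKS)/= addr0 !andbT.
by rewrite andbF add0r (le_trans s0K Kx).
Qed.

Lemma le_in_cell (R : realType) (a b a' b' x : R) : a' <= a -> b <= b' ->
  in_cell a b x <= in_cell a' b' x.
Proof.
move=> aa bb; rewrite /in_cell ler_nat.
case: (boolP (a <= x < b)) => // /andP[ax xb].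
by rewrite (le_trans aa ax) (lt_le_trans xb bb).
Qed.

Lemma cell_pow_prod (R : realType) (f : nat -> R) (k Q : nat) :
  (\prod_(j < k) f j) * (1 - f k) * f k ^+ Q =
  \prod_(j < k.+1) ((1 - f j) ^+ (j == k :> nat) *
    f j ^+ (if j == k :> nat then Q else 1%N)).
Proof.
rewrite big_ord_recr/= eqxx expr1 mulrA; congr (_ * _ * _).
by apply: eq_bigr => j _; rewrite ltn_eqF// expr0 mul1r expr1.
Qed.

Section sampled_grid.
Context {R : realType} {d : measure_display} {T : measurableType d}.
Variables (theta : R) (theta_gt0 : 0 < theta) (P : probability T R).
Variable atom : nat -> T -> R * R.
Hypothesis atomP : poisson_process P (strip_intensity theta) atom.
Context {d' : measure_display} {T' : measurableType d'}.
Variables (P' : probability T' R) (pi : T' -> T) (n : nat) (X : nat -> T' -> R).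
Hypothesis mpi : measurable_fun setT pi.
Hypothesis mX : forall i, measurable_fun setT (X i).
Hypothesis ExX : uniform_extension P P' pi n X.

Local Notation r := (grid_ratio atom).
Local Notation s := (grid_point atom).
Local Notation mom N := (mixed_moment theta (mesh N)).

(** [uniform_extension] speaks only of boxes, so the null set B is tested with the full box: its
    indicator u has expectation 1, and the indicator of the preimage is at most its product with u
    plus 1 - u. *)
Lemma ae_pi (A : T -> Prop) : {ae P, forall w, A w} -> {ae P', forall w, A (pi w)}.
Proof.
move=> [B [mB B0 sB]]; exists (pi @^-1` B); split.
- by rewrite -[X in measurable X]setTI; exact: mpi.
- have mB' : measurable (pi @^-1` B).
    by rewrite -[X in measurable X]setTI; exact: mpi.
  pose u w := \prod_(i < n) in_cell 0 1 (X i w).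
  have bu : bounded_rv u.
    apply: bounded_rv_prod => i _; apply: bounded_rv01; last by move=> w; exact: in_cell01.
    exact: measurable_in_cell.
  have unit_prod (w : T) : \prod_(i < n) (1 - 0) = 1 :> R.
    by rewrite big1// => i _; rewrite subr0.
  have E1 : Ex P' u = 1.
    have := @ExX (fun=> 1) (fun _ _ => 0) (fun _ _ => 1) (bounded_rv_cst 1).
    have -> : (fun w => 1 * \prod_(i < n) in_cell 0 1 (X i w)) = u.
      by apply/funext => w; rewrite mul1r.
    move=> -> //; rewrite -[RHS](Ex_cst P); congr Ex; apply/funext => w.
    by rewrite mul1r unit_prod.
  have bB : bounded_rv (\1_(pi @^-1` B) : T' -> R) by exact: bounded_rv_indic.
  have E2 : Ex P' (fun w => \1_(pi @^-1` B) w * u w) = 0.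
    have := @ExX \1_B (fun _ _ => 0) (fun _ _ => 1) (bounded_rv_indic mB).
    have -> : (fun w => \1_B (pi w) * \prod_(i < n) in_cell 0 1 (X i w)) =
      (fun w => \1_(pi @^-1` B) w * u w).
      by apply/funext => w; rewrite /u !indicE.
    move=> -> //.
    transitivity (Ex P \1_B).
      by congr Ex; apply/funext => w; rewrite (unit_prod w); exact: mulr1.
    by apply: EFin_inj; rewrite Ex_indic.
  rewrite -Ex_indic//; congr EFin; apply/eqP; rewrite eq_le; apply/andP; split; last first.
    by apply: Rintegral_ge0 => w _; rewrite indicE.
  have -> : 0 = Ex P' (fun w => \1_(pi @^-1` B) w * u w + (1 - u w)).
    rewrite ExD ?E2 ?ExB ?Ex_cst ?E1 ?subrr ?addr0//.
    + exact: bounded_rv_cst.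
    + exact: bounded_rvM.
    + by apply: bounded_rvB => //; exact: bounded_rv_cst.
  apply: le_Ex => //.
    by apply: bounded_rvD; [exact: bounded_rvM | apply: bounded_rvB => //; exact: bounded_rv_cst].
  move=> w; have u1 : u w <= 1 by apply: prodr_ile1 => i _; exact: in_cell01.
  rewrite indicE; case: (w \in _); first by rewrite mul1r addrC subrK.
  by rewrite mul0r add0r subr_ge0.
- by move=> w /= nA; apply: sB.
Qed.

Section good_points.
Variable i : 'I_n.

(** With this choice 1 / (1 - margin Q) is 1 + 1 / (Q + 1), whose Q-th power is at most e; moreover
    twice the margin is at most 1. *)
Definition margin (Q : nat) : R := Q.+2%:R^-1.

(* good_sum Q N K is 1 if X i lies in the central part of one of the first K grid
   cells, a cell over which 1 - S is multiplied by at most 1 - margin Q, and 0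
   otherwise.  A point with this property for arbitrarily large N keeps a
   positive distance from the range of S. *)
Definition good_sum Q N K (w : T') : R :=
  \sum_(k < K) \1_[set w | margin Q <= 1 - r N k w] (pi w) *
    \prod_(j < n) in_cell
      (if j == i then s N k (pi w) + margin Q * (s N k.+1 (pi w) - s N k (pi w)) else 0)
      (if j == i then s N k.+1 (pi w) - margin Q * (s N k.+1 (pi w) - s N k (pi w)) else 1)
      (X j w).

Lemma margin_bounds Q : 0 < margin Q <= 2^-1.
Proof. by rewrite /margin invr_gt0 ltr0n lef_pV2 ?posrE// ler_nat. Qed.

Let cell_ge0 N k w : 0 <= s N k.+1 w - s N k w.
Proof. by rewrite subr_ge0; exact: grid_pointS. Qed.

Let lo_hi Q N k w :
  s N k w <= s N k w + margin Q * (s N k.+1 w - s N k w) /\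
  s N k.+1 w - margin Q * (s N k.+1 w - s N k w) <= s N k.+1 w.
Proof.
have c0 := cell_ge0 N k w; have /andP[m0 _] := margin_bounds Q.
by rewrite lerDl lerBlDr lerDl mulr_ge0// ltW.
Qed.

Lemma good_sum_le1 Q N K w : 0 <= good_sum Q N K w <= 1.
Proof.
have c0 (a b x : R) : 0 <= in_cell a b x by case/andP: (in_cell01 a b x).
have c1 (a b x : R) : in_cell a b x <= 1 by case/andP: (in_cell01 a b x).
apply/andP; split.
  apply: sumr_ge0 => k _; apply: mulr_ge0; first by rewrite indicE.
  by apply: prodr_ge0 => j _; exact: c0.
apply: (@le_trans _ _ (\sum_(k < K) in_cell (s N k (pi w)) (s N k.+1 (pi w)) (X i w))).
  apply: ler_sum => k _; rewrite (bigD1 i)//= eqxx.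
  have [lo hi] := lo_hi Q N k (pi w).
  set p := \prod_(j < n | j != i) _.
  have /andP[p0 p1] : 0 <= p <= 1.
    apply/andP; split.
      by apply: prodr_ge0 => j _; exact: c0.
    by apply: prodr_ile1 => j _; rewrite c0 c1.
  apply: le_trans (le_in_cell (X i w) lo hi); set q := in_cell _ _ _.
  have q0 : 0 <= q by exact: c0.
  rewrite indicE; case: (_ \in _); last by rewrite mul0r.
  by rewrite mul1r ler_piMr.
rewrite (@sum_in_cell _ (fun k => s N k (pi w))).
  exact: c1.
by move=> k l; exact: le_grid_point.
Qed.

Lemma measurable_pi (f : T -> R) : measurable_fun setT f -> measurable_fun setT (f \o pi).
Proof. by move=> mf; exact: measurableT_comp. Qed.

Let mratio_set Q N k : measurable [set w | margin Q <= 1 - r N k w].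
Proof.
have mr : measurable_fun setT (fun w => 1 - r N k w).
  by apply: measurable_funB => //; case: (bounded_grid_ratio atomP N k).
rewrite -[X in measurable X]setTI.
by have /(_ measurableT [set true]) :=
  measurable_fun_ler (measurable_cst (margin Q)) mr; exact.
Qed.

Let lo Q N k w := s N k w + margin Q * (s N k.+1 w - s N k w).
Let hi Q N k w := s N k.+1 w - margin Q * (s N k.+1 w - s N k w).

Let mlo Q N k : measurable_fun setT (lo Q N k).
Proof.
have ms l := measurable_grid_point atomP N l.
apply: (measurable_funD (ms k)); apply: measurable_funM => //.
exact: (measurable_funB (ms k.+1) (ms k)).
Qed.

Let mhi Q N k : measurable_fun setT (hi Q N k).
Proof.
have ms l := measurable_grid_point atomP N l.
apply: (measurable_funB (ms k.+1)); apply: measurable_funM => //.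
exact: (measurable_funB (ms k.+1) (ms k)).
Qed.

Lemma bounded_good_term Q N k : bounded_rv (fun w => \1_[set w | margin Q <= 1 - r N k w] (pi w) *
    \prod_(j < n) in_cell (if j == i then lo Q N k (pi w) else 0)
      (if j == i then hi Q N k (pi w) else 1) (X j w)).
Proof.
apply: bounded_rvM.
  have [mI _] := @bounded_rv_indic R _ _ _ (mratio_set Q N k).
  apply: bounded_rv01; first exact: (measurable_pi mI).
  by move=> w; rewrite indicE; case: (_ \in _); rewrite !lexx ler01.
apply: bounded_rv_prod => j _; apply: bounded_rv01; last by move=> w; exact: in_cell01.
apply: measurable_in_cell => //; case: (j == i) => //.
- exact: (measurable_pi (mlo Q N k)).
- exact: (measurable_pi (mhi Q N k)).
Qed.

Lemma Ex_good_sum Q N K : Ex P' (good_sum Q N K) =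
  \sum_(k < K) Ex P (fun w => \1_[set w | margin Q <= 1 - r N k w] w *
     ((1 - 2 * margin Q) * (s N k.+1 w - s N k w))).
Proof.
rewrite /good_sum Ex_sum; last by move=> k _; exact: bounded_good_term.
apply: eq_bigr => k _.
have := @ExX \1_[set w | margin Q <= 1 - r N k w]
  (fun j w => if j == i then lo Q N k w else 0)
  (fun j w => if j == i then hi Q N k w else 1).
move=> ->.
- congr Ex; apply/funext => w; congr (_ * _).
  rewrite (bigD1 i)//= eqxx big1 ?mulr1; last first.
    by move=> j ji; rewrite ifN ?ifN ?subr0.
  by rewrite /lo /hi; ring.
- exact: bounded_rv_indic.
- by move=> w; rewrite indicE.
- by move=> j; case: (j == i).
- by move=> j; case: (j == i).
move=> j w; case: (j == i); last by split.
have /andP[m0 m1] := margin_bounds Q; have c0 := cell_ge0 N k w.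
have /andP[s0 _] := grid_point01 atom N k w.
have /andP[_ s1] := grid_point01 atom N k.+1 w.
have [l1 l2] := lo_hi Q N k w; rewrite -/(lo Q N k w) -/(hi Q N k w) in l1 l2.
split; [exact: le_trans l1 | | exact: le_trans s1].
have : margin Q * (s N k.+1 w - s N k w) <= 2^-1 * (s N k.+1 w - s N k w).
  by rewrite ler_wpM2r.
by rewrite /lo /hi; lra.
Qed.

Lemma Ex_cell_pow N k Q :
  Ex P (fun w => (s N k.+1 w - s N k w) * r N k w ^+ Q) =
  mom N 0 1 ^+ k * mom N 1 Q.
Proof.
have := Ex_mixed theta_gt0 atomP (mesh_gt0 N) k.+1 (fun j => (j == k) : nat)
  (fun j => if j == k then Q else 1%N).
rewrite big_ord_recr eqxx => e; transitivity (Ex P (fun w => \prod_(j < k.+1)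
  ((1 - ratio atom (mesh N) setT j w) ^+ (j == k :> nat) *
    ratio atom (mesh N) setT j w ^+ (if j == k :> nat then Q else 1%N)))).
  apply: (congr1 (Ex P)); apply/funext => w; rewrite grid_cell.
  exact: (cell_pow_prod (fun j => ratio atom (mesh N) setT j w)).
rewrite {}e; congr (_ * _); rewrite (eq_bigr (fun=> mom N 0 1)).
  by rewrite prodr_const card_ord.
by move=> j _ /=; rewrite ltn_eqF.
Qed.

(* If the factor r of a cell exceeds 1 - margin Q, then r^Q / (1 - margin Q)^Q
   exceeds 1: this bounds the contribution of the cells with a small jump. *)
Lemma good_term_lower N k Q :
  (1 - 2 * margin Q) * (mom N 0 1 ^+ k * (1 - mom N 0 1) -
     ((1 - margin Q) ^+ Q)^-1 * (mom N 0 1 ^+ k * mom N 1 Q)) <=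
  Ex P (fun w => \1_[set w | margin Q <= 1 - r N k w] w *
     ((1 - 2 * margin Q) * (s N k.+1 w - s N k w))).
Proof.
have /andP[m0 m1] := margin_bounds Q.
have m2 : 0 <= 1 - 2 * margin Q by lra.
have bc : bounded_rv (fun w => s N k.+1 w - s N k w).
  have bs l : bounded_rv (s N l).
    by apply: bounded_rv01; [exact: (measurable_grid_point atomP) | exact: grid_point01].
  exact: (bounded_rvB (bs k.+1) (bs k)).
have br : bounded_rv (fun w => r N k w ^+ Q).
  by apply: bounded_rvX; exact: (bounded_grid_ratio atomP).
have E0 : Ex P (fun w => s N k.+1 w - s N k w) = mom N 0 1 ^+ k * (1 - mom N 0 1).
  have := Ex_cell_pow N k 0; rewrite /= h0 mulr0 oppr0 expR0 => <-.
  by congr Ex; apply/funext => w; rewrite mulr1.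
rewrite -E0 -Ex_cell_pow -ExZl; last exact: bounded_rvM.
rewrite -ExB//; last by apply: bounded_rvM; [exact: bounded_rv_cst | exact: bounded_rvM].
rewrite -ExZl; last first.
  apply: bounded_rvB => //.
  by apply: bounded_rvM; [exact: bounded_rv_cst | exact: bounded_rvM].
apply: le_Ex.
- apply: bounded_rvM; first exact: bounded_rv_cst.
  apply: bounded_rvB => //.
  by apply: bounded_rvM; [exact: bounded_rv_cst | exact: bounded_rvM].
- apply: bounded_rvM; first exact: (bounded_rv_indic (mratio_set Q N k)).
  by apply: bounded_rvM => //; exact: bounded_rv_cst.
move=> w; have c0 := cell_ge0 N k w; have /andP[r0 r1] := grid_ratio01 atom N k w.
have q0 : 0 < (1 - margin Q) ^+ Q by rewrite exprn_gt0//; lra.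
rewrite indicE; case: (boolP (w \in _)) => [_|/negP nm].
  rewrite mul1r ler_wpM2l// lerBlDr lerDl mulr_ge0// ?invr_ge0 ?(ltW q0)//.
  by rewrite mulr_ge0// exprn_ge0.
rewrite mul0r mulr_ge0_le0// subr_le0 mulrCA ler_peMr// ler_pdivlMl// mulr1.
rewrite lerXn2r ?nnegrE//; first by lra.
by rewrite leNgt; apply/negP => rm; apply: nm; apply/mem_set => /=; lra.
Qed.

Definition good_bound Q N : R :=
  (1 - 2 * margin Q) *
  (1 - ((1 - margin Q) ^+ Q)^-1 * (mom N 1 Q / (1 - mom N 0 1))).

Lemma good_sum_lower Q N K :
  (1 - mom N 0 1 ^+ K) * good_bound Q N <= Ex P' (good_sum Q N K).
Proof.
rewrite Ex_good_sum; apply: (@le_trans _ _ (\sum_(k < K)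
    (mom N 0 1 ^+ k * (1 - mom N 0 1)) * good_bound Q N)); last first.
  apply: ler_sum => k _; apply: le_trans (good_term_lower N k Q).
  rewrite /good_bound le_eqVlt; apply/orP; left; apply/eqP.
  have p1 : 1 - mom N 0 1 != 0.
    by rewrite subr_eq0 eq_sym lt_eqF// mixed_moment0_lt1// mesh_gt0.
  have q0 : (1 - margin Q) ^+ Q != 0.
    by rewrite expf_neq0//; have /andP[m0 m1] := margin_bounds Q; rewrite gt_eqF//; lra.
  move: ((1 - margin Q) ^+ Q) q0 (mom N 0 1 ^+ k) => y y0 z.
  move: (mom N 0 1) (mom N 1 Q) p1 (1 - 2 * margin Q) => u v p1 t.
  by field; rewrite y0 p1.
rewrite -mulr_suml le_eqVlt; apply/orP; left; apply/eqP; congr (_ * _).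
move: (mom N 0 1) => p.
elim: K => [|K IH]; first by rewrite big_ord0 expr0 subrr.
by rewrite big_ord_recr/= -IH exprS; ring.
Qed.

(** The fraction theta / (theta + Q) is the quotient of 1 / (theta + Q), the limit of E ((1 - r)
    r^Q) / delta, and h(1) = 1 / theta. *)
Definition good_limit Q : R :=
  (1 - 2 * margin Q) * (1 - ((1 - margin Q) ^+ Q)^-1 * (theta / (theta + Q%:R))).

Lemma good_bound_cvg Q : good_bound Q @ \oo --> good_limit Q.
Proof.
apply: cvgMr; apply: cvgB; first exact: cvg_cst.
apply: cvgMr.
rewrite (_ : (fun _ => _) = (fun N => (mom N 1 Q / mesh N) / ((1 - mom N 0 1) / mesh N))).
  have -> : theta / (theta + Q%:R) = beta_limit theta 1 Q / h theta 1.
    rewrite hS h0 /beta_limit big_ord1 add0r.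
    by rewrite (addr0 theta) addr0 invrK fact0 div1r mulrC.
  apply: cvgM; first exact: mixed_moment_cvg.
  by apply: cvgV; [rewrite gt_eqF// h_gt0 | exact: mixed_moment0_cvg].
apply/funext => N; have d0 : 0 < mesh N :> R by exact: mesh_gt0.
by rewrite invf_div mulrA divfK ?gt_eqF.
Qed.

Lemma good_sum_near Q (e : R) N0 : 0 < e ->
  exists N K, (N0 <= N)%N /\ good_limit Q - e <= Ex P' (good_sum Q N K).
Proof.
move=> e0; have e2 : 0 < e / 2 by rewrite divr_gt0.
have /cvgrPdist_le/(_ _ e2)[N1 _ /(_ (maxn N0 N1) (leq_maxr _ _))/= HN] := @good_bound_cvg Q.
set N := maxn N0 N1 in HN; exists N.
have p01 : `|mom N 0 1| < 1.
  by rewrite ger0_norm ?expR_ge0// mixed_moment0_lt1// mesh_gt0.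
have c : (fun K => (1 - mom N 0 1 ^+ K) * good_bound Q N) @ \oo --> good_bound Q N.
  have : (fun K => (1 - mom N 0 1 ^+ K) * good_bound Q N) @ \oo --> (1 - 0) * good_bound Q N.
    by apply: cvgMl; apply: cvgB; [exact: cvg_cst | exact: cvg_expr].
  by rewrite subr0 mul1r.
have /cvgrPdist_le/(_ _ e2)[K _ /(_ K (leqnn K))/= HK] := c.
exists K; split; first exact: leq_maxl.
have := good_sum_lower Q N K; move: HN HK; rewrite !ler_norml.
by move=> /andP[? ?] /andP[? ?] ?; lra.
Qed.

(** The power of 1 / (1 - margin Q) stays below e while theta / (theta + Q) is of order 1 / Q, so
    [good_limit] tends to 1. *)
Lemma good_limit_ge Q : (0 < Q)%N ->
  1 - good_limit Q <= 2 * harmonic Q + expR 1 * ((theta + 1) * harmonic Q).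
Proof.
move=> Q0; have /andP[m0 m1] := margin_bounds Q.
have mh : margin Q <= harmonic Q by rewrite /margin/= lef_pV2 ?posrE// ler_nat.
have q1 : 0 < 1 - margin Q by lra.
have y0 : 0 <= ((1 - margin Q) ^+ Q)^-1 by rewrite invr_ge0 exprn_ge0// ltW.
have y1 : ((1 - margin Q) ^+ Q)^-1 <= expR 1.
  have -> : (1 - margin Q) = (1 + Q.+1%:R^-1)^-1.
    rewrite /margin; have : (Q.+1%:R : R) != 0 by [].
    have : (Q.+2%:R : R) != 0 by [].
    rewrite -!(natr1 Q.+1); move: (Q.+1%:R : R) => x x1 x0.
    by field; rewrite x0 x1.
  rewrite exprVn invrK; apply: (@le_trans _ _ (expR (Q.+1%:R^-1) ^+ Q)).
    by apply: lerXn2r; rewrite ?nnegrE ?expR_ge0 ?addr_ge0//; exact: expR_ge1Dx.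
  rewrite -expRM_natl ler_expR ler_pdivrMr// mul1r ler_nat//.
have t0 : 0 <= theta / (theta + Q%:R) by rewrite divr_ge0 ?addr_ge0// ltW.
have t1 : theta / (theta + Q%:R) <= (theta + 1) * harmonic Q.
  rewrite /= ler_pdivrMr ?ltr_wpDr// mulrAC ler_pdivlMr//.
  have Q1 : 0 <= Q%:R :> R by [].
  rewrite -natr1; have : 0 <= theta * theta by rewrite mulr_ge0// ltW.
  lra.
rewrite /good_limit; move: (theta / _) t0 t1 => t t0 t1.
have yt0 : 0 <= ((1 - margin Q) ^+ Q)^-1 * t by rewrite mulr_ge0.
have yt1 : ((1 - margin Q) ^+ Q)^-1 * t <= expR 1 * ((theta + 1) * harmonic Q).
  by rewrite ler_pM.
move: (((1 - margin Q) ^+ Q)^-1 * t) yt0 yt1 => u u0 u1.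
have mu0 : 0 <= margin Q * u by rewrite mulr_ge0// ltW.
apply: (@le_trans _ _ (2 * margin Q + u)); first by lra.
by apply: lerD => //; rewrite ler_wpM2l.
Qed.

Let never_good Q N0 : set T' := [set w | forall N K, good_sum Q (N0 + N) K w = 0].

Let measurable_good_sum Q N K : measurable_fun setT (good_sum Q N K).
Proof.
have [m _] := @bounded_rv_sum _ _ T' _ (index_enum 'I_K) xpredT _
  (fun k _ => bounded_good_term Q N k).
exact: m.
Qed.

Let measurable_never_good Q N0 : measurable (never_good Q N0).
Proof.
have -> : never_good Q N0 = \bigcap_N \bigcap_K
    (good_sum Q (N0 + N) K @^-1` [set 0]).
  by apply/seteqP; split => [w Hw N _ K _|w Hw N K]; [exact: Hw | exact: (Hw N I K I)].
apply: bigcapT_measurable => N; apply: bigcapT_measurable => K.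
by rewrite -[X in measurable X]setTI; exact: measurable_good_sum.
Qed.

Let Ex_never_good Q N0 : Ex P' \1_(never_good Q N0) <= 1 - good_limit Q.
Proof.
apply/ler_addgt0Pr => e e0; have [N [K [N0N lim]]] := good_sum_near Q N0 e0.
have bg : bounded_rv (good_sum Q N K).
  by apply: bounded_rv01; [exact: measurable_good_sum | exact: good_sum_le1].
have : Ex P' \1_(never_good Q N0) <= Ex P' (fun w => 1 - good_sum Q N K w).
  apply: le_Ex; first exact: bounded_rv_indic.
    by apply: bounded_rvB => //; exact: bounded_rv_cst.
  move=> w; rewrite indicE; case: (boolP (w \in _)) => [/set_mem ng|_].
    by rewrite -(subnKC N0N) (ng (N - N0)%N K) subr0.
  by rewrite subr_ge0; case/andP: (good_sum_le1 Q N K w).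
rewrite ExB ?Ex_cst//; last exact: bounded_rv_cst.
by move: lim; lra.
Qed.

(** Outside this set the point has good cells at arbitrarily fine levels. One level would not do,
    since S may come closer to the point at times between its grid times. *)
Let finally_never_good Q : set T' := \bigcup_N0 never_good Q N0.

Let Ex_finally_never_good Q : Ex P' \1_(finally_never_good Q) <= 1 - good_limit Q.
Proof.
have mono m k w : (m <= k)%N -> never_good Q m w -> never_good Q k w.
  by move=> mk Hm N K; rewrite -(subnKC mk) -addnA; exact: Hm.
have mA : measurable (finally_never_good Q) by exact: bigcup_measurable.
have c : (fun N0 => Ex P' \1_(never_good Q N0)) @ \oo --> Ex P' \1_(finally_never_good Q).
  apply: (@Ex_cvg _ _ _ _ _ _ 1).
  - by move=> N0; exact: measurable_indic.
  - by move=> N0 w; rewrite indicE; case: (_ \in _); rewrite ?normr1 ?normr0.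
  - exact: bounded_rv_indic.
  - apply: aeW => w; apply: cvg_near_cst.
    have [[N1 _ HN1]|nA] := pselect (finally_never_good Q w).
      exists N1; first by [].
      move=> N0 /= N10; have Hn : never_good Q N0 w := mono _ _ _ N10 HN1.
      have Hf : finally_never_good Q w by exists N0.
      by rewrite !indicE (mem_set Hn) (mem_set Hf).
    apply: nearW => N0; have Hn : ~ never_good Q N0 w by move=> Hw; apply: nA; exists N0.
    by rewrite !indicE (memNset Hn) (memNset nA).
by apply: (cvgr_to_le c); apply: nearW => N0; exact: Ex_never_good.
Qed.

Lemma good_points_ae :
  {ae P', forall w, good_point (fun j => atom j (pi w)) (X i w)}.
Proof.
have tame := ae_pi (tame_atoms_ae theta_gt0 atomP).
have mA Q : measurable (finally_never_good Q) by exact: bigcup_measurable.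
have some_good : {ae P', forall w, exists Q, \1_(finally_never_good Q) w < 1 :> R}.
  apply: (@small_expectation_ae _ _ _ _ (fun Q => \1_(finally_never_good Q)) 1);
    last exact: ltr01.
  - by move=> Q; exact: bounded_rv_indic.
  - by move=> Q w; rewrite indicE.
  apply: (@squeeze_cvgr _ _ _ _ (fun=> 0)
     (fun Q => 2 * harmonic Q + expR 1 * ((theta + 1) * harmonic Q))).
  - exists 1%N => // Q /= Q0; apply/andP; split.
      by apply: Rintegral_ge0 => w _; rewrite indicE.
    exact: le_trans (Ex_finally_never_good Q) (good_limit_ge Q0).
  - exact: cvg_cst.
  - have ch (c : R) : (fun Q => c * harmonic Q) @ \oo --> 0.
      by rewrite -[X in _ --> X](mulr0 c); apply: cvgMr; exact: (@cvg_harmonic R).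
    rewrite -[X in _ --> X]addr0; apply: cvgD; first exact: ch.
    rewrite (_ : (fun _ => _) = (fun Q => (expR 1 * (theta + 1)) * harmonic Q)).
      exact: ch.
    by apply/funext => Q; rewrite mulrA.
apply: filterS2 tame some_good => w tame [Q].
rewrite indicE; case: (boolP (w \in _)) => [_|/negP ng _]; first by rewrite ltxx.
have /andP[m0 m1] := margin_bounds Q.
set x := X i w; set a := fun j => atom j (pi w).
have cells N0 : exists2 N, (N0 <= N)%N & exists k,
    [/\ margin Q <= 1 - r N k (pi w), lo Q N k (pi w) <= x & x < hi Q N k (pi w)].
  have /existsNP[N /existsNP[K /eqP gs]] : ~ never_good Q N0 w.
    by move=> Hw; apply: ng; apply/mem_set; exists N0.
  exists (N0 + N)%N; first exact: leq_addr.
  apply: contrapT => nex; move: gs; rewrite /good_sum big1 ?eqxx// => k _.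
  rewrite indicE; case: (boolP (_ \in _)) => [/set_mem/= mr|_]; last by rewrite mul0r.
  rewrite (bigD1 i)//= eqxx -/(lo Q (N0 + N) k (pi w)) -/(hi Q (N0 + N) k (pi w)).
  rewrite -/x /in_cell; case: (boolP (_ <= x < _)) => [/andP[lx xh]|_].
    by case: nex; exists k.
  by rewrite mul0r mulr0.
(* The cell has length (1 - s k) * (1 - r k), at least margin Q * (1 - x) because s k <= x, and the
   central part stays margin Q times the length away from both ends. The resulting distance does not
   depend on N. *)
have basic N k : margin Q <= 1 - r N k (pi w) -> lo Q N k (pi w) <= x ->
    x < hi Q N k (pi w) -> [/\ x < 1, s N k (pi w) + margin Q ^+ 2 * (1 - x) <= x &
      x + margin Q ^+ 2 * (1 - x) < s N k.+1 (pi w)].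
  move=> mr lx xh; have [l1 h1] := lo_hi Q N k (pi w).
  have c0 := cell_ge0 N k (pi w).
  have /andP[_ s1] := grid_point01 atom N k.+1 (pi w).
  have sx : s N k (pi w) <= x by exact: le_trans lx.
  have x1 : x < 1 by apply: lt_le_trans xh _; exact: le_trans h1 s1.
  have cx : margin Q * (1 - x) <= s N k.+1 (pi w) - s N k (pi w).
    rewrite grid_cell mulrC; apply: ler_pM => //; rewrite ?subr_ge0 ?(ltW x1) ?(ltW m0)//.
    by move: sx; rewrite /grid_point; lra.
  have mcx : margin Q ^+ 2 * (1 - x) <= margin Q * (s N k.+1 (pi w) - s N k (pi w)).
    by rewrite expr2 -mulrA ler_wpM2l// ltW.
  by move: lx xh; rewrite /lo /hi; split => //; lra.
have [N _ [k [mr lx xh]]] := cells 0%N.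
have [x1 lx' xh'] := basic _ _ mr lx xh.
have rho0 : 0 < margin Q ^+ 2 * (1 - x) by rewrite mulr_gt0 ?exprn_gt0// subr_gt0.
split.
  rewrite x1 andbT; apply: lt_le_trans rho0 _; apply: le_trans lx'.
  by rewrite lerDr; case/andP: (grid_point01 atom N k (pi w)).
exists (margin Q ^+ 2 * (1 - x)) => // N' k' /andP[v1 v2].
(* A dyadic value of level N' is also a grid value of the finer level N2, hence not inside the cell
   k2 around x. *)
have [N2 N'2 [k2 [mr2 lx2 xh2]]] := cells N'.
have [_ sl sh] := basic _ _ mr2 lx2 xh2.
rewrite (grid_refine _ N'2) in v1 v2.
rewrite !grid_pointE// in sl sh.
have mono (l m : nat) : (l <= m)%N ->
    geometric_subordinator a (l%:R * mesh N2) <= geometric_subordinator a (m%:R * mesh N2).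
  move=> lm; apply: le_subordinator => //.
  by rewrite ler_wpM2r ?ler_nat// ltW// mesh_gt0.
have [le1|le2] := leqP (k'.+1 * 2 ^ (N2 - N')) k2.
  by move: (lt_le_trans v1 (mono _ _ le1)); rewrite ltNge lerBrDr sl.
by move: (lt_trans v2 (lt_le_trans sh (mono _ _ le2))); rewrite ltxx.
Qed.

End good_points.

End sampled_grid.

(** * The composition of the adjoined sample *)

Section limit_events.
Context {R : realType} {d : measure_display} {T : measurableType d}.
Variables (P : probability T R) (f : nat -> T -> R) (C : R) (E : set T).
Hypothesis mf : forall n, measurable_fun setT (f n).
Hypothesis fC : forall n w, `|f n w| <= C.
Hypothesis fE : {ae P, forall w, \forall n \near \oo, f n w = (w \in E)%:R}.

Lemma cvg_probability (p : R) : has_probability P E p%:E ->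
  (fun n => Ex P (f n)) @ \oo --> p.
Proof.
move=> [A [mA AE PA]].
have -> : p = Ex P \1_A by apply: EFin_inj; rewrite Ex_indic.
apply: (@Ex_cvg _ _ _ _ _ _ C) => //; first exact: bounded_rv_indic.
apply: filterS2 AE fE => w AE [N _ HN]; apply: cvg_near_cst.
exists N => // m Nm; rewrite HN// indicE; congr ((nat_of_bool _)%:R).
by apply/idP/idP => /set_mem/AE/mem_set.
Qed.

(** E itself need not be measurable; the event that f n = 1 from some index on represents it up to a
    null set. *)
Lemma has_probability_cvg (p : R) : (fun n => Ex P (f n)) @ \oo --> p ->
  has_probability P E p%:E.
Proof.
move=> cp; pose A := \bigcup_N \bigcap_n [set w | f (N + n)%N w = 1].
have mA : measurable A.
  apply: bigcupT_measurable => N; apply: bigcapT_measurable => n.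
  rewrite -[X in measurable X]setTI.
  exact: (mf (N + n)%N measurableT (measurable_set1 1)).
have AE : {ae P, forall w, A w <-> E w}.
  apply: filterS fE => w [N _ HN]; split.
    move=> [N' _ /(_ N I)/=]; rewrite HN/= ?leq_addl//.
    by case: (boolP (w \in E)) => [/set_mem//|_ /eqP]; rewrite eq_sym oner_eq0.
  by move=> Ew; exists N => // n _ /=; rewrite HN/= ?leq_addr// mem_set.
have PA : has_probability P E (Ex P \1_A)%:E.
  by exists A; split => //; rewrite Ex_indic.
exists A; split => //; rewrite -Ex_indic//; congr EFin.
exact: cvg_unique (cvg_probability PA) cp.
Qed.

End limit_events.

Lemma label_composition_widen n (K K' : nat) (kappa : 'I_n -> nat) :
  (forall i, (kappa i < K)%N) -> (K <= K')%N ->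
  label_composition K' kappa = label_composition K kappa.
Proof.
move=> kK /subnKC <-; rewrite /label_composition /label_counts iotaD map_cat filter_cat.
rewrite [X in _ ++ X](_ : _ = [::]) ?cats0//.
apply/eqP; rewrite -size_eq0 size_filter eqn0Ngt -has_count -all_predC.
apply/allP => c /mapP[k]; rewrite mem_iota add0n => /andP[Kk _] -> /=.
rewrite negbK; apply/eqP/eq_card0 => i; rewrite !inE.
by apply/eqP => ik; have := kK i; rewrite ik ltnNge Kk.
Qed.

Section cells.
Context {R : realType} (s : nat -> R) (n : nat).
Hypothesis ms : {homo s : k l / (k <= l)%N >-> k <= l}.
Implicit Types (kappa : 'I_n -> nat) (x : 'I_n -> R).

Definition in_cells kappa x : Prop := forall i, s (kappa i) <= x i < s (kappa i).+1.

Definition cells_indicator kappa x : R :=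
  \prod_i in_cell (s (kappa i)) (s (kappa i).+1) (x i).

Lemma cells_indicatorE kappa x : cells_indicator kappa x = `[< in_cells kappa x >]%:R.
Proof.
rewrite /cells_indicator; case: asboolP => H.
  by rewrite big1// => i _; rewrite /in_cell H.
have /existsNP[i /negP ni] := H.
by rewrite (bigD1 i)//= {1}/in_cell (negbTE ni) mul0r.
Qed.

Lemma in_cells_inj kappa kappa' x : in_cells kappa x -> in_cells kappa' x ->
  kappa =1 kappa'.
Proof.
move=> H H' i; have [kk|kk|//] := ltngtP (kappa i) (kappa' i); exfalso.
- have /andP[_ x1] := H i; have /andP[x2 _] := H' i.
  by have := lt_le_trans x1 (le_trans (ms kk) x2); rewrite ltxx.
- have /andP[_ x1] := H' i; have /andP[x2 _] := H i.
  by have := lt_le_trans x1 (le_trans (ms kk) x2); rewrite ltxx.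
Qed.

Lemma sum_cellsE K (G : ('I_n -> nat) -> R) kappa x : in_cells kappa x ->
  (forall i, (kappa i < K)%N) ->
  \sum_(t : n.-tuple 'I_K) cells_indicator (fun i => tnth t i) x * G (fun i => tnth t i) =
  G kappa.
Proof.
move=> H kK; pose t0 : n.-tuple 'I_K := [tuple Ordinal (kK i) | i < n].
have t0E : (fun i => tnth t0 i : nat) = kappa by apply/funext => i; rewrite tnth_mktuple.
rewrite (bigD1 t0)//= big1 ?addr0.
  by rewrite t0E cells_indicatorE asboolT// mul1r.
move=> t tt0; rewrite cells_indicatorE asboolF ?mul0r// => Ht.
case/eqP: tt0; apply: eq_from_tnth => i; apply/val_inj.
by rewrite tnth_mktuple; exact: (in_cells_inj Ht H).
Qed.

Lemma sum_cells0 K (G : ('I_n -> nat) -> R) x :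
  ~ (exists kappa, in_cells kappa x /\ forall i, (kappa i < K)%N) ->
  \sum_(t : n.-tuple 'I_K) cells_indicator (fun i => tnth t i) x * G (fun i => tnth t i) = 0.
Proof.
move=> H; rewrite big1// => t _; rewrite cells_indicatorE asboolF ?mul0r// => Ht.
by apply: H; exists (fun i => tnth t i : nat); split => // i; exact: ltn_ord.
Qed.

Lemma sum_cells01 K (G : ('I_n -> nat) -> R) x : (forall kappa, 0 <= G kappa <= 1) ->
  0 <= \sum_(t : n.-tuple 'I_K) cells_indicator (fun i => tnth t i) x *
    G (fun i => tnth t i) <= 1.
Proof.
move=> G01; have [[kappa [H kK]]|nk] :=
  pselect (exists kappa, in_cells kappa x /\ forall i, (kappa i < K)%N).
  by rewrite (sum_cellsE _ H kK).
by rewrite sum_cells0// lexx ler01.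
Qed.

End cells.

Section grid_expectation.
Context {R : realType} {d : measure_display} {T : measurableType d}.
Variables (theta : R) (theta_gt0 : 0 < theta) (P : probability T R).
Variable atom : nat -> T -> R * R.
Hypothesis atomP : poisson_process P (strip_intensity theta) atom.
Context {d' : measure_display} {T' : measurableType d'}.
Variables (P' : probability T' R) (pi : T' -> T) (n : nat) (X : nat -> T' -> R).
Hypothesis mpi : measurable_fun setT pi.
Hypothesis mX : forall i, measurable_fun setT (X i).
Hypothesis ExX : uniform_extension P P' pi n X.

Local Notation s := (grid_point atom).

Local Notation in_grid N kappa w :=
  (in_cells (fun k => s N k (pi w)) kappa (fun i : 'I_n => X i w)).
Local Notation grid_cells N kappa w :=
  (cells_indicator (fun k => s N k (pi w)) kappa (fun i : 'I_n => X i w)).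

Let ms N w : {homo (fun k => s N k (pi w)) : k l / (k <= l)%N >-> k <= l}.
Proof. by move=> k l; exact: le_grid_point. Qed.

Definition grid_indicator lam N K (w : T') : R :=
  \sum_(t : n.-tuple 'I_K) grid_cells N (fun i => tnth t i : nat) w *
    (label_composition K (fun i => tnth t i) == lam)%:R.

Lemma bounded_grid_cells N kappa : bounded_rv (fun w => grid_cells N kappa w).
Proof.
apply: bounded_rv_prod => i _; apply: bounded_rv01; last by move=> w; exact: in_cell01.
apply: measurable_in_cell => //.
- exact: (measurableT_comp (measurable_grid_point atomP N (kappa i)) mpi).
- exact: (measurableT_comp (measurable_grid_point atomP N (kappa i).+1) mpi).
Qed.

Lemma bounded_grid_indicator_term lam N K (t : n.-tuple 'I_K) :
  bounded_rv (fun w => grid_cells N (fun i => tnth t i : nat) w *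
    (label_composition K (fun i => tnth t i) == lam)%:R).
Proof. by apply: bounded_rvM; [exact: bounded_grid_cells | exact: bounded_rv_cst]. Qed.

Lemma measurable_grid_indicator lam N K : measurable_fun setT (grid_indicator lam N K).
Proof.
by case: (@bounded_rv_sum _ _ _ _ (index_enum (n.-tuple 'I_K)) xpredT _
  (fun t _ => bounded_grid_indicator_term lam N t)).
Qed.

Lemma Ex_grid_cells N K (t : n.-tuple 'I_K) :
  Ex P' (fun w => grid_cells N (fun i => tnth t i : nat) w) =
  counts_moment theta (mesh N) (label_counts K (tnth t)).
Proof.
(* The labels are extended to all of nat, the index type of the boxes in [uniform_extension]. *)
pose v i := nth 0%N [seq val j | j <- t] i.
have vE (i : 'I_n) : v i = tnth t i.
  by rewrite /v (nth_map (tnth t i)) ?size_tuple// -tnth_nth.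
have := @ExX (fun=> 1) (fun i w => s N (v i) w) (fun i w => s N (v i).+1 w) (bounded_rv_cst 1).
have -> : (fun w => 1 * \prod_(i < n) in_cell (s N (v i) (pi w)) (s N (v i).+1 (pi w)) (X i w)) =
    (fun w => grid_cells N (fun i => tnth t i : nat) w).
  apply/funext => w; rewrite mul1r; apply: eq_bigr => i _; by rewrite vE.
move=> ->//; last 3 first.
- by move=> i; exact: (measurable_grid_point atomP).
- by move=> i; exact: (measurable_grid_point atomP).
- move=> i w; have /andP[a0 _] := grid_point01 atom N (v i) w.
  have /andP[_ b1] := grid_point01 atom N (v i).+1 w.
  by split => //; exact: grid_pointS.
transitivity (Ex P (fun w => \prod_(k < K)
  ((1 - grid_ratio atom N k w) ^+ nth 0%N (label_counts K (tnth t)) k *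
   grid_ratio atom N k w ^+ sumn (drop k.+1 (label_counts K (tnth t)))))).
  apply: (congr1 (Ex P)); apply/funext => w; rewrite mul1r -(prod_cells (fun k => grid_ratio atom N k w)).
  by apply: eq_bigr => i _; rewrite grid_cell vE.
have -> := Ex_mixed theta_gt0 atomP (mesh_gt0 N) K
  (nth 0%N (label_counts K (tnth t)))
  (fun k => sumn (drop k.+1 (label_counts K (tnth t)))).
by rewrite /counts_moment size_map size_iota.
Qed.

Lemma Ex_grid_indicator lam N K : all (leq 1) lam -> sumn lam = n ->
  Ex P' (grid_indicator lam N K) =
  n`!%:R / (\prod_(l <- lam) l`!)%:R * grid_sum theta (mesh N) K lam.
Proof.
move=> lpos ln; rewrite -sum_label_composition// Ex_sum; last first.
  by move=> t _; exact: bounded_grid_indicator_term.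
rewrite [RHS]big_mkcond; apply: eq_bigr => t _.
transitivity ((label_composition K (fun i => tnth t i) == lam)%:R *
    Ex P' (fun w => grid_cells N (fun i => tnth t i : nat) w)).
  rewrite -ExZl; last exact: bounded_grid_cells.
  by apply: (congr1 (Ex P')); apply/funext => w; rewrite mulrC.
by rewrite Ex_grid_cells; case: ifP => _; rewrite ?mul1r ?mul0r.
Qed.

Definition grid_event lam N : set T' :=
  [set w | exists kappa K, [/\ in_grid N kappa w, forall i, (kappa i < K)%N
                             & label_composition K kappa = lam]].

(** Here K tends to infinity at a fixed mesh; the mesh is refined only afterwards. The limit in K is
    needed because finitely many cells need not reach all the sample points. *)
Lemma grid_event_probability lam N : all (leq 1) lam -> sumn lam = n ->
  has_probability P' (grid_event lam N)
    (n`!%:R / (\prod_(l <- lam) l`!)%:R * grid_limit theta (mesh N) lam)%:E.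
Proof.
move=> lpos ln; apply: (@has_probability_cvg _ _ _ _ (grid_indicator lam N) 1).
- by move=> K; exact: measurable_grid_indicator.
- move=> K w.
  have G01 (kappa : 'I_n -> nat) : 0 <= ((label_composition K kappa == lam)%:R : R) <= 1.
    by case: (_ == _); rewrite !lexx ler01.
  have /andP[g0 g1] := sum_cells01 (ms N w) K (fun i : 'I_n => X i w) G01.
  by rewrite ger0_norm.
- apply: aeW => w; have [[kappa Hk]|nk] := pselect (exists kappa, in_grid N kappa w); last first.
    apply: nearW => K; rewrite /grid_indicator.
    rewrite (sum_cells0 (fun kappa => (label_composition K kappa == lam)%:R)) ?memNset//.
      by move=> [kappa [_ [Hk _ _]]]; apply: nk; exists kappa.
    by move=> [kappa [Hk _]]; apply: nk; exists kappa.
  exists (\max_i (kappa i)).+1 => // K /= kK.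
  have kK' i : (kappa i < K)%N by apply: leq_trans kK; rewrite ltnS; exact: leq_bigmax.
  rewrite /grid_indicator.
  rewrite (sum_cellsE (ms N w) (fun kappa => (label_composition K kappa == lam)%:R) Hk kK').
  congr ((nat_of_bool _)%:R).
  apply/eqP/idP => [e|/set_mem[k' [K' [Hk' kK0 e]]]].
    by apply/mem_set; exists kappa, K.
  have ek : kappa = k' by apply/funext; exact: (in_cells_inj (ms N w) Hk Hk').
  rewrite -e -ek; rewrite -ek in kK0.
  rewrite -(label_composition_widen kK' (leq_maxl K K')).
  by rewrite -(label_composition_widen kK0 (leq_maxr K K')).
- have -> : (fun K => Ex P' (grid_indicator lam N K)) =
      (fun K => n`!%:R / (\prod_(l <- lam) l`!)%:R * grid_sum theta (mesh N) K lam).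
    by apply/funext => K; exact: Ex_grid_indicator.
  apply: cvgMr; apply: grid_sum_cvg => //; first exact: mesh_gt0.
  by move=> a b; exact: (mixed_moment_ge0 theta_gt0 atomP (mesh_gt0 N)).
Qed.

Lemma sampled_composition_probability lam : all (leq 1) lam -> sumn lam = n ->
  has_probability P'
    [set w | paintbox_composition (geometric_paintbox (fun j => atom j (pi w)))
               [seq X i w | i : 'I_n <- enum 'I_n] = lam]
    (g theta lam)%:E.
Proof.
move=> lpos ln.
have /choice[A HA] N := grid_event_probability N lpos ln.
have mA N : measurable (A N) by case: (HA N).
apply: (@has_probability_cvg _ _ _ _ (fun N => \1_(A N)) 1).
- by move=> N; exact: measurable_indic.
- by move=> N w; rewrite indicE; case: (_ \in _); rewrite ?normr1 ?normr0.
- have AE : {ae P', forall w, forall N, A N w <-> grid_event lam N w}.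
    by apply: ae_foralln => N; case: (HA N).
  have tame := ae_pi mpi mX ExX (tame_atoms_ae theta_gt0 atomP).
  have good : {ae P', forall w, forall i : 'I_n, good_point (fun j => atom j (pi w)) (X i w)}.
    by apply: filter_forall => i; exact: (good_points_ae theta_gt0 atomP mpi mX ExX).
  apply: filterS3 AE tame good => w AE tame good.
  have [N0 _ HN0] := composition_eventually tame good.
  exists N0 => // N /HN0 HN; rewrite indicE; congr ((nat_of_bool _)%:R).
  have cells : exists kappa, in_grid N kappa w.
    have /choice[kappa Hk] (i : 'I_n) : exists k, s N k (pi w) <= X i w < s N k.+1 (pi w).
      have [/andP[x0 x1] _] := good i.
      apply: cell_exists; first by rewrite grid_point0 ltW.
      have [_ _ lim] := tame.
      have [|t tS] := lim (1 - X i w); first by rewrite subr_gt0.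
      (* S exceeds the point at the integer time t, which is the grid time of this index. *)
      exists (t * 2 ^ N)%N; rewrite grid_pointE// natrM -mulrA pow2_mesh mulr1.
      by move: tS; rewrite subKr.
    by exists kappa.
  have [kappa Hk] := cells.
  pose K := (\max_i (kappa i)).+1.
  have kK i : (kappa i < K)%N by rewrite ltnS; exact: leq_bigmax.
  have compE : paintbox_composition (geometric_paintbox (fun j => atom j (pi w)))
      [seq X i w | i : 'I_n <- enum 'I_n] = label_composition K kappa.
    by apply: HN => // i; rewrite -!grid_pointE.
  apply/idP/idP => /set_mem.
    move=> /AE[k' [K' [Hk' kK' e]]]; apply/mem_set => /=; rewrite -e.
    by apply: HN => // i; rewrite -!grid_pointE.
  by rewrite /= compE => e; apply/mem_set/AE; exists kappa, K.
- have -> : (fun N => Ex P' \1_(A N)) = (fun N =>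
      n`!%:R / (\prod_(l <- lam) l`!)%:R * grid_limit theta (mesh N) lam).
    apply/funext => N; apply: EFin_inj; rewrite Ex_indic//.
    by case: (HA N).
  rewrite -multinomial_beta_limit// ln; apply: cvgMr; exact: grid_limit_cvg.
Qed.

End grid_expectation.

(** * Transfer to the given sample *)

(** The label of a point is the number of points in the blocks before its own: it is constant on
    blocks, increases from block to block and is below n. So two finite relations determine the
    composition. *)
Definition order_composition n (same prec : rel 'I_n) : seq nat :=
  label_composition n (fun i => #|[pred j | ~~ same j i & prec j i]|).

Lemma paintbox_composition_order (R : realType) (U : set R) n (x : 'I_n -> R) :
  (forall i, U (x i)) ->
  paintbox_composition U [seq x i | i <- enum 'I_n] =
  order_composition
    (fun i j => `[< `[Num.min (x i) (x j), Num.max (x i) (x j)]%classic `<=` U >])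
    (fun i j => x i < x j).
Proof.
move=> Ux; set same := fun i j => _.
have sameC i j : same i j = same j i by rewrite /same minC maxC.
have same_refl i : same i i.
  apply/asboolP => y /=; rewrite minxx maxxx in_itv/= => yx.
  by rewrite -(le_anti yx).
have same_sub i j k : x i <= x j -> x j <= x k -> same i k -> same i j /\ same j k.
  move=> ij jk /asboolP sub; split; apply/asboolP => y /=; rewrite in_itv/=.
    rewrite min_l// max_r// => /andP[iy yj]; apply: sub => /=.
    by rewrite in_itv/= ge_min le_max iy (le_trans yj jk) orbT.
  rewrite min_l// max_r// => /andP[jy yk]; apply: sub => /=.
  by rewrite in_itv/= ge_min le_max (le_trans ij jy) yk orbT.
pose prec i := [pred j | ~~ same j i & x j < x i].
have sub_prec i j : x i <= x j -> {subset prec i <= prec j}.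
  move=> ij k; rewrite !inE => /andP[ki xki]; rewrite (lt_le_trans xki ij) andbT.
  by apply: contra ki => kj; have [] := same_sub _ _ _ (ltW xki) ij kj.
have le_prec i j : x i <= x j -> (#|prec i| <= #|prec j|)%N.
  by move=> ij; apply: subset_leq_card; apply/fintype.subsetP; exact: sub_prec.
have lt_prec i j : x i < x j -> ~~ same i j -> (#|prec i| < #|prec j|)%N.
  move=> ij nij; apply: proper_card; apply/properP; split.
    by apply/fintype.subsetP; apply: sub_prec; exact: ltW.
  by exists i; rewrite !inE ?nij ?ij// same_refl.
apply: paintbox_composition_labels.
- move=> i; rewrite -[ltnRHS]card_ord; apply: proper_card; apply/properP; split.
    exact/fintype.subsetP.
  by exists i; rewrite // !inE same_refl.
- by move=> i j ij; rewrite ltNge; apply/negP => /le_prec; rewrite leqNgt ij.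
- move=> i j; rewrite paintbox_blockP//; split=> [/asboolP sij|].
    have same_le k l : x k <= x l -> same k l -> {subset prec l <= prec k}.
      move=> kl skl m; rewrite !inE => /andP[ml xml].
      have [km|mk] := leP (x k) (x m).
        by case/negP: ml; have [] := same_sub _ _ _ km (ltW xml) skl.
      rewrite andbT; apply: contra ml => smk; apply/asboolP => y /=.
      rewrite in_itv/= min_l ?max_r ?(ltW xml)// => /andP[my yl].
      have [yk|ky] := leP y (x k).
        by move/asboolP: smk; apply; rewrite /= in_itv/= ge_min le_max my yk orbT.
      move/asboolP: skl; apply.
      by rewrite /= in_itv/= ge_min le_max (ltW ky) yl orbT.
    apply/eqP; rewrite eqn_leq.
    case: (leP (x i) (x j)) => ij.
      rewrite le_prec//=; apply: subset_leq_card; apply/fintype.subsetP.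
      exact: same_le.
    rewrite (le_prec j i) ?ltW// andbT; apply: subset_leq_card; apply/fintype.subsetP.
    by apply: same_le; rewrite ?(ltW ij) // sameC.
  move=> kij; apply/asboolP; rewrite -/(same i j).
  have [ij|ij|ij] := ltgtP (x i) (x j).
  - by apply: contraT => /(lt_prec _ _ ij); rewrite /prec kij ltnn.
  - by rewrite sameC; apply: contraT => /(lt_prec _ _ ij); rewrite /prec kij ltnn.
  - apply/asboolP => y /=; rewrite ij minxx maxxx in_itv/= => yx.
    by rewrite -(le_anti yx).
Qed.

Section dyadic_hulls.
Context {R : realType}.
Variable a : nat -> R * R.
Hypothesis tame : tame_atoms a.

Local Notation U := (geometric_paintbox a).

(** It replaces the segment between two sample points: it contains that segment, but its end points
    depend only on the dyadic cells of the points. *)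
Definition dyadic_hull M k l : set R :=
  `[(minn k l)%:R * mesh M, (maxn k l).+1%:R * mesh M]%classic.

Lemma dyadic_cell_exists M (x : R) : 0 <= x < 1 ->
  exists2 k, (k < 2 ^ M)%N & k%:R * mesh M <= x < k.+1%:R * mesh M.
Proof.
have top : (2 ^ M)%:R * mesh M = 1 :> R := pow2_mesh M.
move=> /andP[x0 x1].
have [||k kx] := @cell_exists _ (fun k => k%:R * mesh M) x.
- by rewrite mul0r.
- by exists (2 ^ M)%N; rewrite top.
exists k => //; have /andP[kx1 _] := kx; have := le_lt_trans kx1 x1.
by rewrite -[ltRHS]top ltr_pM2r ?mesh_gt0// ltr_nat.
Qed.

(** The hull contains the segment, so only one inclusion needs a fine mesh: a segment inside U has a
    margin around it that is free of values of S, and the hull eventually fits into it. *)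
Lemma dyadic_hull_eventually n (x : 'I_n -> R) :
  (forall i, 0 <= x i < 1) -> (forall i, U (x i)) ->
  \forall M \near \oo, forall c : 'I_n -> nat,
    (forall i, (c i)%:R * mesh M <= x i < (c i).+1%:R * mesh M) ->
    forall i j,
    (dyadic_hull M (c i) (c j) `<=` U <->
       `[Num.min (x i) (x j), Num.max (x i) (x j)]%classic `<=` U) /\
    (c i < c j)%N = (x i < x j).
Proof.
move=> x01 Ux.
suff H i j : \forall M \near \oo, forall c : 'I_n -> nat,
    (forall i, (c i)%:R * mesh M <= x i < (c i).+1%:R * mesh M) ->
    (dyadic_hull M (c i) (c j) `<=` U <->
       `[Num.min (x i) (x j), Num.max (x i) (x j)]%classic `<=` U) /\
    (c i < c j)%N = (x i < x j).
  have : \forall M \near \oo, forall i j, forall c : 'I_n -> nat,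
    (forall i, (c i)%:R * mesh M <= x i < (c i).+1%:R * mesh M) ->
    (dyadic_hull M (c i) (c j) `<=` U <->
       `[Num.min (x i) (x j), Num.max (x i) (x j)]%classic `<=` U) /\
    (c i < c j)%N = (x i < x j).
    by apply: filter_forall => i; apply: filter_forall => j; exact: H.
  by apply: filterS => M HM c cx i j; exact: HM.
have mesh_near (e : R) : 0 < e -> \forall M \near \oo, mesh M < e.
  move=> e0; have := @mesh_cvg R; move/cvgrPdist_lt/(_ _ e0); apply: filterS => M.
  by rewrite sub0r normrN ger0_norm// ltW// mesh_gt0.
have hull_near : \forall M \near \oo, forall c : 'I_n -> nat,
    (forall i, (c i)%:R * mesh M <= x i < (c i).+1%:R * mesh M) ->
    `[Num.min (x i) (x j), Num.max (x i) (x j)]%classic `<=` U ->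
    dyadic_hull M (c i) (c j) `<=` U.
  have [sub|nsub] := pselect (`[Num.min (x i) (x j), Num.max (x i) (x j)]%classic `<=` U);
    last by apply: nearW => M c _ /nsub.
  have /andP[i0 i1] := x01 i; have /andP[j0 j1] := x01 j.
  have [|||m Hm] := (paintbox_segmentP tame _ _ _).1 sub.
  - by rewrite le_min i0.
  - by rewrite ge_min le_max lexx.
  - by rewrite ge_max !ltW.
  have m0 : 0 < (m.+1%:R^-1 : R) by [].
  (* One half of the margin is spent on enlarging the segment by a mesh on each side; the other half
     remains around the hull. *)
  have m2 : 0 < (m.+1%:R^-1 / 2 : R) by rewrite divr_gt0.
  apply: filterS (mesh_near _ m2) => M meshm c cx _.
  have d0 : 0 < mesh M :> R by exact: mesh_gt0.
  have lo : Num.min (x i) (x j) - mesh M <= (minn (c i) (c j))%:R * mesh M.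
    have := cx i; have := cx j; rewrite -!(natr1 (c _)) !mulrDl !mul1r.
    move=> /andP[_ xj] /andP[_ xi]; rewrite lerBlDr.
    by case: (leqP (c i) (c j)) => _; rewrite ge_min ?(ltW xi) ?(ltW xj) ?orbT.
  have hi : (maxn (c i) (c j)).+1%:R * mesh M <= Num.max (x i) (x j) + mesh M.
    have := cx i; have := cx j; rewrite -!(natr1 (maxn _ _)) !mulrDl !mul1r lerD2r.
    move=> /andP[xj _] /andP[xi _].
    by case: (leqP (c i) (c j)) => _; rewrite le_max ?xi ?xj ?orbT.
  have hi1 : (maxn (c i) (c j)).+1%:R * mesh M <= 1 :> R.
    have top : (2 ^ M)%:R * mesh M = 1 :> R := pow2_mesh M.
    rewrite -[leRHS]top ler_pM2r// ler_nat -(ltr_nat R) -(ltr_pM2r d0) top.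
    have := cx i; have := cx j => /andP[xj _] /andP[xi _].
    by case: (leqP (c i) (c j)) => _; [exact: le_lt_trans j1|exact: le_lt_trans i1].
  apply: (segment_subset_paintbox tame _ hi1 m2) => [|N k /andP[S1 S2]].
    by rewrite mulr_ge0// ltW.
  apply: (Hm N k); move: (m.+1%:R^-1) m0 meshm S1 S2 => v m0 meshm S1 S2.
  by apply/andP; split; lra.
have prec_near : \forall M \near \oo, forall c : 'I_n -> nat,
    (forall i, (c i)%:R * mesh M <= x i < (c i).+1%:R * mesh M) ->
    x i < x j -> (c i < c j)%N.
  have [ij|nij] := ltP (x i) (x j); last by apply: nearW.
  apply: (filterS _ (mesh_near (x j - x i) _)); last by rewrite subr_gt0.
  move=> M Mij c cx _; have /andP[ci _] := cx i; have /andP[_ cj] := cx j.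
  rewrite -ltnS -(ltr_nat R) -(ltr_pM2r (mesh_gt0 M)); apply: le_lt_trans cj.
  rewrite -natr1 mulrDl mul1r; lra.
apply: filterS2 hull_near prec_near => M hull_M prec_M c cx; split.
  split=> [hull y|]; last exact: hull_M.
  rewrite /= in_itv/= => /andP[ly yh]; apply: hull; rewrite /dyadic_hull/= in_itv/=.
  have d0 : 0 <= mesh M :> R by rewrite ltW// mesh_gt0.
  have /andP[ci ci'] := cx i; have /andP[cj cj'] := cx j; apply/andP; split.
    apply: le_trans ly; rewrite le_min; apply/andP; split.
      by apply: le_trans ci; rewrite ler_wpM2r// ler_nat geq_minl.
    by apply: le_trans cj; rewrite ler_wpM2r// ler_nat geq_minr.
  apply: le_trans yh _; rewrite ge_max; apply/andP; split.
    by apply: le_trans (ltW ci') _; rewrite ler_wpM2r// ler_nat ltnS leq_maxl.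
  by apply: le_trans (ltW cj') _; rewrite ler_wpM2r// ler_nat ltnS leq_maxr.
apply/idP/idP; last exact: prec_M.
move=> cij; have /andP[_ ci] := cx i; have /andP[cj _] := cx j.
apply: lt_le_trans ci (le_trans _ cj).
by rewrite ler_wpM2r ?ler_nat// ltW// mesh_gt0.
Qed.

Lemma order_composition_eventually n (x : 'I_n -> R) :
  (forall i, 0 <= x i < 1) -> (forall i, U (x i)) ->
  \forall M \near \oo, forall c : 'I_n -> nat,
    (forall i, (c i)%:R * mesh M <= x i < (c i).+1%:R * mesh M) ->
    order_composition (fun i j => `[< dyadic_hull M (c i) (c j) `<=` U >])
      (fun i j => (c i < c j)%N) =
    paintbox_composition U [seq x i | i <- enum 'I_n].
Proof.
move=> x01 Ux; apply: filterS (dyadic_hull_eventually x01 Ux) => M HM c cx.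
rewrite paintbox_composition_order//; congr order_composition.
  by apply/funext => i; apply/funext => j; apply: asbool_equiv_eq; case: (HM c cx i j).
by apply/funext => i; apply/funext => j; case: (HM c cx i j).
Qed.

Lemma dyadic_hull_diag M k (x : R) : k%:R * mesh M <= x < k.+1%:R * mesh M ->
  dyadic_hull M k k `<=` U -> U x.
Proof.
move=> /andP[kx xk]; apply; rewrite /dyadic_hull/= minnn maxnn in_itv/= kx ltW//.
Qed.

End dyadic_hulls.

(** F sees finitely many truth values, so the event is a finite union, over boolean matrices, of
    intersections of the Q i j or their complements. *)
Lemma measurable_rel_event d (T : measurableType d) n (Q : 'I_n -> 'I_n -> set T)
    (F : rel 'I_n -> bool) : (forall i j, measurable (Q i j)) ->
  measurable [set w | F (fun i j => `[< Q i j w >])].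
Proof.
move=> mQ; pose D := [set rho : {ffun 'I_n * 'I_n -> bool} | F (fun i j => rho (i, j))].
rewrite (_ : [set w | _] = \bigcup_(rho in D) \bigcap_(ij in setT)
    (if rho ij then Q ij.1 ij.2 else ~` Q ij.1 ij.2)).
  apply: fin_bigcup_measurable => [|rho _]; first exact: finite_finset.
  apply: fin_bigcap_measurable => [|ij _]; first exact: finite_finset.
  by case: (rho ij); [exact: mQ | exact/measurableC/mQ].
apply/seteqP; split=> w /=.
  move=> Fw; exists [ffun ij => `[< Q ij.1 ij.2 w >]].
    rewrite /D/= (_ : (fun i j => _) = (fun i j => `[< Q i j w >]))//.
    by apply/funext => i; apply/funext => j; rewrite ffunE.
  by move=> ij _; rewrite ffunE; case: asboolP.
move=> [rho Frho Hrho]; rewrite (_ : (fun i j => _) = (fun i j => rho (i, j)))//.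
apply/funext => i; apply/funext => j; have := Hrho (i, j) I.
by case: (rho (i, j)) => /= H; [exact/asboolP | exact/asboolPn].
Qed.

Section independent_sample.
Context {R : realType} {d : measure_display} {T : measurableType d}.
Variables (P : probability T R) (U : T -> set R) (n : nat) (X : 'I_n -> {RV P >-> R}).
Hypothesis HX : uniform_sample U X.

Lemma uniform_sample_cell i (a b : R) : 0 <= a -> a <= b -> b <= 1 ->
  P (X i @^-1` `[a, b[) = (b - a)%:E.
Proof.
by move=> a0 ab b1; rewrite -uniform_prob_itv// -(HX.1 i _ (measurable_itv _)).
Qed.

Lemma uniform_sample_ae : {ae P, forall w, forall i, 0 <= X i w < 1}.
Proof.
apply: filter_forall => i; pose B := X i @^-1` `[0, 1[.
have mB : measurable B by rewrite -[B]setTI; exact: (measurable_funPT (X i)).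
exists (~` B); split; first exact: measurableC.
  by rewrite probability_setC// uniform_sample_cell// subr0 subee.
by move=> w /= nw Bw; apply: nw; move: Bw; rewrite /B/= in_itv.
Qed.

Lemma Ex_uniform_sample (a b : 'I_n -> R) (D : set T) :
  (forall i, [/\ 0 <= a i, a i <= b i & b i <= 1]) ->
  ae_events P (open_set_events U) D ->
  Ex P (fun w => \prod_i in_cell (a i) (b i) (X i w) * \1_D w) =
  (\prod_i (b i - a i)) * Ex P \1_D.
Proof.
move=> ab HD; have [mD _] := HD.
pose A (o : option 'I_n) := if o is Some i then X i @^-1` `[a i, b i[ else D.
pose l : seq (option 'I_n) := None :: map Some (enum 'I_n).
have ul : uniq l.
  rewrite /= map_inj_uniq ?enum_uniq ?andbT; last by move=> i j [].
  by apply/negP => /mapP[].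
have inl o : o \in l by case: o => [i|]; rewrite // inE/= mem_map ?mem_enum// => ? ? [].
pose J := seq_fset tt l.
have mA o : measurable (A o).
  case: o => [i|//]; rewrite -[A _]setTI.
  exact: (measurable_funPT (X i)).
have mB : measurable (\bigcap_(o in [set` J]) A o).
  by apply: fin_bigcap_measurable => // o _; exact: mA.
have := HX.2 J A; rewrite (perm_big l); last first.
  by rewrite (perm_trans (seq_fset_perm _ _))// undup_id.
rewrite big_cons big_map big_enum/= => e.
have {}e : P (\bigcap_(o in [set` J]) A o) = (P D * \prod_i (b i - a i)%:E)%E.
  rewrite e.
    by congr (_ * _)%E; apply: eq_big => // i _; have [a0 aib b1] := ab i; exact: uniform_sample_cell.
  case=> [i _|//]; exists `[a i, b i[%classic; [exact: measurable_itv | by rewrite setTI].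
apply: EFin_inj; rewrite (_ : (fun w => _) = \1_(\bigcap_(o in [set` J]) A o)).
  rewrite Ex_indic// e -Ex_indic// EFinM muleC; congr (_ * _)%E.
  by rewrite -prodEFin.
apply/funext => w; rewrite !indicE; case: (boolP (w \in \bigcap_(o in _) _)) => [/set_mem H|/negP H].
  have HA o : A o w by apply: H; rewrite /= seq_fsetE.
  rewrite (mem_set (HA None)) mulr1 big1// => i _.
  by have := HA (Some i); rewrite /A/= in_itv/= /in_cell => ->.
case: (boolP (w \in D)) => [/set_mem Dw|_]; last by rewrite mulr0.
rewrite mulr1; apply/eqP; apply: contrapT => nz; apply: H; apply/mem_set => -[i|//] _.
apply: contrapT => ni; apply: nz; rewrite (bigD1 i)//= {1}/in_cell.
move: ni; rewrite /A/= in_itv/= => /negP/negbTE ->; by rewrite mul0r.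
Qed.

End independent_sample.

Section transfer.
Context {R : realType} {d : measure_display} {T : measurableType d}.
Variables (theta : R) (theta_gt0 : 0 < theta) (P : probability T R).
Variable atom : nat -> T -> R * R.
Hypothesis atomP : poisson_process P (strip_intensity theta) atom.
Variable n : nat.

Local Notation s := (grid_point atom).
Local Notation Ug := (fun w => geometric_paintbox (fun j => atom j w)).

(* A measurable event that agrees with dyadic_hull M k l `<=` Ug for tame atoms. *)
Definition hull_free M k l : set T :=
  \bigcup_m \bigcap_N \bigcap_j
    ~` ([set w | (minn k l)%:R * mesh M - m.+1%:R^-1 < s N j.+1 w] `&`
        [set w | s N j.+1 w < (maxn k l).+1%:R * mesh M + m.+1%:R^-1]).

Lemma measurable_hull_free M k l : measurable (hull_free M k l).
Proof.
apply: bigcupT_measurable => m; apply: bigcapT_measurable => N.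
apply: bigcapT_measurable => j; apply: measurableC; apply: measurableI.
  rewrite -[X in measurable X]setTI.
  by have /(_ measurableT [set true]) := measurable_fun_ltr
    (measurable_cst ((minn k l)%:R * mesh M - m.+1%:R^-1)) (measurable_grid_point atomP N j.+1);
    exact.
rewrite -[X in measurable X]setTI.
by have /(_ measurableT [set true]) := measurable_fun_ltr
  (measurable_grid_point atomP N j.+1)
  (measurable_cst ((maxn k l).+1%:R * mesh M + m.+1%:R^-1)); exact.
Qed.

Lemma hull_freeP M k l w : tame_atoms (fun j => atom j w) ->
  (k < 2 ^ M)%N -> (l < 2 ^ M)%N ->
  hull_free M k l w <-> dyadic_hull M k l `<=` Ug w.
Proof.
move=> tame kM lM; have d0 : 0 < mesh M :> R by exact: mesh_gt0.
have top : (2 ^ M)%:R * mesh M = 1 :> R := pow2_mesh M.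
rewrite /dyadic_hull (paintbox_segmentP tame).
- split=> [[m _ Hm]|[m Hm]].
    by exists m => N j /andP[lo hi]; apply: (Hm N I j I); rewrite /= grid_pointE.
  exists m => // N _ j _ [lo hi]; apply: (Hm N j).
  by move: lo hi; rewrite /= grid_pointE// => -> ->.
- by rewrite mulr_ge0// ltW.
- by rewrite ler_pM2r// ler_nat ltnW// ltnS (leq_trans (geq_minl _ _) (leq_maxl _ _)).
- by rewrite -[leRHS]top ler_pM2r// ler_nat gtn_max kM.
Qed.

Variable F : ('I_n -> nat) -> rel 'I_n -> bool.

(** F is a test on the cells of the sample and on its hull relation. It will be instantiated twice:
    to read off the composition, and to check that the sample lies in U. *)
Definition hull_event M (c : 'I_n -> nat) : set T :=
  [set w | F c (fun i j => `[< hull_free M (c i) (c j) w >])].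

Lemma measurable_hull_event M c : measurable (hull_event M c).
Proof. by apply: measurable_rel_event => i j; exact: measurable_hull_free. Qed.

Lemma hull_event_subset M c w : tame_atoms (fun j => atom j w) ->
  (forall i, (c i < 2 ^ M)%N) ->
  hull_event M c w = F c (fun i j => `[< dyadic_hull M (c i) (c j) `<=` Ug w >]).
Proof.
move=> tame cM; rewrite /hull_event/=; congr (is_true (F c _)).
apply/funext => i; apply/funext => j; apply: asbool_equiv_eq.
exact: hull_freeP.
Qed.

(** The inclusions of hulls in U generate [open_set_events] but are not given as measurable on T,
    whereas [hull_event] is measurable. The two agree for tame atoms, as [ae_events] requires. *)
Lemma hull_event_ae M c : (forall i, (c i < 2 ^ M)%N) ->
  ae_events P (open_set_events Ug) (hull_event M c).
Proof.
move=> cM; split; first exact: measurable_hull_event.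
exists [set w | F c (fun i j => `[< dyadic_hull M (c i) (c j) `<=` Ug w >])]; last first.
  apply: filterS (tame_atoms_ae theta_gt0 atomP) => w tame.
  by rewrite hull_event_subset.
pose G := range (fun ab : R * R => [set w | `[ab.1, ab.2] `<=` Ug w]).
apply: (@measurable_rel_event _ (g_sigma_algebraType G) n
  (fun i j => [set w | dyadic_hull M (c i) (c j) `<=` Ug w])) => i j.
apply: sub_sigma_algebra.
by exists ((minn (c i) (c j))%:R * mesh M, (maxn (c i) (c j)).+1%:R * mesh M).
Qed.

(* The sample points enter only through their dyadic cells, and U only through
   events of the form `[q, r] `<=` U, so the expectation of this sum is
   determined by the independence of the sample and U. *)
Definition dyadic_sum (S : Type) (p : S -> T) (Y : 'I_n -> S -> R) M (w : S) : R :=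
  \sum_(t : n.-tuple 'I_(2 ^ M))
    cells_indicator (fun k => k%:R * mesh M) (fun i => tnth t i) (Y^~ w) *
    \1_(hull_event M (fun i => tnth t i)) (p w).

Let mesh_mono M : {homo (fun k => k%:R * mesh M : R) : k l / (k <= l)%N >-> k <= l}.
Proof. by move=> k l kl; rewrite ler_wpM2r ?ler_nat// ltW// mesh_gt0. Qed.

Section dyadic_sum_values.
Variables (S : Type) (p : S -> T) (Y : 'I_n -> S -> R) (w : S).

Lemma dyadic_sum01 M : 0 <= dyadic_sum p Y M w <= 1.
Proof.
apply: (sum_cells01 (mesh_mono M) (2 ^ M) (Y^~ w)
  (G := fun c => \1_(hull_event M c) (p w))) => c.
by rewrite indicE; case: (_ \in _); rewrite !lexx ler01.
Qed.

Lemma dyadic_sumE M : (forall i, 0 <= Y i w < 1) ->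
  exists c, [/\ in_cells (fun k => k%:R * mesh M) c (Y^~ w),
    forall i, (c i < 2 ^ M)%N & dyadic_sum p Y M w = \1_(hull_event M c) (p w)].
Proof.
move=> Y01; have /choice[c Hc] i : exists k,
    (k < 2 ^ M)%N /\ k%:R * mesh M <= Y i w < k.+1%:R * mesh M.
  by have [k kM kY] := dyadic_cell_exists M (Y01 i); exists k.
have Yc : in_cells (fun k => k%:R * mesh M) c (Y^~ w) by move=> i; case: (Hc i).
have cM i : (c i < 2 ^ M)%N by case: (Hc i).
exists c; split => //.
exact: (sum_cellsE (mesh_mono M) (fun c => \1_(hull_event M c) (p w)) Yc cM).
Qed.

End dyadic_sum_values.

Section dyadic_sum_expectation.
Context {dS : measure_display} {S : measurableType dS}.
Variables (Q : probability S R) (p : S -> T) (Y : 'I_n -> S -> R).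
Hypothesis mp : measurable_fun setT p.
Hypothesis mY : forall i, measurable_fun setT (Y i).

Lemma bounded_dyadic_term M (c : 'I_n -> nat) : bounded_rv (fun w =>
  cells_indicator (fun k => k%:R * mesh M) c (Y^~ w) * \1_(hull_event M c) (p w)).
Proof.
apply: bounded_rvM.
  apply: bounded_rv_prod => i _; apply: bounded_rv01; last by move=> w; exact: in_cell01.
  by apply: measurable_in_cell.
apply: bounded_rv01; last first.
  by move=> w; rewrite indicE; case: (_ \in _); rewrite !lexx ler01.
by apply: (measurableT_comp _ mp); exact/measurable_indic/measurable_hull_event.
Qed.

Lemma bounded_dyadic_sum M : bounded_rv (dyadic_sum p Y M).
Proof.
exact: (@bounded_rv_sum _ _ _ _ (index_enum (n.-tuple 'I_(2 ^ M))) xpredT _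
  (fun t _ => bounded_dyadic_term M (fun i => tnth t i))).
Qed.

Hypothesis ExY : forall M (c : 'I_n -> nat), (forall i, (c i < 2 ^ M)%N) ->
  Ex Q (fun w => cells_indicator (fun k => k%:R * mesh M) c (Y^~ w) *
    \1_(hull_event M c) (p w)) =
  \prod_(i < n) ((c i).+1%:R * mesh M - (c i)%:R * mesh M) * Ex P \1_(hull_event M c).

(** The right side no longer mentions Q, p or Y, so the given and the adjoined sample have the same
    expectation. *)
Lemma Ex_dyadic_sum M : Ex Q (dyadic_sum p Y M) =
  \sum_(t : n.-tuple 'I_(2 ^ M))
    \prod_(i < n) ((tnth t i).+1%:R * mesh M - (tnth t i)%:R * mesh M) *
    Ex P \1_(hull_event M (fun i => tnth t i)).
Proof.
rewrite /dyadic_sum Ex_sum; last by move=> t _; exact: bounded_dyadic_term.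
by apply: eq_bigr => t _; apply: ExY => i; exact: ltn_ord.
Qed.

End dyadic_sum_expectation.

Lemma dyadic_cell_bounds M k : (k < 2 ^ M)%N ->
  [/\ 0 <= k%:R * mesh M :> R, k%:R * mesh M <= k.+1%:R * mesh M :> R &
      k.+1%:R * mesh M <= 1 :> R].
Proof.
move=> kM; have d0 : 0 < mesh M :> R by exact: mesh_gt0.
have top : (2 ^ M)%:R * mesh M = 1 :> R := pow2_mesh M.
split; first by rewrite mulr_ge0// ltW.
- exact: mesh_mono.
- by rewrite -[leRHS]top ler_pM2r// ler_nat.
Qed.

End transfer.

Section dyadic_limits.
Context {R : realType} {d : measure_display} {T : measurableType d}.
Variables (atom : nat -> T -> R * R) (n : nat).
Variables (S : Type) (p : S -> T) (Y : 'I_n -> S -> R) (w : S).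

Local Notation U := (geometric_paintbox (fun j => atom j (p w))).

Hypothesis tame : tame_atoms (fun j => atom j (p w)).
Hypothesis Y01 : forall i, 0 <= Y i w < 1.

Definition composition_test lam (c : 'I_n -> nat) (same : rel 'I_n) : bool :=
  order_composition same (fun i j => (c i < c j)%N) == lam.

(** For the hull relation, [same i i] says that the closed dyadic cell of the i-th point lies in
    U. *)
Definition interior_test (c : 'I_n -> nat) (same : rel 'I_n) : bool :=
  [forall i, same i i].

Lemma dyadic_sum_composition lam : (forall i, U (Y i w)) ->
  \forall M \near \oo, dyadic_sum atom (composition_test lam) p Y M w =
    (paintbox_composition U [seq Y i w | i <- enum 'I_n] == lam)%:R.
Proof.
move=> UY; apply: filterS (order_composition_eventually tame Y01 UY) => M HM.
have [c [Yc cM ->]] := dyadic_sumE atom (composition_test lam) p M Y01.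
rewrite indicE; congr ((nat_of_bool _)%:R).
rewrite -(HM c Yc); apply/idP/idP => [/set_mem|H]; first by rewrite hull_event_subset.
by apply/mem_set; rewrite hull_event_subset.
Qed.

Lemma dyadic_sum_interior : (forall i, U (Y i w)) ->
  \forall M \near \oo, dyadic_sum atom interior_test p Y M w = 1.
Proof.
move=> UY; apply: filterS (dyadic_hull_eventually tame Y01 UY) => M HM.
have [c [Yc cM ->]] := dyadic_sumE atom interior_test p M Y01.
rewrite indicE mem_set// hull_event_subset//; apply/forallP => i; apply/asboolP.
apply/(HM c Yc i i).1 => y; rewrite /= minxx maxxx in_itv/= => yY.
by rewrite -(le_anti yY).
Qed.

Lemma dyadic_sum_gt0 M : 0 < dyadic_sum atom interior_test p Y M w ->
  forall i, U (Y i w).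
Proof.
have [c [Yc cM ->]] := dyadic_sumE atom interior_test p M Y01.
rewrite indicE; case: (boolP (p w \in _)) => [/set_mem H _ i|]; last by rewrite ltxx.
move: H; rewrite hull_event_subset// => /forallP/(_ i)/asboolP.
exact: dyadic_hull_diag (Yc i).
Qed.

End dyadic_limits.

Theorem theorem4 (R : realType) (theta : R) (theta_gt0 : 0 < theta)
    (d : measure_display) (T : measurableType d) (P : probability T R)
    (atom : nat -> T -> R * R)
    (atomP : poisson_process P (strip_intensity theta) atom) :
  let Ug := fun w => geometric_paintbox (fun j => atom j w) in
  forall (n : nat) (X : 'I_n -> {RV P >-> R}) (lambda : seq nat),
    (0 < n)%N -> uniform_sample Ug X -> is_composition n lambda ->
    has_probability P
      [set w | paintbox_composition (Ug w) [seq X i w | i <- enum 'I_n]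
               = lambda]
      (g theta lambda)%:E.
Proof.
move=> Ug n X lam _ HX /andP[lpos /eqP ln].
have [d' [T' [P' [pi [X' [mpi mX' ExX]]]]]] := sample_extension P n.
pose Y (i : 'I_n) : T' -> R := X' i.
have tame := tame_atoms_ae theta_gt0 atomP.
have tame' := ae_pi mpi mX' ExX tame.
have good' : {ae P', forall w, forall i : 'I_n,
    good_point (fun j => atom j (pi w)) (X' i w)}.
  by apply: filter_forall => i; exact: (good_points_ae theta_gt0 atomP mpi mX' ExX).
have X01 := uniform_sample_ae HX.
have mX i : measurable_fun setT (X i) by exact: measurable_funPT.
have cells_extension F K (c : 'I_n -> nat) : (forall i, (c i < 2 ^ K)%N) ->
    Ex P' (fun w => cells_indicator (fun k => k%:R * mesh K) c (Y^~ w) *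
      \1_(hull_event atom F K c) (pi w)) =
    \prod_(i < n) ((c i).+1%:R * mesh K - (c i)%:R * mesh K) *
      Ex P \1_(hull_event atom F K c).
  (* The default 0 is a legitimate cell, so the bounds on the boxes hold for every index. *)
  move=> cK; pose v (k : nat) := if insub k is Some i then c i else 0%N.
  have vE (i : 'I_n) : v i = c i by rewrite /v valK.
  have vK k : (v k < 2 ^ K)%N by rewrite /v; case: insub => // *; rewrite expn_gt0.
  have mV : measurable (hull_event atom F K c) by exact: (measurable_hull_event atomP).
  have := @ExX \1_(hull_event atom F K c) (fun k _ => (v k)%:R * mesh K)
    (fun k _ => (v k).+1%:R * mesh K) (bounded_rv_indic mV).
  rewrite (_ : (fun w => \1_(hull_event atom F K c) (pi w) * _) =
    (fun w => cells_indicator (fun k => k%:R * mesh K) c (Y^~ w) *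
      \1_(hull_event atom F K c) (pi w))); last first.
    apply/funext => w; rewrite mulrC; congr (_ * _).
    by apply: eq_bigr => i _; rewrite vE.
  move=> ->//; last by move=> k _; exact: dyadic_cell_bounds.
  rewrite -ExZl; last exact: bounded_rv_indic.
  apply: (congr1 (Ex P)); apply/funext => w; rewrite mulrC; congr (_ * _).
  by apply: eq_bigr => i _; rewrite vE.
have ExT F M : Ex P (dyadic_sum atom F id X M) = Ex P' (dyadic_sum atom F pi Y M).
  rewrite (Ex_dyadic_sum atomP (@measurable_id _ T setT) mX); last first.
    move=> K c cK; apply: (Ex_uniform_sample HX) => [i|].
      exact: dyadic_cell_bounds.
    exact: (hull_event_ae theta_gt0 atomP).
  by rewrite (Ex_dyadic_sum atomP mpi (fun i : 'I_n => mX' i) (@cells_extension F)).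
have bT F M : bounded_rv (dyadic_sum atom F id X M).
  exact: (bounded_dyadic_sum atomP).
have mT' F M : measurable_fun setT (dyadic_sum atom F pi Y M).
  by case: (bounded_dyadic_sum atomP F mpi (fun i : 'I_n => mX' i) M).
have norm1 F S (p : S -> T) (Z : 'I_n -> S -> R) M w : `|dyadic_sum atom F p Z M w| <= 1.
  by have /andP[d0 d1] := dyadic_sum01 atom F p Z w M; rewrite ger0_norm.
have Y01 : {ae P', forall w, forall i, 0 <= Y i w < 1}.
  apply: filterS good' => w good i; have [/andP[x0 x1] _] := good i.
  by rewrite /Y (ltW x0).
(* So far only the adjoined sample is known to avoid the closed range. There the interior test tends
   to 1, so its expectation tends to 1 for X too, and a single success of the test puts all the X i
   in U. *)
have in_paintbox : {ae P, forall w, forall i, Ug w (X i w)}.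
  have c : (fun M => Ex P' (dyadic_sum atom (@interior_test n) pi Y M)) @ \oo --> (1 : R).
    apply: (@cvg_probability _ _ _ _ _ 1 setT) => //.
      apply: filterS3 tame' good' Y01 => w tm good y01.
      apply: filterS (dyadic_sum_interior (p := pi) (atom := atom) tm y01 (fun i => good_point_paintbox tm (good i))).
      by move=> M ->; rewrite mem_set.
    by exists setT; split; [by [] | exact: aeW | exact: probability_setT].
  have small : {ae P, forall w, exists M,
      1 - dyadic_sum atom (@interior_test n) id X M w < 1}.
    apply: (@small_expectation_ae _ _ _ _
      (fun M w => 1 - dyadic_sum atom (@interior_test n) id X M w) 1); last by [].
    - by move=> M; apply: bounded_rvB => //; exact: bounded_rv_cst.
    - by move=> M w; rewrite subr_ge0; case/andP: (dyadic_sum01 atom (@interior_test n) id X w M).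
    rewrite (_ : (fun M => _) = (fun M => 1 - Ex P' (dyadic_sum atom (@interior_test n) pi Y M))).
      by rewrite -(subrr (1 : R)); apply: cvgB => //; exact: cvg_cst.
    by apply/funext => M; rewrite ExB ?Ex_cst ?ExT//; exact: bounded_rv_cst.
  apply: filterS3 tame X01 small => w tm x01 [M].
  by rewrite ltrBlDr ltrDl => /(dyadic_sum_gt0 (p := id) (Y := X) (atom := atom) tm x01).
apply: (@has_probability_cvg _ _ _ _ (dyadic_sum atom (composition_test lam) id X) 1) => //.
- by move=> M; case: (bT (composition_test lam) M).
- apply: filterS3 tame X01 in_paintbox => w tm x01 xU.
  apply: filterS (dyadic_sum_composition (p := id) (Y := X) (atom := atom) tm x01 lam xU) => M e.
  by rewrite {}e; congr ((nat_of_bool _)%:R); apply/eqP/idP => [?|/set_mem//]; exact/mem_set.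
(* Only expectations are left, and they equal those of the adjoined sample, which converge to the
   probability found for it. *)
rewrite (_ : (fun M => _) =
  (fun M => Ex P' (dyadic_sum atom (composition_test lam) pi Y M))); last first.
  by apply/funext => M; rewrite ExT.
apply: (cvg_probability _ (C := 1) _ _
  (sampled_composition_probability theta_gt0 atomP mpi mX' ExX lpos ln)) => //.
apply: filterS3 tame' good' Y01 => w tm good y01.
apply: filterS (dyadic_sum_composition (p := pi) (atom := atom) tm y01 lam
  (fun i => good_point_paintbox tm (good i))) => M e.
rewrite {}e; by congr ((nat_of_bool _)%:R); apply/eqP/idP => [?|/set_mem//]; exact/mem_set.
Qed.
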